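(* Fix $\mu\in\mathbb{R}$, $T\in(0,\infty)$, $n\ge1$ and $\boldsymbol\theta=(\theta_1,\ldots,\theta_n)\in\mathcal{X}_n^{\mathbb{U}}$. For $\kappa\in(0,4]$ let $\boldsymbol\omega^\kappa$ be the unique strong solution of the SDE system $$\mathrm{d}\omega_t^j=\sqrt\kappa\,\mathrm{d}B_t^j+\Big(\mu+2\sum_{i\ne j}\cot\Big(\frac{\omega_t^j-\omega_t^i}{2}\Big)\Big)\mathrm{d}t,\qquad1\le j\le n,$$ with initial data $\boldsymbol\omega_0^\kappa=\boldsymbol\theta$, where $B^1,\ldots,B^n$ are independent standard one-dimensional Brownian motions. Then the family of laws of $\{\boldsymbol\omega^\kappa\}_{\kappa\in(0,4]}$ satisfies the large deviation principle in the space $\mathrm{C}([0,T],\mathcal{X}_n^{\mathbb{U}})$ as $\kappa\to0+$ with good rate function $$\mathcal{I}^{(\mu)}(\boldsymbol\omega_{[0,T]})=\frac12\int_0^T\sum_{j=1}^n\Big(\dot\omega_t^j-\mu-2\sum_{i\ne j}\cot\Big(\frac{\omega_t^j-\omega_t^i}{2}\Big)\Big)^2\mathrm{d}t$$ if $\boldsymbol\omega$ is absolutely continuous on $[0,T]$ and $\boldsymbol\omega_0=\boldsymbol\theta$, and $\mathcal{I}^{(\mu)}(\boldsymbol\omega_{[0,T]})=\infty$ otherwise.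
   Context: $\mathcal{X}_n^{\mathbb{U}}=\{(\theta_1,\ldots,\theta_n)\in\mathbb{R}^n:\theta_1<\cdots<\theta_n<\theta_1+2\pi\}$. $\mathrm{C}([0,T],\mathcal{X}_n^{\mathbb{U}})$ is the space of continuous functions from $[0,T]$ to $\mathcal{X}_n^{\mathbb{U}}$ with the topology of uniform convergence. For $\kappa\le4$ the solution (Dyson circular ensemble with parameter $\beta=8/\kappa$ and spiraling rate $\mu$) exists in $\mathcal{X}_n^{\mathbb{U}}$ for all time. Large deviation principle (speed $\kappa^{-1}$): for open $O$, $\liminf_{\kappa\to0+}\kappa\log\mathbb{P}[\boldsymbol\omega^\kappa\in O]\ge-\inf_O\mathcal{I}^{(\mu)}$; for closed $F$, $\limsup_{\kappa\to0+}\kappa\log\mathbb{P}[\boldsymbol\omega^\kappa\in F]\le-\inf_F\mathcal{I}^{(\mu)}$. A rate function is good if its sublevel sets at finite levels are compact. *)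

(* Defs.v *)
From HB Require Import structures.
From mathcomp Require Import all_boot all_order all_algebra.
From mathcomp Require Import all_classical all_reals all_analysis.

Set Implicit Arguments.
Unset Strict Implicit.
Unset Printing Implicit Defensive.

Import Order.TTheory GRing.Theory Num.Theory.
Import numFieldNormedType.Exports.

Local Open Scope classical_set_scope.
Local Open Scope ring_scope.

Definition cot {R : realType} (x : R) : R := cos x / sin x.

(* The open intervals ]x i, y i[ are pairwise disjoint subintervals of [a, b];
   degenerate (empty) ones are harmless. *)
Definition absolutely_continuous_on {R : realType} (a b : R) (f : R -> R) :=
  forall e : R, 0 < e -> exists2 d : R, 0 < d &
    forall (m : nat) (x y : 'I_m -> R),
      (forall i, [/\ a <= x i, x i <= y i & y i <= b]) ->
      trivIset setT (fun i => `]x i, y i[%classic) ->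
      \sum_(i < m) (y i - x i) < d ->
      \sum_(i < m) `|f (y i) - f (x i)| < e.

(* C(U, V) with the topology of uniform convergence. *)
Definition uniform_continuousType (U : topologicalType) (V : uniformType) :
  Type := continuousType U V.

HB.instance Definition _ (U : topologicalType) (V : uniformType) :=
  Uniform.copy (uniform_continuousType U V)
    (initial_topology (id : continuousType U V -> {uniform U -> V})).

Section large_deviations.
Context {R : realType} {X : topologicalType}.
Local Open Scope ereal_scope.

Definition good_rate_function (I : X -> \bar R) :=
  [/\ forall x, 0 <= I x,
      lower_semicontinuous I &
      forall M : R, compact [set x | I x <= M%:E] ].

(* Speed k^-1 as k -> 0+; [mu k] is the law with parameter k, and
   [lne 0 = -oo]. *)
Definition satisfies_LDP (mu : R -> set X -> \bar R) (I : X -> \bar R) :=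
  (forall O : set X, open O ->
     - ereal_inf (I @` O) <= limf_einf (fun k : R => k%:E * lne (mu k O)) 0^'+) /\
  (forall F : set X, closed F ->
     limf_esup (fun k : R => k%:E * lne (mu k F)) 0^'+ <= - ereal_inf (I @` F)).

End large_deviations.

Section brownian_motion.
Context {R : realType} {d : measure_display} {Omega : measurableType d}.
Variable P : probability Omega R.

(* The events {X t \in A}, for t in S and A Borel. *)
Definition process_events (S : set R) (X : R -> Omega -> R) : set_system Omega :=
  [set E | exists2 t, S t & exists2 A, measurable A & E = X t @^-1` A].

Definition standard_brownian_motion (B : R -> Omega -> R) :=
  [/\ forall t, 0 <= t -> measurable_fun setT (B t),
      {ae P, forall w, B 0 w = 0},
      forall s t, 0 <= s -> s < t -> forall A : set R, measurable A ->
        P [set w | A (B t w - B s w)] = normal_prob 0 (Num.sqrt (t - s)) A,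
      forall (m : nat) (t : nat -> R) (A : nat -> set R),
        0 <= t 0%N -> (forall i, t i <= t i.+1) ->
        (forall i, measurable (A i)) ->
        P [set w | forall i : 'I_m, A i (B (t i.+1) w - B (t i) w)] =
        \big[*%E/1%E]_(i < m) P [set w | A i (B (t i.+1) w - B (t i) w)] &
      {ae P, forall w, {within `[0, +oo[, continuous (fun t => B t w)}}].

(* Taking some of the events equal to setT gives the product rule for every
   subfamily. *)
Definition independent_processes (n : nat) (B : 'I_n -> R -> Omega -> R) :=
  forall E : 'I_n -> set Omega,
    (forall j, <<s process_events [set t | 0 <= t] (B j) >> (E j)) ->
    P (\bigcap_j E j) = \big[*%E/1%E]_(j < n) P (E j).

(* The filtration generated by B, augmented by the null events. *)
Definition augmented_filtration (n : nat) (B : 'I_n -> R -> Omega -> R) (t : R) :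
    set_system Omega :=
  <<s [set E | (exists j, process_events `[0, t] (B j) E) \/
               (measurable E /\ P E = 0%E)] >>.

End brownian_motion.

Section dyson.
Context {R : realType}.

(* theta_1 < ... < theta_n < theta_1 + 2 pi *)
Definition chamber (n : nat) : set 'rV[R]_n :=
  [set x | (forall i j : 'I_n, (i < j)%N -> x ord0 i < x ord0 j) /\
           (forall i j : 'I_n, i = 0%N :> nat -> j.+1 = n ->
              x ord0 j < x ord0 i + 2 * pi)].
Arguments chamber : clear implicits.

Definition path_space (T : R) (n : nat) :=
  uniform_continuousType `[0, T]%classic (chamber n).

(* The j-th coordinate at time t in [0, T], extended by 0 outside [0, T]. *)
Definition path_coord (T : R) (n : nat) (f : path_space T n) (j : 'I_n) (t : R) : R :=
  valL_ 0 (fun s : `[0, T]%classic => \val (f s) ord0 j) t.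

Definition drift (mu : R) (n : nat) (x : 'I_n -> R) (j : 'I_n) : R :=
  mu + 2 * \sum_(i < n | i != j) cot ((x j - x i) / 2).

(* The noise is additive, so that the integral form of the SDE involves no
   stochastic integral. *)
Definition dyson_strong_solution (mu T : R) (n : nat) (theta : 'rV[R]_n)
    (d : measure_display) (Omega : measurableType d) (P : probability Omega R)
    (B : 'I_n -> R -> Omega -> R) (k : R) (omega : Omega -> path_space T n) :=
  (forall t, 0 <= t <= T -> forall (j : 'I_n) (A : set R), measurable A ->
     augmented_filtration P B t [set w | A (path_coord (omega w) j t)]) /\
  {ae P, forall w, forall t, 0 <= t <= T -> forall j : 'I_n,
     path_coord (omega w) j t = theta ord0 j + Num.sqrt k * B j t w +
       \int[lebesgue_measure]_(s in `[0, t])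
          drift mu (fun i => path_coord (omega w) i s) j}.

Definition dyson_rate (mu T : R) (n : nat) (theta : 'rV[R]_n)
    (f : path_space T n) : \bar R :=
  if `[< (forall j, absolutely_continuous_on 0 T (path_coord f j)) /\
         (forall j, path_coord f j 0 = theta ord0 j) >]
  then ((2^-1)%:E * \int[lebesgue_measure]_(t in `[0%R, T])
          (\sum_(j < n) (derive1 (path_coord f j) t
                         - drift mu (fun i => path_coord f i t) j) ^+ 2)%:E)%E
  else +oo%E.

End dyson.
Arguments chamber : clear implicits.

(* Main.v *)
(* The noise being additive, a path w is determined by its driving path
   h = w - \int_0^. b(w), b the drift, and the rate of w is the energy of h: the
   supremum over finite families of disjoint intervals of the sums of |dh|^2 / (2 dt).

   The repulsion is minus the gradient of a convex potential U which blows up at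
   collisions, so that U(w_t) <= U(w_0) + (energy of h) + c t. Paths of bounded rate
   therefore stay in a region where b is Lipschitz, whence the compactness of the
   level sets.

   Upper bound: cut [0, T] into N cells and replace the driver sqrt(k) B by its
   piecewise linear interpolation. By Gaussian tail estimates, the energy of the
   interpolation exceeds a with probability of order exp(-a/k), and the oscillation of
   the driver in some cell exceeds x with probability at most exp(-c N x^2/k), which is
   negligible for large N. A path with driver close to one of energy a is close to a
   path of rate a' > a: this needs no solution theory, since one may add the difference
   of the drivers to the path and absorb the change of drift in the energy.

   Lower bound: the increments of the driver on the grid are close to those of a given
   h with probability at least exp(-(energy of h + eps)/k), and closeness of the drivers
   implies closeness of the paths by Gronwall's inequality. *)
Require Import Defs.
From HB Require Import structures.
From mathcomp Require Import all_boot all_order all_algebra.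
From mathcomp Require Import all_classical all_reals all_analysis.
From mathcomp Require Import measurable_realfun.
From mathcomp Require Import ring lra.

Set Implicit Arguments.
Unset Strict Implicit.
Unset Printing Implicit Defensive.

Import Order.TTheory GRing.Theory Num.Theory.
Import numFieldNormedType.Exports HBNNSimple.

Local Open Scope classical_set_scope.
Local Open Scope ring_scope.

(** * Absolutely continuous functions *)

(** The rate is written with pointwise derivatives, which behave badly under limits and whose
    measurability is not at hand. The bound by finite sums has neither defect: it passes to
    pointwise limits, it is stable under Lipschitz perturbations by Young's inequality, and it
    controls the potential by a discrete chain rule although the driver is not smooth.
    [dyson_rate_leP] joins the two forms; its cost is the fundamental theorem of calculus for
    absolutely continuous functions, and Fatou's lemma. The other obstacle is circular: comparing
    two paths requires that they be far from collisions, which is known only as long as the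
    comparison holds. [continuous_induction] breaks the circle. *)

Lemma eq_ler d (T : porderType d) (x y : T) : x = y -> (x <= y)%O.
Proof. by move=> ->. Qed.

Section interval_families.
Context {R : realType}.
Implicit Types (a b : R) (f : R -> R) (l r : seq (R * R)).

(** Families are lists, so that replacing an interval by a partition is a concatenation; neighbours
    may share an endpoint. *)
Definition nonoverlap (p q : R * R) := (p.2 <= q.1) || (q.2 <= p.1).

Definition itv_family a b l :=
  all (fun p : R * R => [&& a <= p.1, p.1 <= p.2 & p.2 <= b]) l &&
  pairwise nonoverlap l.

Definition total_length l : R := \sum_(p <- l) (p.2 - p.1).

Definition variation_on f l : R := \sum_(p <- l) `|f p.2 - f p.1|.

Lemma nonoverlap_trivIset l : all (fun p : R * R => p.1 <= p.2) l ->
  pairwise nonoverlap l ->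
  trivIset setT (fun i : 'I_(size l) => `](tnth (in_tuple l) i).1, (tnth (in_tuple l) i).2[%classic).
Proof.
move=> /all_nthP lle /(pairwiseP (0, 0)) lno i j _ _ [t []] /=.
rewrite !(tnth_nth (0, 0)) /= !in_itv/= => /andP[it ti] /andP[jt tj].
apply: val_inj => /=; case: (ltngtP i j) => // ij.
- have := lno i j (ltn_ord i) (ltn_ord j) ij; move: it ti jt tj.
  move: (nth _ l i) (nth _ l j) => p q {lle lno ij}.
  by rewrite /nonoverlap => ? ? ? ? /orP[] ?; exfalso; lra.
- have := lno j i (ltn_ord j) (ltn_ord i) ij; move: it ti jt tj.
  move: (nth _ l i) (nth _ l j) => p q {lle lno ij}.
  by rewrite /nonoverlap => ? ? ? ? /orP[] ?; exfalso; lra.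
Qed.

Lemma absolutely_continuous_onP a b f : absolutely_continuous_on a b f <->
  forall e : R, 0 < e -> exists2 d : R, 0 < d &
    forall l, itv_family a b l -> total_length l < d -> variation_on f l < e.
Proof.
split=> fac e e0; have [d d0 fd] := fac e e0; exists d => //.
- move=> l /andP[/all_nthP lab lno] ld.
  have := fd (size l) (fun i => (tnth (in_tuple l) i).1)
    (fun i => (tnth (in_tuple l) i).2).
  rewrite -(big_tnth 0 +%R l xpredT (fun p => p.2 - p.1)).
  rewrite -(big_tnth 0 +%R l xpredT (fun p => `|f p.2 - f p.1|)); apply => //.
  + by move=> i; rewrite (tnth_nth (0, 0)) /=; apply/and3P/lab.
  + apply: nonoverlap_trivIset => //.
    by apply/(all_nthP (0,0)) => i il; have /and3P[] := lab (0, 0) i il.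
- move=> m x y xy xyd sd.
  (* Empty intervals are dropped: a degenerate one inside another interval is disjoint from it as an
     open set but violates [nonoverlap]. *)
  pose l := [seq (x i, y i) | i <- enum 'I_m & x i < y i].
  have suml (F : R -> R -> R) : (forall t, F t t = 0) ->
      \sum_(p <- l) F p.1 p.2 = \sum_(i < m) F (x i) (y i).
    move=> F0; rewrite big_map big_filter big_mkcond big_enum/=.
    apply: eq_bigr => i _; case: ifPn => //; rewrite -leNgt => yx.
    have [_ xy' _] := xy i.
    by have -> : y i = x i by apply/eqP; rewrite eq_le yx xy'.
  have /fd : itv_family a b l.
    apply/andP; split.
      rewrite all_map; apply/allP => i _ /=; exact/and3P/xy.
    have : pairwise (fun i j => i != j) [seq i <- enum 'I_m | x i < y i].
      by rewrite -uniq_pairwise filter_uniq// enum_uniq.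
    rewrite pairwise_map.
    apply: (@sub_in_pairwise _ [pred i | x i < y i]); last first.
      by apply/allP => i; rewrite mem_filter => /andP[].
      move=> i j; rewrite !inE => xi xj ij; rewrite /nonoverlap/=.
      apply/negPn/negP; rewrite negb_or -!ltNge => /andP[ji ij'].
      move: ij; rewrite (xyd i j I I) ?eqxx//.
      exists ((Num.max (x i) (x j) + Num.min (y i) (y j)) / 2).
      rewrite /Num.max /Num.min; move: ji ij'.
      move: xi xj; clear -i j.
      move: (x i) (y i) (x j) (y j) => {}x {}y u v *.
      by split; rewrite /= in_itv/=; case: ifP; case: ifP; lra.
  rewrite /total_length /variation_on.
  rewrite (suml (fun u v => v - u)) ?(suml (fun u v => `|f v - f u|)).
  - exact.
  - by move=> t; rewrite subrr normr0.
  - by move=> t; rewrite subrr.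
Qed.

End interval_families.

Section total_variation_ac.
Context {R : realType}.
Implicit Types (a b : R) (f : R -> R) (l r s : seq (R * R)).

Definition steps a (t : seq R) := zip (a :: t) t.

Lemma variation_steps a b f t : itv_partition a b t ->
  variation a b f t = variation_on f (steps a t).
Proof.
move=> abt; rewrite variation_zip// /variation_on /steps.
have -> : zip t (a :: t) = [seq (p.2, p.1) | p <- zip (a :: t) t].
  elim: t a {abt} => //= x t ih a; congr cons.
  by case: t ih => //= y t /(_ x) ->.
by rewrite big_map; apply: eq_bigr.
Qed.

Lemma steps_cons a x t : steps a (x :: t) = (a, x) :: steps x t.
Proof. by []. Qed.

Lemma steps_bnd a t : path <%R a t ->
  all (fun p : R * R => [&& a <= p.1, p.1 <= p.2 & p.2 <= last a t]) (steps a t).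
Proof.
elim: t a => // x t ih a /= /andP[ax xt].
have xl : x <= last x t.
  have := ih x xt; case: t xt {ih} => //= y t /andP[xy _] /andP[/andP[_ /andP[]]].
  by move=> _ + _; exact: le_trans (ltW xy).
rewrite lexx (ltW ax) xl/=.
by apply: sub_all (ih x xt) => p /and3P[xp -> ->]; rewrite (le_trans (ltW ax) xp).
Qed.

Lemma steps_nonoverlap a t : path <%R a t -> pairwise nonoverlap (steps a t).
Proof.
elim: t a => // x t ih a /= /andP[ax xt]; rewrite ih// andbT.
by apply: sub_all (steps_bnd xt) => p /and3P[xp _ _]; rewrite /nonoverlap xp.
Qed.

Lemma total_length_steps a t : total_length (steps a t) = last a t - a.
Proof.
rewrite /total_length; elim: t a => [a|x t ih a]; first by rewrite big_nil subrr.
by rewrite steps_cons big_cons ih/=; ring.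
Qed.

Lemma total_length_cat l r : total_length (l ++ r) = total_length l + total_length r.
Proof. by rewrite /total_length big_cat. Qed.

Lemma variation_on_cat f l r : variation_on f (l ++ r) = variation_on f l + variation_on f r.
Proof. by rewrite /variation_on big_cat. Qed.

Lemma itv_family_steps a b x y t l r : itv_family a b ((x, y) :: l ++ r) ->
  itv_partition x y t -> itv_family a b (l ++ steps x t ++ r).
Proof.
move=> /andP[/= /andP[/and3P[ax xy yb] llr]] /andP[xylr plr] [xt /eqP ty].
have sb := steps_bnd xt; rewrite ty in sb.
apply/andP; split.
  rewrite !all_cat; move: llr; rewrite all_cat => /andP[-> ->]; rewrite andbT/=.
  apply: sub_all sb => p /and3P[xp -> py].
  by rewrite (le_trans ax xp) (le_trans py yb).
have sepp q : nonoverlap (x, y) q -> all (fun p => nonoverlap p q && nonoverlap q p) (steps x t).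
  move=> xyq; apply: sub_all sb => p /and3P[xp pp py].
  move: xyq; rewrite /nonoverlap/= => /orP[yq|qx].
    by rewrite (le_trans py yq)/= orbT.
  by rewrite (le_trans qx xp)/= orbT.
move: plr xylr; rewrite !pairwise_cat all_cat allrel_catr => /and3P[-> -> ->] /andP[xyl xyr].
rewrite steps_nonoverlap//= !andbT; apply/andP; split.
  apply/allrelP => p q pl qs; have /allP/(_ _ qs)/andP[] := sepp p (allP xyl _ pl).
  by [].
apply/allrelP => p q ps qr; have /allP/(_ _ ps)/andP[] := sepp q (allP xyr _ qr).
by [].
Qed.

(* By induction on [l], the intervals of which are replaced one at a time by partitions. *)
Lemma total_variation_family a b f (e d : R) :
  (forall l, itv_family a b l -> total_length l < d -> variation_on f l < e) ->
  forall l r, itv_family a b (l ++ r) -> total_length (l ++ r) < d ->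
  (\sum_(p <- l) total_variation p.1 p.2 f + (variation_on f r)%:E <= e%:E)%E.
Proof.
move=> fac; elim=> [r abr rd|[x y] l ih r ablr lrd].
  by rewrite big_nil add0e lee_fin ltW// fac.
have lrd' : total_length (l ++ r) < d.
  move: lrd; rewrite /total_length/= big_cons/=; apply: le_lt_trans.
  by rewrite lerDr subr_ge0; case/andP: ablr => /= /andP[/and3P[]].
have ablr' : itv_family a b (l ++ r).
  by case/andP: ablr => /= /andP[_ ?] /andP[_ ?]; apply/andP.
have xy : x <= y by case/andP: ablr => /= /andP[/and3P[]].
rewrite big_cons/=.
set K := (\sum_(p <- l) _)%E.
have Kr := ih r ablr' lrd'; rewrite -/K in Kr.
have K0 : (0 <= K)%E.
  rewrite /K big_seq; apply: sume_ge0 => p pl; apply: total_variation_ge0.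
  by case/andP: ablr' => /allP/(_ p); rewrite mem_cat pl => /(_ isT)/and3P[].
have Kfin : (K \is a fin_num).
  rewrite ge0_fin_numE//; apply: le_lt_trans (ltry e); apply: le_trans Kr.
  by rewrite leeDl// lee_fin sumr_ge0.
rewrite -addeA -leeBrDr ?fin_numD ?Kfin//.
apply: ge_ereal_sup => _ [_ [t xyt <-] <-].
rewrite leeBrDr ?fin_numD ?Kfin// variation_steps// addeCA addeC -EFinD.
rewrite -variation_on_cat addeC; apply: ih; first exact: itv_family_steps ablr xyt.
move: lrd; rewrite catA !total_length_cat total_length_steps /total_length big_cons.
by case: xyt => _ /eqP ->; rewrite /=; lra.
Qed.

(** On an interval shorter than the [d] attached to [e = 1] the variation is at most 1, and finitely
    many such intervals exhaust [a, b]. *)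
Lemma acl_bounded_variation a b f : a <= b -> absolutely_continuous_on a b f ->
  bounded_variation a b f.
Proof.
move=> ab /absolutely_continuous_onP /(_ 1 ltr01)[d d0 fd].
have small x y : a <= x -> x <= y -> y <= b -> y - x < d -> bounded_variation x y f.
  move=> ax xy yb xyd; apply/bounded_variationP => //.
  rewrite ge0_fin_numE ?total_variation_ge0//.
  have := @total_variation_family _ _ _ _ _ fd [:: (x, y)] [::].
  rewrite /total_length !big_cons !big_nil /variation_on big_nil adde0 addr0 adde0.
  move=> H; apply: le_lt_trans (ltry 1); apply: H => //=.
  by rewrite /itv_family/= ax xy yb.
(* The steps have length d / 2, strictly below [d]; the doubling makes [N] of them exceed b - a. *)
pose N := (Num.bound ((b - a) / d)).*2.
have H k : bounded_variation a (Num.min b (a + k%:R * (d / 2))) f.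
  elim: k => [|k ih].
    by rewrite mul0r addr0 min_r//; exact: bounded_variationxx.
  set u := Num.min _ _ in ih; set v := Num.min _ _.
  have kd : (0 <= k%:R * (d / 2)) by rewrite mulr_ge0// divr_ge0// ltW.
  have [au uv vb vu] : [/\ a <= u, u <= v, v <= b & v - u < d].
    rewrite /u /v -[k.+1]addn1 natrD mulrDl mul1r /Num.min.
    by case: ifP => ?; case: ifP => ?; split; lra.
  apply/bounded_variationP; first exact: le_trans uv.
  rewrite (total_variationD f au uv) fin_numD.
  by apply/andP; split; apply/bounded_variationP => //; apply: small.
suff <- : Num.min b (a + N%:R * (d / 2)) = b by exact: H.
rewrite min_l// -lerBlDl mulrCA.
have : 0 <= (b - a) / d by rewrite divr_ge0 ?subr_ge0// ltW.
move=> /archi_boundP; rewrite ltr_pdivrMr// => h.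
by rewrite /N -muln2 natrM; apply: ltW; move: h; lra.
Qed.

(** Increments of the variation function are total variations, which [total_variation_family] bounds
    with [r] empty. The supremum loses strictness, hence e / 2. *)
Lemma total_variation_acl a b f : a <= b -> absolutely_continuous_on a b f ->
  absolutely_continuous_on a b (fine \o total_variation a ^~ f).
Proof.
move=> ab fac; have bvf := acl_bounded_variation ab fac.
apply/absolutely_continuous_onP => e e0.
have e20 : 0 < e / 2 by lra.
have [d d0 fd] := (absolutely_continuous_onP a b f).1 fac _ e20.
exists d => // l abl ld.
have := @total_variation_family _ _ _ _ _ fd l [::].
rewrite cats0 => /(_ abl ld); rewrite /variation_on big_nil adde0 => H.
suff E : (\sum_(p <- l) total_variation p.1 p.2 f)%E =
    (\sum_(p <- l) `|(fine \o total_variation a ^~ f) p.2 -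
                     (fine \o total_variation a ^~ f) p.1|)%:E.
  by move: H; rewrite E lee_fin; lra.
rewrite -sumEFin big_seq [RHS]big_seq; apply: eq_bigr => -[x y] pl.
case/andP: abl => /allP/(_ _ pl)/= /and3P[ax xy yb] _.
have xf : total_variation a x f \is a fin_num.
  apply/bounded_variationP => //; apply: bounded_variationl bvf => //.
  exact: le_trans yb.
have xyf : total_variation x y f \is a fin_num.
  apply/bounded_variationP => //; apply: (@bounded_variationl _ _ _ b) => //.
  by apply: bounded_variationr bvf => //; exact: le_trans yb.
rewrite (total_variationD f ax xy) fineD// addrAC subrr add0r.
by rewrite ger0_norm ?fineK// fine_ge0// total_variation_ge0.
Qed.

Lemma absolutely_continuous_onB a b f g : absolutely_continuous_on a b f ->
  absolutely_continuous_on a b g -> absolutely_continuous_on a b (f \- g).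
Proof.
move=> /absolutely_continuous_onP fac /absolutely_continuous_onP gac.
apply/absolutely_continuous_onP => e e0; have e20 : 0 < e / 2 by lra.
have [d d0 fd] := fac _ e20; have [d' d0' gd] := gac _ e20.
exists (Num.min d d'); first by rewrite lt_min d0.
move=> l abl; rewrite lt_min => /andP[/(fd _ abl) + /(gd _ abl)] => h1 h2.
apply: (@le_lt_trans _ _ (variation_on f l + variation_on g l)); last lra.
rewrite /variation_on -big_split/=; apply: ler_sum => p _.
rewrite (_ : (f \- g) p.2 - (f \- g) p.1 = (f p.2 - f p.1) - (g p.2 - g p.1)); last by rewrite /=; ring.
exact: ler_normB.
Qed.

(* [f = V - (V - f)], with [V] the total variation of [f], is a difference of two nondecreasing absolutely continuous functions. *)
Lemma absolutely_continuous_jordan a b f : a <= b -> absolutely_continuous_on a b f ->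
  exists g h, [/\ f = g \- h,
    absolutely_continuous_on a b g /\ absolutely_continuous_on a b h,
    {in `[a, b] &, nondecreasing_fun g} & {in `[a, b] &, nondecreasing_fun h}].
Proof.
move=> ab fac; have bvf := acl_bounded_variation ab fac.
pose V := fine \o total_variation a ^~ f.
have Vac := total_variation_acl ab fac.
have VB x y : x \in `[a, b] -> y \in `[a, b] -> x <= y -> `|f y - f x| <= V y - V x.
  rewrite !in_itv/= => /andP[ax xb] /andP[ay yb] xy.
  have xf : total_variation a x f \is a fin_num.
    by apply/bounded_variationP => //; apply: bounded_variationl bvf.
  have xyf : total_variation x y f \is a fin_num.
    apply/bounded_variationP => //; apply: (@bounded_variationl _ _ _ b) => //.
    exact: bounded_variationr bvf.
  rewrite /V/= (total_variationD f ax xy) fineD// addrAC subrr add0r.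
  by rewrite -lee_fin fineK// total_variation_ge.
exists V, (V \- f); split.
- by apply/funext => x /=; ring.
- by split=> //; exact: absolutely_continuous_onB.
- move=> x y xab yab xy; rewrite -subr_ge0.
  exact: le_trans (VB x y xab yab xy).
- move=> x y xab yab xy; have := VB x y xab yab xy; rewrite -subr_ge0/=.
  by have := ler_norm (f y - f x); lra.
Qed.

End total_variation_ac.

(** Projection onto [a, b]. Composition with it extends a function by constants and keeps
    monotonicity, continuity and absolute continuity. *)
Definition clip {R : realType} (a b x : R) : R := Num.max a (Num.min b x).

Section clip.
Context {R : realType}.
Implicit Types a b x y : R.

Lemma clip_id a b x : a <= x -> x <= b -> clip a b x = x.
Proof. by move=> ax xb; rewrite /clip min_r// max_r. Qed.

Lemma clip_bnd a b x : a <= b -> a <= clip a b x <= b.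
Proof. by move=> ab; rewrite /clip le_max lexx ge_max ab ge_min lexx. Qed.

Lemma clip_homo a b : {homo clip a b : x y / x <= y}.
Proof.
move=> x y xy; have h : Num.min b x <= Num.min b y.
  by case: (leP b x) => bx; case: (leP b y) => by'; lra.
rewrite /clip; move: h; move: (Num.min b x) (Num.min b y) => u v uv.
by case: (leP a u) => au; case: (leP a v) => av; lra.
Qed.

Lemma clip_lip a b x y : `|clip a b x - clip a b y| <= `|x - y|.
Proof.
suff H : forall u v : R, u <= v -> clip a b v - clip a b u <= v - u.
  have [xy|/ltW yx] := leP x y.
    by rewrite distrC (distrC x) !ger0_norm ?subr_ge0 ?H// clip_homo.
  by rewrite !ger0_norm ?subr_ge0 ?H// clip_homo.
move=> u v uv; rewrite /clip; case: (leP b v) => bv.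
  by case: (leP b u) => bu; rewrite ?subrr ?subr_ge0//; case: (leP a b) => ?; case: (leP a u) => ?; lra.
by case: (leP b u) => bu; case: (leP a v) => ?; case: (leP a u) => ?; lra.
Qed.

Lemma clip_continuous a b : continuous (clip a b).
Proof.
move=> x; apply/cvgrPdist_lt => e e0; near=> y.
apply: le_lt_trans (clip_lip a b x y) _; near: y.
exact: cvgr_dist_lt.
Unshelve. all: by end_near. Qed.

Lemma absolutely_continuous_clip a b (f : R -> R) a' b' : a <= b ->
  absolutely_continuous_on a b f -> absolutely_continuous_on a' b' (f \o clip a b).
Proof.
move=> ab /absolutely_continuous_onP fac; apply/absolutely_continuous_onP => e e0.
have [d d0 fd] := fac e e0; exists d => // l /andP[/allP al pl] ld.
pose l' := [seq (clip a b p.1, clip a b p.2) | p <- l].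
have {}fd : itv_family a b l' -> total_length l' < d -> variation_on f l' < e := fd l'.
rewrite (_ : variation_on _ _ = variation_on f l'); last by rewrite /variation_on big_map.
apply: fd.
- apply/andP; split.
    apply/allP => _ /mapP[p pl' ->]/=; have /and3P[_ pp _] := al p pl'.
    by have /andP[-> _] := clip_bnd p.1 ab; have /andP[_ ->] := clip_bnd p.2 ab; rewrite clip_homo.
  rewrite pairwise_map; apply: sub_pairwise pl => p q; rewrite /nonoverlap/=.
  by case/orP => /(clip_homo a b) -> //; rewrite orbT.
- apply: le_lt_trans ld; rewrite /total_length big_map big_seq [leRHS]big_seq.
  apply: ler_sum => p pl'; have /and3P[_ pp _] := al p pl'.
  apply: le_trans (ler_norm _) _; apply: le_trans (clip_lip _ _ _ _) _.
  by rewrite ger0_norm// subr_ge0.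
Qed.

Lemma absolutely_continuous_continuous a b (f : R -> R) : absolutely_continuous_on a b f ->
  forall e, 0 < e -> exists2 d, 0 < d & forall x y, a <= x -> x <= b -> a <= y -> y <= b ->
    `|x - y| < d -> `|f x - f y| < e.
Proof.
move=> /absolutely_continuous_onP fac e e0; have [d d0 fd] := fac e e0.
exists d => // x y ax xb ay yb xyd.
wlog xy : x y ax xb ay yb xyd / x <= y.
  move=> H; have [|yx] := leP x y; first exact: H.
  by rewrite distrC; apply: H => //; rewrite 1?distrC// ltW.
have := fd [:: (x, y)]; rewrite /itv_family /total_length /variation_on !big_seq1/=.
rewrite ax xy yb/= distrC => -> //; apply: le_lt_trans xyd.
by rewrite distrC ler_norm.
Qed.

End clip.

(** * Density of a monotone absolutely continuous function *)

Section monotone_ac.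
Context {R : realType}.
Variables (a b : R) (ab : a < b) (f : R -> R).
Hypothesis fac : forall a' b', absolutely_continuous_on a' b' f.
Hypothesis fnd : {homo f : x y / x <= y}.
Let lam := @lebesgue_measure R.

Let f_continuous : continuous f.
Proof.
move=> x; apply/cvgrPdist_lt => e e0.
have [d d0 fd] := absolutely_continuous_continuous (fac (x - 1) (x + 1)) e0.
near=> y.
have y1 : `|x - y| < 1 by near: y; exact: cvgr_dist_lt.
have [] : x - 1 <= y /\ y <= x + 1 by move: y1; rewrite ltr_norml => /andP[]; lra.
move=> ? ?; apply: fd; [lra|lra|lra|lra|].
by near: y; exact: cvgr_dist_lt.
Unshelve. all: by end_near. Qed.

(** The Stieltjes measure of [f], through which absolute continuity of the function becomes absolute
    continuity of a measure. *)
Let F : cumulative R R := HB.pack f (isCumulative.Build R _ R f fnd (right_continuousW f_continuous)).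
Let m := lebesgue_stieltjes_measure F.

Let m_oc x y : x <= y -> m `]x, y]%classic = (f y - f x)%:E.
Proof.
move=> xy; rewrite /m /lebesgue_stieltjes_measure /measure_extension measurable_mu_extE/=.
  by rewrite wlength_itv_bnd.
exact: is_ocitv.
Qed.

Let D := `]a, b[%classic : set (measurableTypeR R).
Let mD : measurable D. Proof. exact: measurable_itv. Qed.
Let mDoo : (m D < +oo)%E.
Proof.
apply: (@le_lt_trans _ _ (m `]a, b]%classic)).
  by apply: le_measure; rewrite ?inE//; apply: subset_itvl; rewrite bnd_simp.
by rewrite m_oc ?ltry// ltW.
Qed.

Let nu : {finite_measure set (measurableTypeR R) -> \bar R} := mfrestr mD mDoo.

Let open_itv (I : set R) : open I -> is_interval I -> I `<=` D -> I !=set0 ->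
  [/\ a <= inf I, inf I < sup I, sup I <= b & I = `]inf I, sup I[%classic].
Proof.
move=> oI iI ID [t It].
have hl : has_lbound I by exists a => x /ID; rewrite /D/= in_itv/= => /andP[/ltW].
have hu : has_ubound I by exists b => x /ID; rewrite /D/= in_itv/= => /andP[_ /ltW].
have IE : I = `]inf I, sup I[%classic.
  have /interior_id := oI; rewrite interval_bounded_interior// => <-.
have [] : inf I < t /\ t < sup I by move: It; rewrite {1}IE/= in_itv/= => /andP.
move=> It1 It2; split => //.
- by apply: lb_le_inf; [exists t|move=> x /ID; rewrite /D/= in_itv/= => /andP[/ltW]].
- exact: lt_trans It1 It2.
- by apply: ge_sup; [exists t|move=> x /ID; rewrite /D/= in_itv/= => /andP[_ /ltW]].
Qed.

(** The components of an open set are countably many disjoint intervals. Absolute continuity applies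
    to each finite subfamily, and the bound passes to the limit of the partial sums. *)
Let dominated_open e : 0 < e -> exists2 d, 0 < d &
  forall U : set R, open U -> U `<=` D -> (lam U < d%:E)%E -> (m U <= e%:E)%E.
Proof.
move=> e0; have [d d0 fd] := (absolutely_continuous_onP a b f).1 (fac a b) e e0.
exists d => // U oU UD Ud.
pose I := open_disjoint_itv oU.
have oI k : open (I k) by exact: open_disjoint_itv_open.
have iI k : is_interval (I k) by exact: open_disjoint_itv_is_interval.
have tI : trivIset setT I by exact: open_disjoint_itv_trivIset.
have UE : U = \bigcup_k I k by exact: open_disjoint_itv_bigcup.
have ID k : I k `<=` D by move=> x Ix; apply: UD; rewrite UE; exists k.
have mI k : measurable (I k : set (measurableTypeR R)) by exact: (@measurable_realfun.open_measurable R (I k)).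
have -> : m U = (\sum_(k <oo) m (I k))%E.
  by rewrite [in LHS]UE; apply: measure_semi_bigcup => //; exact: bigcup_measurable.
apply: lime_le; first by apply: is_cvg_nneseries => *; exact: measure_ge0.
near=> K.
(* Empty members of the enumeration are skipped, as their [inf] and [sup] are default values
   possibly outside [a, b]. *)
pose l := [seq (inf (I k), sup (I k)) | k <- iota 0 K & `[< I k !=set0 >]].
have lE k : k \in [seq k <- iota 0 K | `[< I k !=set0 >]] ->
  [/\ a <= inf (I k), inf (I k) < sup (I k), sup (I k) <= b & I k = `]inf (I k), sup (I k)[%classic].
  by rewrite mem_filter => /andP[/asboolP I0 _]; exact: open_itv.
have fl : itv_family a b l.
  apply/andP; split.
    by apply/allP => _ /mapP[k /lE[? ? ? _] ->] /=; apply/and3P; split => //; exact: ltW.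
  rewrite pairwise_map.
  have : pairwise (fun i j => i != j) [seq k <- iota 0 K | `[< I k !=set0 >]].
    by rewrite -uniq_pairwise filter_uniq// iota_uniq.
  apply: (@sub_in_pairwise _ (mem [seq k <- iota 0 K | `[< I k !=set0 >]])); last exact/allP.
  move=> i j /lE[_ ii _ Ii] /lE[_ jj _ Ij] ij; rewrite /nonoverlap/=.
  apply/negPn/negP; rewrite negb_or -!ltNge => /andP[ji ij'].
  move: ij; rewrite (tI i j Logic.I Logic.I) ?eqxx//; rewrite Ii Ij.
  move: (inf (I i)) (inf (I j)) (sup (I i)) (sup (I j)) ii jj ji ij' => u v x y *.
  by exists ((Num.max u v + Num.min x y) / 2); split; rewrite /= in_itv/=;
    case: (ltP u v) => ?; case: (ltP x y) => ?; lra.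
have sumE (H : set R -> \bar R) : (H set0 = 0)%E ->
    (\sum_(0 <= k < K) H (I k) = \sum_(k <- [seq k <- iota 0 K | `[< I k !=set0 >]]) H (I k))%E.
  move=> H0; rewrite big_filter [RHS]big_mkcond /index_iota subn0.
  apply: eq_bigr => k _; case: asboolP => // /set0P/negP/negPn/eqP ->.
  by rewrite H0.
rewrite sumE ?measure0//.
apply: (@le_trans _ _ (variation_on f l)%:E); last first.
  rewrite lee_fin ltW//; apply: fd => //; rewrite -lte_fin; apply: le_lt_trans Ud.
  rewrite /total_length big_map -sumEFin.
  apply: (@le_trans _ _ (\sum_(k <- [seq k <- iota 0 K | `[< I k !=set0 >]]) lam (I k))%E).
    rewrite big_seq [leRHS]big_seq; apply: lee_sum => k /lE[_ ii _ Ik].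
    by rewrite [in leRHS]Ik /lam lebesgue_measure_itv/= lte_fin ii.
  have -> : lam U = (\sum_(k <oo) lam (I k))%E.
    by rewrite [in LHS]UE; apply: measure_semi_bigcup => //; exact: bigcup_measurable.
  rewrite -sumE ?measure0//.
  by apply: nneseries_lim_ge => *; exact: measure_ge0.
rewrite /variation_on big_map -sumEFin big_seq [leRHS]big_seq.
apply: lee_sum => k /lE[_ ii _ Ik]; rewrite {1}Ik.
apply: (@le_trans _ _ (m `]inf (I k), sup (I k)]%classic)).
  by apply: le_measure; rewrite ?inE//; apply: subset_itvl; rewrite bnd_simp.
rewrite (m_oc (ltW ii)) lee_fin.
exact: ler_norm.
Unshelve. all: by end_near. Qed.

(** Outer regularity puts a null set inside an open set of small Lebesgue measure, to which
    [dominated_open] applies. *)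
Let nu_dominated : nu `<< lam.
Proof.
apply/null_content_dominatesP => N mN N0.
apply/eqP; rewrite -measure_le0; apply/lee_addgt0Pr => e e0; rewrite add0e.
have [d d0 dU] := dominated_open e0.
have Noo : (lebesgue_measure N < +oo)%E by rewrite N0 ltry.
have [U [oU NU Ud]] := lebesgue_regularity_outer mN Noo d0.
have mU : measurable (U : set (measurableTypeR R)) by exact: measurable_realfun.open_measurable.
rewrite /nu/= /mfrestr /mrestr.
apply: (@le_trans _ _ (m (U `&` D))).
  apply: le_measure; rewrite ?inE//; [exact: measurableI|exact: measurableI|exact: setSI].
apply: dU; first by apply: openI => //; exact: interval_open.
  exact: subIsetr.
apply: le_lt_trans Ud; apply: (@le_trans _ _ (lam U)).
  by apply: le_measure; rewrite ?inE//; exact: measurableI.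
rewrite -[X in lam X](setUIDK U N) /lam.
apply: (le_trans (measureU2 _ (measurableI _ _ mU mN) (measurableD mU mN))).
rewrite -[leRHS]add0e; apply: leeD => //.
by rewrite -N0; apply: le_measure; rewrite ?inE//; exact: measurableI.
Qed.

(** The Radon-Nikodym derivative of the Stieltjes measure. The measure was restricted to ]a, b[ to
    be finite, so the formula is confined to interior points. *)
Lemma monotone_ac_density : exists2 g : R -> R, lam.-integrable setT (EFin \o g) &
  forall x y, a < x -> x <= y -> y < b -> f y - f x = \int[lam]_(t in `[x, y]) g t.
Proof.
have [g [g0 gfin gint gE]] := radon_nikodym_sigma_finite nu_dominated.
exists (fine \o g).
  by rewrite (_ : EFin \o _ = g)//; apply/funext => t /=; rewrite fineK.
move=> x y ax xy yb; rewrite -Rintegral_itv_obnd_cbnd; last first.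
  rewrite (_ : EFin \o _ = g); last by apply/funext => t /=; rewrite fineK.
  exact: integrableS gint.
rewrite /Rintegral /= (eq_integral g); last by move=> t _ /=; rewrite fineK.
rewrite -gE// /nu /= /mfrestr /mrestr setIidl.
  by have := m_oc xy; rewrite /m => ->.
by move=> t; rewrite /D/= !in_itv/= => /andP[xt ty]; rewrite (lt_trans ax xt) (le_lt_trans ty yb).
Qed.

End monotone_ac.

Section ftc_absolutely_continuous.
Context {R : realType}.
Local Notation lam := (@lebesgue_measure R).

(** The Jordan decomposition reduces the integral formula to monotone functions; the derivative is
    then found almost everywhere by Lebesgue differentiation of the primitive of the density. *)
Theorem absolutely_continuous_FTC (a b : R) (f : R -> R) : a <= b ->
  absolutely_continuous_on a b f ->
  exists g : R -> R, [/\ lam.-integrable setT (EFin \o g),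
    forall x y, a <= x -> x <= y -> y <= b -> f y - f x = \int[lam]_(t in `[x, y]) g t &
    {ae lam, forall x, a < x < b -> derivable f x 1 /\ derive1 f x = g x}].
Proof.
move=> ab fac.
have [p [q [fE [pac qac] pnd qnd]]] := absolutely_continuous_jordan ab fac.
(* Densities are available only strictly inside an interval; the enlargement makes a and b interior
   points. *)
have ab1 : a - 1 < b + 1 by lra.
have dens u : absolutely_continuous_on a b u -> {in `[a, b] &, nondecreasing_fun u} ->
    exists2 g : R -> R, lam.-integrable setT (EFin \o g) &
    forall x y, a <= x -> x <= y -> y <= b -> u y - u x = \int[lam]_(t in `[x, y]) g t.
  move=> uac und.
  have uac' a' b' : absolutely_continuous_on a' b' (u \o clip a b).
    exact: absolutely_continuous_clip.
  have und' : {homo u \o clip a b : x y / x <= y}.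
    move=> x y xy /=; apply: und; rewrite ?in_itv ?clip_bnd//=; exact: clip_homo.
  have [g gi gE] := monotone_ac_density ab1 uac' und'.
  exists g => // x y ax xy yb; rewrite -gE ?/=; [|lra|by []|lra].
  by rewrite !clip_id//; [exact: le_trans yb|exact: le_trans ax xy].
have [gp gpi gpE] := dens p pac pnd; have [gq gqi gqE] := dens q qac qnd.
have gi : lam.-integrable setT (EFin \o (gp \- gq)).
  exact: (integrableB measurableT gpi gqi).
have gE x y : a <= x -> x <= y -> y <= b -> f y - f x = \int[lam]_(t in `[x, y]) (gp \- gq) t.
  move=> ax xy yb; rewrite RintegralB//; [|exact: integrableS gpi|exact: integrableS gqi].
  by rewrite -gpE// -gqE// fE/=; ring.
exists (gp \- gq); split => //.
have gloc : locally_integrable [set: R] (gp \- gq) by exact: open_integrable_locally openT gi.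
have giy y : lam.-integrable [set` Interval (BLeft a) (BRight y)] (EFin \o (gp \- gq)).
  exact: integrableS gi.
have H := FTC1 giy gloc.
apply: filterS H; first exact: (ae_filter_ringOfSetsType lam).
move=> x Hx /andP[ax xb].
have [] := Hx ax; set F := fun _ => _ => dF F'.
(* [F] is the primitive from a, so that [f] is [F] plus the constant [f a] around an interior
   point. *)
have near_eq : \forall t \near x, F t + f a = f t.
  have : x \in `]a, b[ by rewrite in_itv/= ax xb.
  move/near_in_itvoo; apply: filterS => t; rewrite in_itv/= => /andP[at' tb].
  by rewrite /F -gE ?subrK// ltW.
move: F dF F' near_eq => F dF F' near_eq {Hx gE gi giy gloc fE}.
have dFa : is_derive x 1 (fun t => F t + f a) (derive1 F x + 0).
  by rewrite derive1E; apply: (is_deriveD (derivableP dF) (is_derive_cst _ _ _)).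
have [dfx fx] := near_eq_is_derive near_eq dFa.
by split=> //; rewrite derive1E fx addr0.
Qed.

End ftc_absolutely_continuous.

(** * Energy *)

(* [f] is not assumed to be measurable: its integral is then a lower integral. *)
Lemma ae_ge0_le_lower_integral d (T : measurableType d) (R : realType)
    (mu : {measure set T -> \bar R}) (D : set T) (f g : T -> \bar R) :
  measurable D -> (forall x, D x -> 0 <= f x)%E -> (forall x, D x -> 0 <= g x)%E ->
  measurable_fun D g -> {ae mu, forall x, D x -> (f x <= g x)%E} ->
  (\int[mu]_(x in D) f x <= \int[mu]_(x in D) g x)%E.
Proof.
move=> mD f0 g0 mg fg.
have res0 (h : T -> \bar R) : (forall x, D x -> 0 <= h x)%E -> (forall x, 0 <= (h \_ D) x)%E.
  by move=> h0 x; rewrite patchE; case: ifPn => // /[!inE] /h0.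
rewrite integral_mkcond [leRHS]integral_mkcond ge0_integralTE ?res0//; last exact: res0.
apply: ge_ereal_sup => _ [h /= hf <-]; rewrite -integralT_nnsfun.
apply: ae_ge0_le_integral => //.
- by move=> x _; rewrite lee_fin fun_ge0.
- by apply/measurable_EFinP; exact: measurable_funPT.
- by move=> x _; exact: res0.
- by apply/(measurable_restrictT g mD).1.
apply: filterS fg => x fgx _; apply: le_trans (hf x) _; rewrite !patchE; case: ifPn => //.
by rewrite inE.
Qed.

(** The mirror case, in which the larger function may fail to be measurable. The null set is removed
    from the domain of the measurable [f]; simple functions below [f] off that set are then below
    [g] everywhere. *)
Lemma ae_ge0_le_integral_lower d (T : measurableType d) (R : realType)
    (mu : {measure set T -> \bar R}) (D : set T) (f g : T -> \bar R) :
  measurable D -> (forall x, D x -> 0 <= f x)%E -> (forall x, D x -> 0 <= g x)%E ->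
  measurable_fun D f -> {ae mu, forall x, D x -> (f x <= g x)%E} ->
  (\int[mu]_(x in D) f x <= \int[mu]_(x in D) g x)%E.
Proof.
move=> mD f0 g0 mf [N [mN N0 fgN]].
rewrite (ge0_negligible_integral mN mD mf f0 N0) integral_mkcond [leRHS]integral_mkcond.
have res0 (A : set T) (h : T -> \bar R) : A `<=` D -> (forall x, D x -> 0 <= h x)%E ->
    (forall x, 0 <= (h \_ A) x)%E.
  by move=> AD h0 x; rewrite patchE; case: ifPn => // /[!inE] /AD /h0.
rewrite !ge0_integralTE; [|exact: (res0 D)|by apply: (res0 (D `\` N)) => // x []].
apply: le_ereal_sup => _ [h hf <-]; exists h => // x; apply: le_trans (hf x) _.
rewrite !patchE; case: ifPn => [|_].
  rewrite inE => -[Dx Nx]; rewrite mem_set//; apply: contrapT => fg; apply: Nx.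
  by apply: fgN => /=; apply/not_implyP.
by case: ifPn => // /[!inE] /g0.
Qed.

Section difference_quotient.
Context {R : realType}.

Lemma straddle_derivative (f : R -> R) (t e : R) : derivable f t 1 -> 0 < e ->
  exists2 d, 0 < d & forall a b, a <= t -> t <= b -> a < b -> b - a < d ->
    `|(f b - f a) / (b - a) - derive1 f t| <= e.
Proof.
move=> df e0; have := df; rewrite /derivable => /cvg_ex[l fl].
have fl' : h^-1 *: (f (h + t) - f t) @[h --> 0^'] --> l.
  have : (fun h => h^-1 *: (f (h *: 1 + t) - f t)) = (fun h => h^-1 *: (f (h + t) - f t)).
    by apply/funext => h; rewrite [h *: 1]mulr1.
  by move=> <-.
have -> : derive1 f t = l by exact/cvg_lim.
have /cvgrPdist_le/(_ e e0)/nbhs_ballP[d /= d0 dH] := fl'.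
exists d => //.
have key h : `|h| < d -> `|f (t + h) - f t - l * h| <= e * `|h|.
  move=> hd; have [->|h0] := eqVneq h 0.
    by rewrite addr0 subrr mulr0 subrr normr0 mulr0.
  have := dH h; rewrite /ball/= sub0r normrN => /(_ hd h0).
  rewrite -(ler_pM2r (_ : 0 < `|h|)) ?normr_gt0// -normrM.
  rewrite distrC; congr (`|_| <= _); rewrite mulrBl; congr (_ - _).
  by rewrite /GRing.scale/= mulrAC mulVf// mul1r [h + t]addrC.
move=> a b at_ tb ab bad.
have ba0 : 0 < b - a by rewrite subr_gt0.
rewrite -(ler_pM2r ba0) -[X in _ * X <= _](gtr0_norm ba0) -normrM mulrBl divfK ?gt_eqF//.
have k1 : `|f b - f t - l * (b - t)| <= e * (b - t).
  have := key (b - t); rewrite subrKC ger0_norm ?subr_ge0//; apply; lra.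
have k2 : `|f a - f t - l * (a - t)| <= e * (t - a).
  have := key (a - t); rewrite subrKC ler0_norm ?subr_le0// opprB; apply; lra.
rewrite (_ : _ - _ = (f b - f t - l * (b - t)) - (f a - f t - l * (a - t))); last ring.
apply: le_trans (ler_normB _ _) _; apply: le_trans (lerD k1 k2) _.
by apply: eq_ler; ring.
Qed.

End difference_quotient.

Lemma cvg_sumr {R : realType} (T I : Type) (F : set_system T) (s : seq I) (P : pred I)
    (f : I -> T -> R) (a : I -> R) : Filter F ->
  (forall i, P i -> f i x @[x --> F] --> a i) ->
  \sum_(i <- s | P i) f i x @[x --> F] --> \sum_(i <- s | P i) a i.
Proof.
by move=> FF fa; apply: cvg_big => //; exact: add_continuous.
Qed.

Lemma ae_interior_itv {R : realType} (a b : R) (P : R -> Prop) :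
  {ae (@lebesgue_measure R), forall t, a < t < b -> P t} ->
  {ae (@lebesgue_measure R), forall t, `[a, b]%classic t -> a < t < b /\ P t}.
Proof.
pose lam := @lebesgue_measure R; move=> HP.
have endpoints : {ae lam, forall t, t != a /\ t != b}.
  exists [set a; b]; split.
  - by apply: measurableU.
  - apply/eqP; rewrite -measure_le0; apply: le_trans (measureU2 _ _ _) _ => //.
    by rewrite [X in (X + _)%E]lebesgue_measure_set1 [X in (_ + X)%E]lebesgue_measure_set1 adde0.
  - move=> t /= /not_andP[] /negP; rewrite negbK => /eqP ->; [by left|by right].
apply: filterS2 HP endpoints; first exact: (ae_filter_ringOfSetsType lam).
move=> t Pt [ta tb]; rewrite /= in_itv/= => /andP[at' tb'].
have tab : a < t < b by rewrite !lt_neqAle at' tb' tb eq_sym ta.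
by split => //; exact: Pt.
Qed.

Section energy.
Context {R : realType} {n : nat}.
Implicit Types (h g : 'I_n -> R -> R) (l : seq (R * R)) (T M : R).
Local Notation lam := (@lebesgue_measure R).

Definition energy_on h l : R :=
  \sum_(p <- l) \sum_(j < n) (h j p.2 - h j p.1) ^+ 2 / (p.2 - p.1).

(** A bound rather than a supremum, so that each use concerns one finite family. The 2 offsets the
    factor 1/2 of the rate. *)
Definition energy_le T h M := forall l, itv_family 0 T l -> energy_on h l <= 2 * M.

(** Young's inequality |dh| <= (c dh^2 / dt + dt / c) / 2, with c = e / (2 M + 1) making the first
    term at most e / 2 and the choice d = e c making the second less than e / 2. *)
Lemma energy_le_ac T h M j : energy_le T h M -> absolutely_continuous_on 0 T (h j).
Proof.
move=> hM; apply/absolutely_continuous_onP => e e0.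
have M0 : 0 <= 2 * M.
  by have := hM [::]; rewrite /energy_on big_nil; apply.
pose c := e / (2 * M + 1).
have c0 : 0 < c by rewrite divr_gt0//; lra.
exists (e * c) => [|l abl ld]; first exact: mulr_gt0.
have /andP[/allP al _] := abl.
have H : variation_on (h j) l <= 2^-1 * (c * energy_on h l + c^-1 * total_length l).
  rewrite /variation_on /energy_on /total_length !mulr_sumr -big_split mulr_sumr/=.
  rewrite big_seq [leRHS]big_seq; apply: ler_sum => p pl.
  have /and3P[_ p12 _] := al p pl.
  apply: (@le_trans _ _ (2^-1 * (c * ((h j p.2 - h j p.1) ^+ 2 / (p.2 - p.1)) + c^-1 * (p.2 - p.1)))); last first.
    rewrite ler_wpM2l// lerD2r ler_wpM2l ?(ltW c0)//.
    rewrite (bigD1 j)//= lerDl; apply: sumr_ge0 => k _.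
    by rewrite mulr_ge0 ?sqr_ge0// invr_ge0 subr_ge0.
  have [->|ne] := eqVneq p.1 p.2.
    by rewrite !subrr normr0 invr0 !mulr0 addr0 mulr0.
  have L0 : 0 < p.2 - p.1 by rewrite subr_gt0 lt_neqAle ne.
  rewrite -[_ ^+ 2]real_normK ?num_real//; set x := `|_|.
  set L := p.2 - p.1 in L0 *.
  rewrite -subr_ge0 (_ : _ - _ = 2^-1 * c / L * (x - L / c) ^+ 2).
    by rewrite mulr_ge0 ?sqr_ge0// divr_ge0 ?ltW// mulr_gt0.
  by field; rewrite !gt_eqF.
apply: le_lt_trans H _.
have E : energy_on h l <= 2 * M by exact: hM.
have : c * energy_on h l <= e.
  apply: le_trans (ler_wpM2l (ltW c0) E) _.
  by rewrite /c -mulrA ler_piMr ?(ltW e0)// mulrC ler_pdivrMr; lra.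
have : c^-1 * total_length l < e by rewrite mulrC ltr_pdivrMr.
lra.
Qed.

(** Cauchy-Schwarz, obtained by integrating 2 c q - c^2 <= q^2 with c the mean of q. *)
Lemma sqr_Rintegral_le (q : R -> R) x y : x < y ->
  lam.-integrable `[x, y] (EFin \o q) ->
  lam.-integrable `[x, y] (EFin \o (fun t => q t ^+ 2)) ->
  (\int[lam]_(t in `[x, y]) q t) ^+ 2 / (y - x) <= \int[lam]_(t in `[x, y]) q t ^+ 2.
Proof.
move=> xy qi q2i; set D := \int[lam]_(t in `[x, y]) q t.
have xy0 : 0 < y - x by lra.
pose c := D / (y - x).
have cst_int (k : R) : lam.-integrable `[x, y] (EFin \o cst k).
  apply: continuous_compact_integrable; first exact: segment_compact.
  by apply: continuous_subspaceT => t; exact: cst_continuous.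
have cq_int : lam.-integrable `[x, y] (EFin \o (fun t => 2 * c * q t - c ^+ 2)).
  rewrite (_ : _ \o _ = (fun t => ((2 * c)%R%:E * (EFin \o q) t) - (EFin \o cst (c ^+ 2)%R) t)%E)//.
  apply: integrableB => //; exact: integrableZl.
have : \int[lam]_(t in `[x, y]) (2 * c * q t - c ^+ 2) <= \int[lam]_(t in `[x, y]) q t ^+ 2.
  apply: le_Rintegral => // t _.
  by rewrite -subr_ge0 (_ : _ - _ = (q t - c) ^+ 2) ?sqr_ge0//; ring.
apply: le_trans; rewrite RintegralB//; last 2 first.
- rewrite (_ : _ \o _ = (fun t => ((2 * c)%R%:E * (EFin \o q) t))%E)//.
  exact: integrableZl.
- exact: cst_int.
have -> : \int[lam]_(t in `[x, y]) (2 * c * q t) = 2 * c * D by rewrite RintegralZl.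
have -> : \int[lam]_(t in `[x, y]) c ^+ 2 = c ^+ 2 * (y - x).
  rewrite Rintegral_cst//; congr (_ * _).
  by rewrite /lam [X in fine X]lebesgue_measure_itv/= lte_fin xy.
apply: eq_ler; rewrite /c; field.
by rewrite gt_eqF.
Qed.

Lemma le_sum_integral_family T (G : R -> \bar R) l :
  measurable_fun `[0, T] G -> (forall t, 0 <= G t)%E -> itv_family 0 T l ->
  (\sum_(p <- l) \int[lam]_(t in `[p.1, p.2]) G t <= \int[lam]_(t in `[0%R, T]) G t)%E.
Proof.
move=> mG G0 /andP[/allP al pl].
have tl : trivIset setT (fun i : 'I_(size l) => `](tnth (in_tuple l) i).1, (tnth (in_tuple l) i).2[%classic).
  by apply: nonoverlap_trivIset => //; apply/allP => p /al /and3P[].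
set F := fun i : 'I__ => _ in tl.
have mF i : measurable (F i) by exact: measurable_itv.
have FT i : F i `<=` `[0, T].
  have /and3P[x0 _ yT] := al _ (mem_tnth i (in_tuple l)).
  move=> t; rewrite /F /= !in_itv/= => /andP[/ltW/(le_trans x0) -> /ltW ty].
  exact: le_trans yT.
pose D := \big[setU/set0]_(i <- index_enum 'I_(size l)) F i.
have mD : measurable D by apply: bigsetU_measurable.
have DT : D `<=` `[0, T]%classic.
  by move=> t; rewrite /D -bigcup_seq => -[i _ /FT].
apply: (@le_trans _ _ (\int[lam]_(t in D) G t)%E); last first.
  by apply: ge0_subset_integral => //; exact: measurable_itv.
rewrite /D ge0_integral_bigsetU//.
- rewrite big_tnth; apply: lee_sum => i _.
  set p := tnth _ _.
  have mGi b1 b2 : measurable_fun [set` Interval (BSide b1 p.1) (BSide b2 p.2)] G.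
    apply: measurable_funS mG => //; have /and3P[x0 _ yT] := al _ (mem_tnth i (in_tuple l)).
    by apply: subset_itv; case: b1 b2 => -[]; rewrite bnd_simp.
  by rewrite -integral_itv_bndo_bndc// -integral_itv_obnd_cbnd.
- by rewrite /index_enum -enumT enum_uniq.
- by apply: sub_trivIset tl => i _.
- exact: measurable_funS mG.
Qed.

(** Cauchy-Schwarz on each interval, followed by additivity of the integral over the family. *)
Lemma integral_energy_le T M h g : (forall j, lam.-integrable `[0, T] (EFin \o g j)) ->
  (forall j x y, 0 <= x -> x <= y -> y <= T -> h j y - h j x = \int[lam]_(t in `[x, y]) g j t) ->
  (\int[lam]_(t in `[0%R, T]) (\sum_(j < n) g j t ^+ 2)%:E <= (2 * M)%:E)%E ->
  energy_le T h M.
Proof.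
move=> gi hg gM l abl.
have mg j : measurable_fun `[0, T] (g j) by apply/measurable_EFinP; case/integrableP: (gi j).
have mG : measurable_fun `[0, T] (fun t => \sum_(j < n) g j t ^+ 2).
  by apply: measurable_sum => j; exact: measurable_funX.
have Gi : lam.-integrable `[0, T] (fun t => (\sum_(j < n) g j t ^+ 2)%:E).
  apply/integrableP; split; first exact/measurable_EFinP.
  apply: le_lt_trans (ltry (2 * M)); apply: le_trans gM.
  rewrite [leLHS](_ : _ = \int[lam]_(t in `[0%R, T]) (\sum_(j < n) g j t ^+ 2)%:E)%E//.
  apply: eq_integral => t _.
  by rewrite gee0_abs// lee_fin sumr_ge0// => j _; exact: sqr_ge0.
have g2i j : lam.-integrable `[0, T] (EFin \o (fun t => g j t ^+ 2)).
  apply: le_integrable Gi => //.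
    by apply/measurable_EFinP; exact: (measurable_funX 2 (mg j)).
  move=> t _ /=; rewrite lee_fin !ger0_norm ?sqr_ge0//; last first.
    by apply: sumr_ge0 => k _; exact: sqr_ge0.
  by rewrite (bigD1 j)//= lerDl sumr_ge0// => k _; exact: sqr_ge0.
rewrite -lee_fin; apply: le_trans gM; apply: le_trans (le_sum_integral_family _ _ abl); last 2 first.
- exact/measurable_EFinP.
- by move=> t; rewrite lee_fin sumr_ge0// => j _; exact: sqr_ge0.
rewrite /energy_on -sumEFin big_seq [leRHS]big_seq; apply: lee_sum => -[x y] pl /=.
have /andP[/allP/(_ _ pl)/= /and3P[x0 xy yT] _] := abl.
have [yx|xy'] := leP y x.
  have -> : y = x by apply/eqP; rewrite eq_le yx xy.
  rewrite big1 ?integral_ge0// => [t _|j _].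
    by rewrite lee_fin sumr_ge0// => j _; exact: sqr_ge0.
  by rewrite !subrr invr0 mulr0.
have sub : `[x, y] `<=` `[0, T] by apply: subset_itv; rewrite bnd_simp.
rewrite [leRHS](_ : _ = \int[lam]_(t in `[x, y]) \sum_(j <- index_enum 'I_n) (g j t ^+ 2)%:E)%E; last first.
  by apply: eq_integral => t _; rewrite sumEFin.
rewrite ge0_integral_sum//; last 2 first.
- move=> j; apply/measurable_EFinP.
  exact: (measurable_funX 2 (measurable_funS _ sub (mg j))).
- by move=> j t _; rewrite lee_fin sqr_ge0.
rewrite -sumEFin; apply: lee_sum => j _.
have gji : lam.-integrable `[x, y] (EFin \o (fun t => g j t ^+ 2)) by exact: integrableS (g2i j).
rewrite hg//; have gxy : lam.-integrable `[x, y] (EFin \o g j) by exact: integrableS (gi j).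
have := sqr_Rintegral_le xy' gxy gji; rewrite -lee_fin => /le_trans; apply.
by rewrite /Rintegral fineK//; exact: integrable_fin_num gji.
Qed.

Lemma uniform_family T N : 0 <= T ->
  itv_family 0 T [seq (T / N%:R * i%:R, T / N%:R * i.+1%:R) | i <- iota 0 N].
Proof.
move=> T0; case: N => [//|N]; set dt := T / _.
have dt0 : 0 <= dt by rewrite divr_ge0.
have mon (i k : nat) : (i <= k)%N -> dt * i%:R <= dt * k%:R.
  by move=> ik; rewrite ler_wpM2l// ler_nat.
apply/andP; split.
  apply/allP => _ /mapP[i + ->] /=; rewrite mem_iota add0n => /andP[_ iN].
  apply/and3P; split; [by rewrite mulr_ge0|exact: mon|].
  by rewrite [leRHS](_ : _ = dt * N.+1%:R) ?mon// /dt divfK// pnatr_eq0.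
rewrite pairwise_map.
apply: (@sub_pairwise _ ltn); last by rewrite -sorted_pairwise ?iota_ltn_sorted//; exact: ltn_trans.
by move=> i k ik; rewrite /nonoverlap/= mon.
Qed.

End energy.

Section energy_fatou.
Context {R : realType} {n : nat}.
Implicit Types (h g : 'I_n -> R -> R) (l : seq (R * R)) (T M : R).
Local Notation lam := (@lebesgue_measure R).

(** Fatou's lemma for the step functions made of squared difference quotients on uniform grids:
    their integrals are bounded by grid energies, and they converge wherever [h] is differentiable,
    by the straddle lemma. *)
Lemma energy_le_integral T M h g : 0 < T -> energy_le T h M ->
  {ae lam, forall t, 0 < t < T -> forall j, derivable (h j) t 1 /\ derive1 (h j) t = g j t} ->
  (\int[lam]_(t in `[0%R, T]) (\sum_(j < n) g j t ^+ 2)%:E <= (2 * M)%:E)%E.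
Proof.
move=> T0 hM hg.
pose dt N : R := T / N.+1%:R.
pose E N i : set R := `[(dt N * i%:R), (dt N * i.+1%:R)[%classic.
pose c N i : R := \sum_(j < n) ((h j (dt N * i.+1%:R) - h j (dt N * i%:R)) / dt N) ^+ 2.
pose F N t : R := \sum_(i <- iota 0 N.+1) c N i * \1_(E N i) t.
have dt0 N : 0 < dt N by rewrite divr_gt0.
have c0 N i : 0 <= c N i by apply: sumr_ge0 => j _; exact: sqr_ge0.
have F0 N t : 0 <= F N t by apply: sumr_ge0 => i _; rewrite mulr_ge0.
have mE N i : measurable (E N i) by exact: measurable_itv.
have mindic N i : measurable_fun `[0, T] (fun t => \1_(E N i) t : R).
  exact: measurable_indic.
have mcE N i : measurable_fun `[0, T] (fun t => c N i * \1_(E N i) t).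
  by apply: measurable_funM => //; exact: mindic.
have mF N : measurable_fun `[0, T] (F N).
  by apply: measurable_sum => i; exact: mcE.
have intF N : (\int[lam]_(t in `[0%R, T]) (F N t)%:E <= (2 * M)%:E)%E.
  rewrite [leLHS](_ : _ = \int[lam]_(t in `[0%R, T]) \sum_(i <- iota 0 N.+1) (c N i * \1_(E N i) t)%:E)%E; last first.
    by apply: eq_integral => t _; rewrite sumEFin.
  rewrite ge0_integral_sum//; last 2 first.
  - by move=> i; apply/measurable_EFinP; exact: mcE.
  - by move=> i t _; rewrite lee_fin mulr_ge0.
  have := hM _ (uniform_family N.+1 (ltW T0)); rewrite -lee_fin; apply: le_trans.
  rewrite /energy_on big_map -sumEFin; apply: lee_sum => i _ /=.
  rewrite [leLHS](_ : _ = \int[lam]_(t in `[0%R, T]) ((c N i)%:E * (\1_(E N i) t)%:E))%E//.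
  rewrite ge0_integralZl//; last 2 first.
  - by apply/measurable_EFinP; exact: mindic.
  - by rewrite lee_fin.
  apply: (@le_trans _ _ ((c N i)%:E * lam (E N i))%E).
    rewrite lee_wpmul2l ?lee_fin//.
    rewrite (_ : (\int[lam]_(t in `[0%R, T]) _)%E = lam (E N i `&` `[0, T])); last first.
      by apply: integral_indic => //; exact: mE.
    apply: le_measure; rewrite ?inE//; last exact: mE.
    by apply: measurableI => //; exact: mE.
  rewrite /E [X in (_ * X)%E]lebesgue_measure_itv/= lte_fin ltr_pM2l// ltr_nat ltnSn -EFinB -EFinM lee_fin.
  rewrite -mulrBr -natrB// subSnn mulr1 /c mulr_suml; apply: ler_sum => j _.
  rewrite -!/(dt N); apply: eq_ler.
  by field; rewrite gt_eqF.
(* The lower limit is measurable as it stands, while nothing is known of the measurability of [g];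
   the two sides are compared only almost everywhere. *)
pose G t := limn_einf (fun N => (F N t)%:E).
have mG : measurable_fun `[0, T] G.
  rewrite /G /limn_einf; apply: measurableT_comp => //.
  apply: measurable_fun_limn_esup => N.
  by apply: measurableT_comp => //; apply/measurable_EFinP; exact: mF.
have G0 t : (0 <= G t)%E.
  rewrite /G limn_einf_lim; apply: lime_ge; first exact: is_cvg_einfs.
  by apply: nearW => N; apply: le_ereal_inf_tmp => _ [k _ <-]; rewrite lee_fin.
apply: (@le_trans _ _ (\int[lam]_(t in `[0%R, T]) G t)%E); last first.
  have mF' N : measurable_fun `[0, T] (fun t => (F N t)%:E).
    by apply/measurable_EFinP; exact: mF.
  have F0' N t : `[0, T]%classic t -> (0 <= (F N t)%:E)%E by rewrite lee_fin.
  apply: (le_trans (@fatou _ _ _ lam _ (measurable_itv _) _ mF' F0')).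
  rewrite limn_einf_lim; apply: lime_le; first exact: is_cvg_einfs.
  apply: nearW => N; apply: le_trans (intF N).
  by apply: ereal_inf_lbound; exists N => /=.
apply: ae_ge0_le_lower_integral => //.
- by move=> t _; rewrite lee_fin sumr_ge0// => j _; exact: sqr_ge0.
apply: filterS (ae_interior_itv hg); first exact: (ae_filter_ringOfSetsType lam).
move=> t /[apply] -[/andP[t0 tT] tg]; have t0' := ltW t0.
(* The index of the cell containing [t], the only one that contributes to [F N t]. *)
pose i N := Num.truncn (t / dt N).
have iP N : dt N * (i N)%:R <= t < dt N * (i N).+1%:R.
  have := @truncn_itv _ (t / dt N) (divr_ge0 t0' (ltW (dt0 N))).
  by rewrite ler_pdivlMr// ltr_pdivrMr// mulrC [_.+1%:R * _]mulrC.
have iN N : (i N < N.+1)%N.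
  have /andP[+ _] := iP N; move=> /le_lt_trans/(_ tT).
  by rewrite mulrC -ltr_pdivlMr// /dt invf_div mulrCA divff ?gt_eqF// mulr1 ltr_nat.
pose Q j N := (h j (dt N * (i N).+1%:R) - h j (dt N * (i N)%:R)) / dt N.
have FE N : F N t = \sum_(j < n) (Q j N) ^+ 2.
  rewrite /F (bigD1_seq (i N)) ?mem_iota ?add0n ?iN ?iota_uniq//=.
  rewrite big1 ?addr0.
    by rewrite indicE mem_set ?mulr1// /E /= in_itv/=; exact: iP.
  move=> k ki; rewrite indicE memNset ?mulr0// /E /= in_itv/= => /andP[kt tk].
  have /andP[it ti] := iP N.
  have : (k < (i N).+1)%N.
    by have := le_lt_trans kt ti; rewrite ltr_pM2l// ltr_nat.
  have : (i N < k.+1)%N.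
    by have := le_lt_trans it tk; rewrite ltr_pM2l// ltr_nat.
  by rewrite !ltnS => h1 h2; move: ki; rewrite eqn_leq h1 h2.
have dtl N : dt N * (i N).+1%:R - dt N * (i N)%:R = dt N.
  by rewrite -mulrBr -natrB// subSnn mulr1.
have dt_cvg : dt N @[N --> \oo] --> 0.
  rewrite -[X in _ --> X](mulr0 T); apply: cvgMr; exact: cvg_harmonic.
have Qcvg j : Q j N @[N --> \oo] --> g j t.
  have [dj <-] := tg j; apply/cvgrPdist_le => e e0.
  have [d d0 dH] := straddle_derivative dj e0.
  near=> N; have Nd : dt N < d by near: N; exact: (cvgr_lt _ dt_cvg).
  rewrite distrC; have /andP[it ti] := iP N.
  have := dH _ _ it (ltW ti); rewrite dtl; apply => //.
  by rewrite ltr_pM2l// ltr_nat.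
apply/eq_ler/esym.
suff H : (F N t)%:E @[N --> \oo] --> (\sum_(j < n) g j t ^+ 2)%:E.
  by have [] := cvg_limn_einf_sup H.
apply: cvg_EFin; first by apply: nearW.
rewrite (_ : fine \o _ = fun N => \sum_(j < n) Q j N ^+ 2); last first.
  by apply/funext => N /=; rewrite FE.
apply: cvg_sumr => j _.
by rewrite expr2; under eq_fun do rewrite expr2; exact: cvgM.
Unshelve. all: by end_near. Qed.

End energy_fatou.

(** * The drift and its potential *)

Section cotangent.
Context {R : realType}.
Implicit Types u v s : R.

Lemma ler_norm_sin u : `|sin u| <= `|u|.
Proof.
have H v : 0 < v -> `|sin v| <= v.
  move=> v0; have [c _] : exists2 c, c \in `]0, v[ & sin v - sin 0 = cos c * (v - 0).
    by apply: MVT => //; apply: continuous_subspaceT => x; exact: continuous_sin.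
  rewrite sin0 !subr0 => ->; rewrite normrM (gtr0_norm v0) ler_piMl ?cos_max// ltW//.
have [u0|u0|->] := ltgtP u 0; last by rewrite sin0.
- by rewrite -normrN -sinN -[leRHS]normrN [leRHS]gtr0_norm ?oppr_gt0// H// oppr_gt0.
- by rewrite [leRHS]gtr0_norm// H.
Qed.

Lemma sin_lower_bound s : 0 < s ->
  exists2 m : R, 0 < m & forall u, s <= u <= pi - s -> m <= sin u.
Proof.
move=> s0; have [sp|ps] := leP s (pi - s); last first.
  by exists 1 => // u /andP[su us]; move: (le_trans su us); rewrite leNgt ps.
have [|c cs H] := @EVT_min R sin s (pi - s) sp.
  by apply: continuous_subspaceT => x; exact: continuous_sin.
exists (sin c); last by move=> u su; apply: H; rewrite in_itv.
by move: cs; rewrite in_itv/= => /andP[sc cs]; apply: sin_gt0_pi; lra.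
Qed.

Lemma cotN u : cot (- u) = - cot u.
Proof. by rewrite /cot sinN cosN invrN mulrN. Qed.

Lemma cot_sub u v : sin u != 0 -> sin v != 0 ->
  cot u - cot v = sin (v - u) / (sin u * sin v).
Proof. by move=> u0 v0; rewrite /cot sinB; field; rewrite u0 v0. Qed.

Lemma cot_lipschitz s : 0 < s -> exists2 L : R, 0 < L & forall u v,
  s <= u <= pi - s -> s <= v <= pi - s ->
  `|cot u| <= L /\ `|cot u - cot v| <= L * `|u - v|.
Proof.
move=> s0; have [m m0 mH] := sin_lower_bound s0.
have m1 : 0 < m^-1 by rewrite invr_gt0.
(* The first term bounds [cot], the second its Lipschitz constant. *)
exists (m^-1 + m^-1 ^+ 2); first by rewrite addr_gt0// exprn_gt0.
move=> u v /mH mu /mH mv.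
have u0 : 0 < sin u by lra.
have v0 : 0 < sin v by lra.
have iu : (sin u)^-1 <= m^-1 by rewrite lef_pV2.
have iv : (sin v)^-1 <= m^-1 by rewrite lef_pV2.
split.
  rewrite /cot normrM [`|_^-1|]gtr0_norm ?invr_gt0//.
  apply: (@le_trans _ _ (1 * m^-1)).
    by rewrite ler_pM// ?cos_max// invr_ge0 ltW.
  by rewrite mul1r lerDl sqr_ge0.
rewrite cot_sub ?gt_eqF// normrM mulrC.
apply: ler_pM => //; last by rewrite distrC ler_norm_sin.
rewrite gtr0_norm ?invr_gt0 ?mulr_gt0// invfM expr2.
by apply: (@le_trans _ _ (m^-1 * m^-1)); [apply: ler_pM; rewrite ?invr_ge0// ltW|rewrite lerDr ltW].
Qed.

Lemma cot_nonincreasing u v : 0 < u -> u <= v -> v < pi -> cot v <= cot u.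
Proof.
move=> u0 uv vp; rewrite -subr_ge0 cot_sub; last 2 first.
- by rewrite gt_eqF// sin_gt0_pi// u0 (le_lt_trans uv vp).
- by rewrite gt_eqF// sin_gt0_pi// vp (lt_le_trans u0 uv).
apply: divr_ge0; first by apply: sin_ge0_pi; lra.
by apply: mulr_ge0; apply: sin_ge0_pi; lra.
Qed.

(* Concavity of [ln \o sin] on ]0, pi[. *)
Lemma ln_sin_tangent u v : 0 < u < pi -> 0 < v < pi ->
  ln (sin u) - ln (sin v) <= cot v * (u - v).
Proof.
have dlns (x : R) : 0 < x < pi -> is_derive x 1 (fun x => ln (sin x)) (cot x).
  move=> xpi; rewrite /cot mulrC.
  apply: (@is_derive1_comp R (@ln R) sin).
  by apply: is_derive1_ln; exact: sin_gt0_pi.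
have clns (a b : R) : 0 < a -> b < pi -> {within `[a, b], continuous (fun x => ln (sin x))}.
  move=> a0 bp; apply: derivable_within_continuous => x; rewrite in_itv/= => /andP[ax xb].
  by have [|//] := dlns x; lra.
move=> /andP[u0 up] /andP[v0 vp]; have [uv|vu|->] := ltgtP u v.
- have [||c] := @MVT R (fun x => ln (sin x)) cot u v uv.
  + by move=> x; rewrite in_itv/= => /andP[ux xv]; apply: dlns; lra.
  + exact: clns.
  rewrite in_itv/= => /andP[uc cv] E.
  have := cot_nonincreasing (lt_trans u0 uc) (ltW cv) vp.
  by rewrite -(ler_pM2r (_ : 0 < v - u)) ?subr_gt0//; lra.
- have [||c] := @MVT R (fun x => ln (sin x)) cot v u vu.
  + by move=> x; rewrite in_itv/= => /andP[ux xv]; apply: dlns; lra.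
  + exact: clns.
  rewrite in_itv/= => /andP[uc cv] E.
  have := cot_nonincreasing v0 (ltW uc) (lt_trans cv up).
  by rewrite -(ler_pM2r (_ : 0 < u - v)) ?subr_gt0//; lra.
- by rewrite !subrr mulr0.
Qed.

End cotangent.

Section drift_potential.
Context {R : realType} {n : nat}.
Implicit Types (x y : 'I_n -> R) (s mu c : R).

(** The chamber bounds only the extreme gap by 2 pi; the bound on every pair, which follows from it,
    is the form suited to pair interactions. *)
Definition ordered x := forall i j : 'I_n, (i < j)%N -> 0 < x j - x i < 2 * pi.

(** The factors 2 put the half gaps, which are the arguments of [cot], in [s, pi - s]. The upper
    bound keeps particles apart across the point where the circle closes. *)
Definition separated s x :=
  forall i j : 'I_n, (i < j)%N -> 2 * s <= x j - x i <= 2 * pi - 2 * s.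

Lemma chamberP (v : 'rV[R]_n) : chamber R n v <-> ordered (fun j => v ord0 j).
Proof.
split=> [[vlt v2pi] i j ij|ov].
  rewrite subr_gt0 vlt//=; case: n v vlt v2pi i j ij => [|m] v vlt v2pi i j ij; first by case: i ij.
  have := v2pi ord0 ord_max erefl erefl.
  have vi : v ord0 ord0 <= v ord0 i.
    have [->//|i0] := eqVneq i ord0; apply/ltW/vlt.
    by rewrite lt0n; apply: contra i0 => /eqP i0; apply/eqP/val_inj.
  have vj : v ord0 j <= v ord0 ord_max.
    have [->//|jm] := eqVneq j ord_max; apply/ltW/vlt.
    by rewrite ltn_neqAle -ltnS ltn_ord andbT; apply: contra jm => /eqP jm; apply/eqP/val_inj.
  lra.
split=> [i j /ov /andP[]|i j i0 jn]; first by rewrite subr_gt0.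
have [ij|] := ltnP i j; first by have /andP[_] := ov i j ij; lra.
rewrite i0 leqn0 => /eqP j0; have -> : i = j by apply: val_inj; rewrite /= i0 j0.
by rewrite ltrDl mulr_gt0// pi_gt0.
Qed.

Lemma separated_ordered s x : 0 < s -> separated s x -> ordered x.
Proof. by move=> s0 xs i j ij; have := xs i j ij; lra. Qed.

Lemma separated_close s x y : separated s x ->
  (forall i, `|x i - y i| <= s / 2) -> separated (s / 2) y.
Proof.
move=> xs xy i j ij; have := xs i j ij.
have := xy i; have := xy j; rewrite !ler_norml => /andP[? ?] /andP[? ?] /andP[? ?].
by apply/andP; split; lra.
Qed.

Lemma norm_sum_le (F : 'I_n -> R) c (j : 'I_n) : 0 <= c ->
  (forall i, i != j -> `|F i| <= c) -> `|\sum_(i < n | i != j) F i| <= n%:R * c.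
Proof.
move=> c0 Fc; apply: le_trans (ler_norm_sum _ _ _) _.
apply: (@le_trans _ _ (\sum_(i < n) c)).
  rewrite [leRHS](bigID (fun i => i != j))/=.
  by apply: ler_wpDr; [exact: sumr_ge0|exact: ler_sum].
by rewrite sumr_const card_ord mulr_natl.
Qed.

Lemma half_gap s x (i j : 'I_n) : separated s x -> (i < j)%N ->
  s <= (x j - x i) / 2 <= pi - s.
Proof.
by move=> xs ij; have := xs i j ij; rewrite ler_pdivlMr// ler_pdivrMr//; lra.
Qed.

Lemma cot_gap_lipschitz s : 0 < s -> exists2 L : R, 0 < L &
  forall x y (i j : 'I_n), separated s x -> separated s y -> i != j ->
    `|cot ((x j - x i) / 2)| <= L /\
    `|cot ((x j - x i) / 2) - cot ((y j - y i) / 2)| <=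
      L * `|(x j - x i) / 2 - (y j - y i) / 2|.
Proof.
move=> s0; have [L L0 LH] := cot_lipschitz s0; exists L => // x y i j xs ys.
rewrite neq_ltn => /orP[ij|ji].
  exact: LH (half_gap xs ij) (half_gap ys ij).
have [h1 h2] := LH _ _ (half_gap xs ji) (half_gap ys ji).
rewrite -(opprB (x i)) -(opprB (y i)) !mulNr !cotN normrN; split => //.
by rewrite -!opprD !normrN.
Qed.

Lemma drift_lipschitz s mu : 0 < s -> exists2 L : R, 0 < L &
  (forall x j, separated s x -> `|drift mu x j| <= L) /\
  (forall x y j (d : R), separated s x -> separated s y -> (forall i, `|x i - y i| <= d) ->
     `|drift mu x j - drift mu y j| <= L * d).
Proof.
move=> s0; have [L L0 key] := cot_gap_lipschitz s0.
have muL : 0 <= n%:R * L by rewrite mulr_ge0// ltW.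
have mu0 := normr_ge0 mu.
exists (`|mu| + 2 * (n%:R * L) + 1).
  by rewrite ltr_wpDl// addr_ge0// mulr_ge0.
split=> [x j xs|x y j d xs ys xyd].
  rewrite /drift; apply: le_trans (ler_normD _ _) _.
  rewrite normrM (ger0_norm (_ : 0 <= 2))// -addrA lerD2l ler_wpDr//.
  rewrite ler_pM2l//; apply: norm_sum_le; first exact: ltW.
  by move=> i ij; have [] := key x x i j xs xs ij.
have d0 : 0 <= d by apply: le_trans (xyd j).
rewrite /drift opprD addrACA subrr add0r -mulrBr -sumrB normrM (ger0_norm (_ : 0 <= 2))//.
have Ld : 0 <= L * d by rewrite mulr_ge0// ltW.
apply: (@le_trans _ _ (2 * (n%:R * (L * d)))).
  rewrite ler_pM2l//; apply: norm_sum_le => // i ij.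
  apply: le_trans (key x y i j xs ys ij).2 _; rewrite ler_wpM2l ?(ltW L0)//.
  rewrite -mulrBl normrM [`|2^-1|]ger0_norm ?invr_ge0// ler_pdivrMr//.
  rewrite (_ : _ - _ = (x j - y j) - (x i - y i)); last by ring.
  apply: le_trans (ler_normB _ _) _.
  by rewrite mulr_natr mulr2n lerD.
rewrite [leRHS](_ : _ = 2 * (n%:R * (L * d)) + (`|mu| + 1) * d); last by ring.
by rewrite lerDl mulr_ge0// addr_ge0.
Qed.

Definition repulsion x (j : 'I_n) : R := 2 * \sum_(i < n | i != j) cot ((x j - x i) / 2).

Lemma driftE mu x j : drift mu x j = mu + repulsion x j.
Proof. by []. Qed.

(** The logarithmic gas on the circle. Each pair is counted twice and differentiation halves the
    angle, so the factor 2 makes the gradient exactly the opposite of [repulsion]. *)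
Definition potential x : R :=
  - (2 * \sum_(j < n) \sum_(i < n | i != j) ln `|sin ((x j - x i) / 2)|).

Lemma half_gap_gt0 x (i j : 'I_n) : ordered x -> (i < j)%N ->
  0 < (x j - x i) / 2 < pi.
Proof.
move=> ox ij; have /andP[h1 h2] := ox i j ij.
by rewrite divr_gt0//= ltr_pdivrMr// mulrC.
Qed.

Lemma ln_norm_sin_le0 (u : R) : ln `|sin u| <= 0.
Proof. exact/ln_le0/sin_max. Qed.

(* By antisymmetry of [cot]: each pair contributes the same amount from both sides. *)
Lemma sum_repulsion x (z : 'I_n -> R) :
  \sum_(j < n) \sum_(i < n | i != j) cot ((x j - x i) / 2) * (z j - z i) =
  \sum_(j < n) repulsion x j * z j.
Proof.
pose c (i j : 'I_n) := cot ((x j - x i) / 2).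
have cN i j : c j i = - c i j by rewrite /c -cotN -mulNr opprB.
have E : \sum_(j < n) \sum_(i < n | i != j) c i j * z i =
         - \sum_(j < n) \sum_(i < n | i != j) c i j * z j.
  rewrite (exchange_big_dep xpredT)//= -sumrN; apply: eq_bigr => i _.
  rewrite -sumrN; apply: eq_big => [j|j ij]; first by rewrite eq_sym.
  by rewrite cN mulNr.
transitivity (\sum_(j < n) \sum_(i < n | i != j) c i j * z j -
              \sum_(j < n) \sum_(i < n | i != j) c i j * z i).
  rewrite -sumrB; apply: eq_bigr => j _; rewrite -sumrB; apply: eq_bigr => i _.
  by rewrite mulrBr.
rewrite E opprK -mulr2n -mulr_natl mulr_sumr; apply: eq_bigr => j _.
by rewrite /repulsion -mulrA mulr_suml.
Qed.

Lemma ln_norm_sin_tangent x y (i j : 'I_n) : ordered x -> ordered y -> i != j ->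
  ln `|sin ((x j - x i) / 2)| - ln `|sin ((y j - y i) / 2)| <=
  cot ((y j - y i) / 2) * ((x j - x i) / 2 - (y j - y i) / 2).
Proof.
move=> ox oy; wlog ij : i j / (i < j)%N => [H|_].
  rewrite neq_ltn => /orP[ij|ji]; first by apply: H => //; rewrite neq_ltn ij.
  have := H j i ji; rewrite neq_ltn ji => /(_ isT).
  rewrite -(opprB (x j)) -(opprB (y j)) !mulNr !sinN !normrN cotN mulNr -mulrN.
  by rewrite opprD !opprK.
have xij := half_gap_gt0 ox ij; have yij := half_gap_gt0 oy ij.
by rewrite !gtr0_norm ?sin_gt0_pi//; exact: ln_sin_tangent.
Qed.

(* Convexity of the potential, whose gradient is the opposite of the repulsion. *)
Lemma potential_tangent x y : ordered x -> ordered y ->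
  potential y - potential x <= - \sum_(j < n) repulsion y j * (y j - x j).
Proof.
move=> ox oy; rewrite -sum_repulsion /potential opprK addrC -mulrBr -sumrB.
rewrite -sumrN mulr_sumr; apply: ler_sum => j _.
rewrite -sumrB -sumrN mulr_sumr; apply: ler_sum => i ij.
have := ln_norm_sin_tangent ox oy ij.
move/(ler_wpM2l (ler0n R 2)) => /le_trans; apply.
by apply: eq_ler; field.
Qed.

(** The tangent inequality at each of the two points, with the gradient bounded by the drift bound
    for mu = 0. *)
Lemma potential_lipschitz s : 0 < s -> exists2 L : R, 0 < L &
  forall x y (d : R), 0 <= d -> separated s x -> separated s y ->
    (forall i, `|x i - y i| <= d) -> `|potential x - potential y| <= L * d.
Proof.
move=> s0; have [L L0 [LH _]] := drift_lipschitz 0 s0.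
exists (n%:R * L + 1); first by rewrite ltr_wpDl// mulr_ge0// ltW.
move=> x y d d0 xs ys xyd.
have half u v : separated s u -> separated s v -> (forall i, `|u i - v i| <= d) ->
    potential u - potential v <= n%:R * L * d.
  move=> us vs uvd; have ou := separated_ordered s0 us; have ov := separated_ordered s0 vs.
  apply: le_trans (potential_tangent ov ou) _; apply: le_trans (ler_norm _) _.
  rewrite normrN; apply: le_trans (ler_norm_sum _ _ _) _.
  apply: (@le_trans _ _ (\sum_(j < n) L * d)).
    apply: ler_sum => j _; rewrite normrM; apply: ler_pM => //.
    by have := LH u j us; rewrite driftE add0r.
  by rewrite sumr_const card_ord -[leLHS]mulr_natl mulrA.
have h1 := half x y xs ys xyd.
have h2 : potential y - potential x <= n%:R * L * d.
  by apply: half => // i; rewrite distrC.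
rewrite mulrDl mul1r ler_wpDr// ler_norml h1 lerNl opprB.
by rewrite h2.
Qed.

(** All logarithms are nonpositive, so a single pair already satisfies - 2 ln sin <= c. Then sin u
    <= u and sin u <= pi - u bound the half gap on both sides. *)
Lemma potential_separated x c : ordered x -> potential x <= c ->
  separated (expR (- (c / 2))) x.
Proof.
move=> ox xc i j ij; have h := half_gap_gt0 ox ij; have /andP[h1 h2] := h.
have sc : expR (- (c / 2)) <= sin ((x j - x i) / 2).
  rewrite -[leRHS]lnK ?posrE ?sin_gt0_pi// ler_expR.
  rewrite -lerN2 opprK ler_pdivlMr// mulrC; apply: le_trans xc.
  rewrite /potential -mulrN ler_pM2l// lerN2.
  rewrite (bigD1 j)//= (bigD1 i) ?neq_ltn ?ij//= gtr0_norm ?sin_gt0_pi//.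
  rewrite -addrA gerDl -[leRHS](addr0 0) lerD//.
    by apply: sumr_le0 => k _; exact: ln_norm_sin_le0.
  by apply: sumr_le0 => k _; apply: sumr_le0 => l _; exact: ln_norm_sin_le0.
have u1 : sin ((x j - x i) / 2) <= (x j - x i) / 2.
  by have := ler_norm_sin ((x j - x i) / 2); rewrite !gtr0_norm ?sin_gt0_pi.
have u2 : sin ((x j - x i) / 2) <= pi - (x j - x i) / 2.
  rewrite (_ : sin _ = sin (pi - (x j - x i) / 2)); last first.
    by rewrite [RHS]sinB sinpi cospi mul0r sub0r mulN1r opprK.
  apply: le_trans (ler_norm _) _; apply: le_trans (ler_norm_sin _) _.
  by rewrite gtr0_norm ?subr_gt0.
by apply/andP; split; lra.
Qed.

End drift_potential.

(** * Driven paths *)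

Section continuous_integral.
Context {R : realType}.
Implicit Types (f : R -> R) (a b s t : R).
Local Notation lam := (@lebesgue_measure R).

Lemma continuous_uniform_itv f a b e : continuous f -> 0 < e ->
  exists2 d : R, 0 < d & forall s t, a <= s <= b -> `|s - t| < d -> `|f s - f t| < e.
Proof.
move=> cf e0; have e20 : 0 < e / 2 by lra.
have /compact_near_coveringP/near_covering_withinP := @segment_compact R a b.
move=> /(_ R 0^'+ (fun d s => forall t, `|s - t| < d -> `|f s - f t| < e) _) H.
have [s _|d /= d0 dH] := H _.
  have /cvgrPdist_lt/(_ _ e20)/nbhs_ballP[d /= d0 dH] := cf s.
  exists (ball s (d / 2), [set r | r < d / 2]).
    split => /=; first by apply: nbhsx_ballx; rewrite divr_gt0.
    by apply: nbhs_right_lt; rewrite divr_gt0.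
  move=> [u r] /= [us rd] _ t tr.
  have fu : `|f s - f u| < e / 2 by apply: dH; apply: lt_trans us _; lra.
  have ft : `|f s - f t| < e / 2.
    apply: dH; rewrite /ball/= -(subrKA u).
    by apply: le_lt_trans (ler_normD _ _) _; move: us; rewrite /ball/=; lra.
  rewrite -(subrKA (f s)); apply: le_lt_trans (ler_normD _ _) _.
  by move: fu; rewrite distrC; lra.
exists (d / 2); first by rewrite divr_gt0.
move=> s t sab; apply: (dH (d / 2)).
- by rewrite /= sub0r normrN gtr0_norm; lra.
- by lra.
- by rewrite /= in_itv.
Qed.

Lemma continuous_integrable_itv f a b : continuous f ->
  lam.-integrable `[a, b] (EFin \o f).
Proof.
by move=> cf; apply: continuous_compact_integrable; [exact: segment_compact|exact: continuous_subspaceT].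
Qed.

Lemma integral_itvB f s t : continuous f -> 0 <= s -> s <= t ->
  \int[lam]_(r in `[0, t]) f r - \int[lam]_(r in `[0, s]) f r = \int[lam]_(r in `[s, t]) f r.
Proof.
move=> cf s0 st; have fi a b := @continuous_integrable_itv f a b cf.
rewrite Rintegral_itvB ?bnd_simp//.
apply: Rintegral_itv_obnd_cbnd; apply: integrableS (fi s t) => //.
by apply: subset_itv; rewrite bnd_simp.
Qed.

Lemma integral_itv_cst s t (c : R) : s <= t -> \int[lam]_(r in `[s, t]) c = c * (t - s).
Proof.
move=> st; rewrite Rintegral_cst//; congr (_ * _).
rewrite [X in fine X]lebesgue_measure_itv/= lte_fin.
by case: ltP => // ts; apply/esym/eqP; rewrite subr_eq0 eq_le st ts.
Qed.

Lemma norm_integral_itv_le f s t (c : R) : continuous f -> s <= t ->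
  (forall r, s <= r <= t -> `|f r| <= c) -> `|\int[lam]_(r in `[s, t]) f r| <= c * (t - s).
Proof.
move=> cf st fc; apply: le_trans (le_normr_Rintegral _ _) _ => //.
  exact: continuous_integrable_itv.
rewrite -integral_itv_cst//; apply: le_Rintegral => //.
- apply: continuous_integrable_itv => x; apply: cvg_norm; exact: cf.
- by apply: continuous_integrable_itv => x; exact: cvg_cst.
Qed.

End continuous_integral.

Section noise.
Context {R : realType} {n : nat}.
Implicit Types (x : 'I_n -> R -> R) (T M mu : R).
Local Notation lam := (@lebesgue_measure R).

Definition drift_along mu x j t := drift mu (fun i => x i t) j.

(* The driving path [W] of [x_j(t) = W_j(t) + \int_0^t drift_j(x(s)) ds]. *)
Definition noise mu x j t := x j t - \int[lam]_(s in `[0, t]) drift_along mu x j s.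

(** Paths live on the whole line, which spares continuity relative to an interval; a path on [0, T]
    enters through [clip]. *)
Definition chamber_path x := (forall j, continuous (x j)) /\ forall t, ordered (fun i => x i t).

Lemma half_gap_neq0 (v : 'I_n -> R) (i j : 'I_n) : ordered v -> i != j ->
  sin ((v j - v i) / 2) != 0.
Proof.
move=> ov; rewrite neq_ltn => /orP[ij|ji].
  by rewrite gt_eqF// sin_gt0_pi// half_gap_gt0.
by rewrite -(opprB (v i)) mulNr sinN oppr_eq0 gt_eqF// sin_gt0_pi// half_gap_gt0.
Qed.

Lemma drift_along_continuous mu x j : chamber_path x -> continuous (drift_along mu x j).
Proof.
move=> [cx ox] t; apply: cvgD; first exact: cvg_cst.
apply: cvgMr; apply: cvg_sumr => i ij.
have c : (x j s - x i s) / 2 @[s --> t] --> (x j t - x i t) / 2.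
  by apply: cvgMl; apply: cvgB; exact: cx.
apply: cvgM; first by apply: (cvg_comp _ _ c); exact: continuous_cos.
apply: cvgV; first exact: (half_gap_neq0 (ox t) ij).
by apply: (cvg_comp _ _ c); exact: continuous_sin.
Qed.

Lemma potential_along_continuous x : chamber_path x ->
  continuous (fun t => potential (fun i => x i t)).
Proof.
move=> [cx ox] t; apply: cvgN; apply: cvgMr.
apply: cvg_sumr => j _; apply: cvg_sumr => i ij.
have c : (x j s - x i s) / 2 @[s --> t] --> (x j t - x i t) / 2.
  by apply: cvgMl; apply: cvgB; exact: cx.
have c' : `|sin ((x j s - x i s) / 2)| @[s --> t] --> `|sin ((x j t - x i t) / 2)|.
  by apply: cvg_norm; apply: (cvg_comp _ _ c); exact: continuous_sin.
apply: (cvg_comp _ _ c'); apply: continuous_ln; rewrite normr_gt0.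
exact: (half_gap_neq0 (ox t) ij).
Qed.

Lemma itv_family_le (T T' : R) l : T <= T' -> itv_family 0 T l -> itv_family 0 T' l.
Proof.
move=> TT /andP[al pl]; apply/andP; split => //; apply: sub_all al => p /and3P[-> ->].
by move=> /le_trans ->.
Qed.

Lemma energy_le_ge0 T M (h : 'I_n -> R -> R) : energy_le T h M -> 0 <= M.
Proof. by move/(_ [::] erefl); rewrite /energy_on big_nil pmulr_rge0. Qed.

Lemma energy_le_horizon T T' M (h : 'I_n -> R -> R) : T' <= T ->
  energy_le T h M -> energy_le T' h M.
Proof. by move=> TT hM l /(itv_family_le TT); exact: hM. Qed.

(** One time step, with b the repulsion, p the increment of the driver and E the integral of the
    drift. As E is close to (mu + b) dt, a term - b^2 dt appears, and completing the square absorbs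
    in it the products of b with p and with the rest of E. The 1 in |mu| + 1 is the tolerance on
    E. *)
Lemma dissipation_le (b mu p E dt : R) : 0 < dt -> `|E - (mu + b) * dt| <= dt ->
  - (b * (p + E)) <= 2^-1 * (p ^+ 2 / dt) + 2^-1 * (`|mu| + 1) ^+ 2 * dt.
Proof.
move=> dt0 Edt; pose m := E / dt - b; pose q := p / dt.
have mb : `|m| <= `|mu| + 1.
  have mdt : m * dt = mu * dt + (E - (mu + b) * dt) by rewrite /m; field; rewrite gt_eqF.
  rewrite -(ler_pM2r dt0) -{1}(gtr0_norm dt0) -normrM mdt.
  apply: le_trans (ler_normD _ _) _; rewrite [leRHS]mulrDl [1 * dt]mul1r.
  by apply: lerD => //; rewrite normrM (gtr0_norm dt0).
have m2 : m ^+ 2 <= (`|mu| + 1) ^+ 2 by rewrite -[m ^+ 2]real_normK ?num_real// ler_pXn2r ?nnegrE ?addr_ge0.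
have -> : E = (b + m) * dt by rewrite /m; field; rewrite gt_eqF.
have -> : p = q * dt by rewrite /q divfK ?gt_eqF.
have -> : (q * dt) ^+ 2 / dt = q ^+ 2 * dt by field; rewrite gt_eqF.
rewrite mulrA -mulrDl; rewrite -mulrDl mulrA -mulNr ler_pM2r//.
apply: (@le_trans _ _ (2^-1 * q ^+ 2 + 2^-1 * m ^+ 2)); last by rewrite lerD2l ler_pM2l.
rewrite -subr_ge0 (_ : _ - _ = (b + (q + m) / 2) ^+ 2 + ((q - m) / 2) ^+ 2).
  by rewrite addr_ge0// sqr_ge0.
by field.
Qed.

(* The repulsive drift makes the potential decrease: it grows only through the energy and the rotation. *)
Lemma potential_a_priori mu T M x : chamber_path x -> energy_le T (noise mu x) M ->
  forall t, 0 <= t <= T -> potential (fun i => x i t) <=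
    potential (fun i => x i 0) + M + n%:R * (2^-1 * (`|mu| + 1) ^+ 2) * T.
Proof.
move=> cx xM t /andP[t0 tT].
have M0 := energy_le_ge0 xM; have T0 := le_trans t0 tT.
have C0 : 0 <= n%:R * (2^-1 * (`|mu| + 1) ^+ 2) by rewrite mulr_ge0// mulr_ge0// sqr_ge0.
move: t0; rewrite le_eqVlt => /predU1P[<-|t0].
  by rewrite -addrA lerDl addr_ge0// mulr_ge0.
have cD j : continuous (drift_along mu x j) by exact: drift_along_continuous.
have [d d0 dH] : exists2 d : R, 0 < d & forall j s r, 0 <= s <= t -> `|s - r| < d ->
    `|drift_along mu x j s - drift_along mu x j r| <= 1.
  have H j : exists d : R, 0 < d /\ forall s r, 0 <= s <= t -> `|s - r| < d ->
      `|drift_along mu x j s - drift_along mu x j r| < 1.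
    by have [d d0 dH] := continuous_uniform_itv 0 t (cD j) ltr01; exists d.
  have [f fH] := choice H.
  exists (\big[Num.min/1]_(j < n) f j).
    by apply: lt_bigmin => // j _; have [] := fH j.
  move=> j s r st srd; apply/ltW; have [_] := fH j; apply => //.
  by apply: lt_le_trans srd _; exact: bigmin_le.
(* The mesh is below [d], so that the drift varies by at most 1 on a cell. *)
pose N := (Num.truncn (t / d)).+1; pose dt := t / N%:R; pose g (i : nat) := dt * i%:R.
have dt0 : 0 < dt by rewrite divr_gt0.
have dtd : dt < d.
  by rewrite ltr_pdivrMr// mulrC -ltr_pdivrMr//; have /andP[] := truncn_itv (divr_ge0 (ltW t0) (ltW d0)).
have gS i : g i.+1 - g i = dt by rewrite /g -mulrBr -natrB// subSnn mulr1.
have gN : g N = t by rewrite /g /dt divfK// pnatr_eq0.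
have g0 i : 0 <= g i by rewrite mulr_ge0// ltW.
have gle i : (i <= N)%N -> g i <= t by rewrite -gN => iN; rewrite ler_pM2l// ler_nat.
pose U s := potential (fun i => x i s).
pose h := noise mu x.
(* A discrete chain rule: convexity, with the tangent taken at the right end of the cell, gives the
   favourable sign without any differentiability of the path. *)
have step i : (i < N)%N -> U (g i.+1) - U (g i) <=
    \sum_(j < n) (2^-1 * ((h j (g i.+1) - h j (g i)) ^+ 2 / dt) + 2^-1 * (`|mu| + 1) ^+ 2 * dt).
  move=> iN; apply: le_trans (potential_tangent (cx.2 _) (cx.2 _)) _.
  rewrite -sumrN; apply: ler_sum => j _.
  pose E := \int[lam]_(s in `[g i, g i.+1]) drift_along mu x j s.
  have gi : g i <= g i.+1 by rewrite -subr_ge0 gS ltW.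
  have -> : x j (g i.+1) - x j (g i) = (h j (g i.+1) - h j (g i)) + E.
    by rewrite /E -integral_itvB// /h /noise; ring.
  apply: dissipation_le => //; rewrite -driftE -/(drift_along mu x j (g i.+1)).
  rewrite -{1}(gS i) -(integral_itv_cst _ gi) -RintegralB//; last 2 first.
  - exact: continuous_integrable_itv.
  - by apply: continuous_integrable_itv => s; exact: cvg_cst.
  rewrite -[leRHS]mul1r -[X in _ <= _ * X](gS i); apply: norm_integral_itv_le => //.
    by move=> s; apply: cvgB; [exact: cD|exact: cvg_cst].
  move=> r /andP[gr rg]; apply: dH.
    by rewrite (le_trans (g0 i) gr)/= (le_trans rg)// gle.
  by rewrite ler0_norm ?subr_le0// opprB; apply: le_lt_trans dtd; rewrite -(gS i) lerB.
have total : U t - U 0 <= 2^-1 * energy_on h [seq (g i, g i.+1) | i <- iota 0 N] +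
    n%:R * (2^-1 * (`|mu| + 1) ^+ 2) * t.
  have -> : U t - U 0 = \sum_(0 <= i < N) (U (g i.+1) - U (g i)).
    by rewrite telescope_sumr// gN /g mulr0.
  apply: (@le_trans _ _ (\sum_(0 <= i < N) \sum_(j < n)
     (2^-1 * ((h j (g i.+1) - h j (g i)) ^+ 2 / dt) + 2^-1 * (`|mu| + 1) ^+ 2 * dt))).
    by rewrite !big_nat; apply: ler_sum => i /andP[_ iN]; exact: step.
  rewrite /energy_on big_map mulr_sumr /index_iota subn0.
  under eq_bigr do rewrite big_split/=.
  rewrite big_split/= lerD//.
    apply: ler_sum => i _; rewrite mulr_sumr; apply: ler_sum => j _.
    by rewrite gS.
  rewrite -[_ :: _]/(iota 0 N) big_const_seq count_predT size_iota iter_addr addr0 sumr_const card_ord.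
  apply: eq_ler.
  by rewrite -[LHS]mulr_natr -[_ *+ n]mulr_natl -[X in _ = _ * X]gN /g; ring.
have := xM _ (itv_family_le tT (uniform_family N (ltW t0))); rewrite -/dt => E.
rewrite -/(U t) -/(U 0) -addrA addrC -lerBlDr; apply: le_trans total _; apply: lerD.
  by rewrite -(ler_pM2l (_ : 0 < 2))// mulrA divff// mul1r.
by rewrite ler_wpM2l.
Qed.

End noise.

(** * The space of paths *)

Section path_space_topology.
Context {R : realType} (T : R) (n : nat).
Implicit Types (f g : path_space T n) (x : 'I_n -> R -> R).

Lemma path_coordE f j (s : `[0, T]%classic) : path_coord f j (\val s) = \val (f s) ord0 j.
Proof.
have := valLK 0 (fun s : `[0, T]%classic => \val (f s) ord0 j).
by move/(congr1 (fun h => h s)).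
Qed.

Lemma rV_entourage (E : set ('rV[R]_n * 'rV[R]_n)) : entourage E ->
  exists2 e : R, 0 < e & forall u v : 'rV[R]_n, (forall j, `|u ord0 j - v ord0 j| < e) -> E (u, v).
Proof.
rewrite -entourage_ballE => -[e /= e0 eE]; exists e => // u v uv.
by apply: eE; split => //= i j; rewrite (ord1 i); exact: uv.
Qed.

Lemma rV_entourage_ball (e : R) : 0 < e ->
  entourage [set uv : 'rV[R]_n * 'rV[R]_n | forall j, `|uv.1 ord0 j - uv.2 ord0 j| < e].
Proof.
move=> e0; rewrite -entourage_ballE; exists e => // -[u v] [_ uv] j /=.
exact: (uv ord0 j).
Qed.

(** Coordinatewise uniform balls. They form a neighbourhood basis, and the topology is used only
    through them. *)
Definition path_ball f (e : R) : set (path_space T n) :=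
  [set g | forall t j, 0 <= t <= T -> `|path_coord f j t - path_coord g j t| < e].

Lemma nbhs_path_ball f e : 0 < e -> nbhs f (path_ball f e).
Proof.
move=> e0; apply/nbhsP.
have entE := rV_entourage_ball e0.
exists [set fg : path_space T n * path_space T n | forall s : `[0, T]%classic,
   forall j, `|\val (fg.1 s) ord0 j - \val (fg.2 s) ord0 j| < e].
  exists [set fg : (`[0, T]%classic -> chamber R n) * (`[0, T]%classic -> chamber R n) |
    forall s j, `|\val (fg.1 s) ord0 j - \val (fg.2 s) ord0 j| < e]; last by [].
  rewrite uniform_entourage; exists [set uv : chamber R n * chamber R n |
    forall j, `|\val uv.1 ord0 j - \val uv.2 ord0 j| < e].
    by exists [set uv : 'rV[R]_n * 'rV[R]_n | forall j, `|uv.1 ord0 j - uv.2 ord0 j| < e].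
  by move=> fg /= H s; exact: H.
move=> g /xsectionP /= fg t j tT.
have tT' : t \in `[0, T]%classic by rewrite inE/= in_itv.
by have := fg (SigSub tT') j; rewrite -!path_coordE.
Qed.

Lemma path_ball_nbhs f (A : set (path_space T n)) : nbhs f A ->
  exists2 e : R, 0 < e & path_ball f e `<=` A.
Proof.
move/nbhsP => [E [E1 + E1E] EA].
rewrite uniform_entourage => -[E2 [E3 /rV_entourage[e e0 eE3] E32] E21].
exists e => // g fg; apply: EA; apply/xsectionP; apply: E1E; apply: E21 => s _.
apply: E32; apply: eE3 => j /=; rewrite -!path_coordE; apply: fg.
by have /set_mem := valP s; rewrite /= in_itv.
Qed.

Lemma path_of x : chamber_path x ->
  exists f, forall t j, 0 <= t <= T -> path_coord f j t = x j t.
Proof.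
move=> [cx ox].
have xc t : chamber R n (\row_j x j t).
  by apply/chamberP => i j ij; rewrite !mxE; exact: ox.
pose F (s : `[0, T]%classic) : chamber R n := SigSub (mem_set (xc (\val s))).
have cF : continuous F.
  apply: continuous_comp_initial => s.
  have : (fun t => \row_j x j t) (t) @[t --> \val s] --> (\row_j x j (\val s) : 'rV[R]_n).
    move=> A [P /= HP PA].
    have : \forall t \near \val s, forall j, P ord0 j (x j t).
      apply: (@filter_forall R 'I_n (fun j t => P ord0 j (x j t)) (nbhs (\val s))) => j.
      by have := HP ord0 j; rewrite mxE => /cx.
    by apply: filterS => t H; apply: PA => i j; rewrite mxE (ord1 i).
  by move=> H; apply: (cvg_comp _ _ _ H); exact: initial_continuous.
exists (mkcts cF) => t j tT.
have tT' : t \in `[0, T]%classic by rewrite inE/= in_itv.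
by have := path_coordE (mkcts cF) j (SigSub tT'); rewrite /= mxE.
Qed.

Lemma absolutely_continuous_on_eq (h k : R -> R) :
  (forall t, 0 <= t <= T -> h t = k t) ->
  absolutely_continuous_on 0 T h -> absolutely_continuous_on 0 T k.
Proof.
move=> hk /absolutely_continuous_onP hac; apply/absolutely_continuous_onP => e e0.
have [d d0 dH] := hac e e0; exists d => // l abl ld.
rewrite (_ : variation_on k l = variation_on h l) ?dH//.
have /andP[/allP al _] := abl.
rewrite /variation_on !big_seq; apply: eq_bigr => p pl.
have /and3P[p0 pp pT] := al p pl.
by rewrite !hk// ?p0 ?pT ?(le_trans pp) ?(le_trans p0).
Qed.

Hypothesis T0 : 0 <= T.

(* Extended by constants outside [0, T], a path is continuous on the line, unlike [path_coord]. *)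
Definition path_ext f (j : 'I_n) (t : R) : R := path_coord f j (clip 0 T t).

Lemma path_ext_id f j t : 0 <= t <= T -> path_ext f j t = path_coord f j t.
Proof. by move=> /andP[t0 tT]; rewrite /path_ext clip_id. Qed.

Lemma path_ext_chamber f : chamber_path (path_ext f).
Proof.
have cT t : clip 0 T t \in `[0, T]%classic by rewrite inE/= in_itv/= clip_bnd.
have E j t : path_ext f j t = \val (f (SigSub (cT t))) ord0 j.
  by rewrite -path_coordE.
split=> [j t|t]; last first.
  have /set_mem/chamberP := valP (f (SigSub (cT t))).
  by move=> H i j ij; rewrite !E; exact: H.
have cfT : continuous (fun t => SigSub (cT t) : `[0, T]%classic).
  by apply: continuous_comp_initial => s; exact: clip_continuous.
rewrite [path_ext f j](_ : _ = (fun u : 'rV[R]_n => u ord0 j) \o (fun v : chamber R n => \val v) \o f \o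
   (fun t => SigSub (cT t) : `[0, T]%classic)); last first.
  by apply/funext => s; rewrite /= E.
apply: continuous_comp; first exact: cfT.
apply: continuous_comp; first exact: cts_fun.
apply: continuous_comp; first exact: initial_continuous.
exact: coord_continuous.
Qed.

End path_space_topology.

Section rate.
Context {R : realType} (mu T : R) (n : nat) (theta : 'rV[R]_n).
Hypothesis T0 : 0 < T.
Implicit Types (f : path_space T n) (M : R).
Local Notation lam := (@lebesgue_measure R).

Lemma noiseB (x : 'I_n -> R -> R) j : chamber_path x ->
  forall s t : R, 0 <= s -> s <= t -> noise mu x j t - noise mu x j s =
    (x j t - x j s) - \int[lam]_(r in `[s, t]) drift_along mu x j r.
Proof.
move=> cx s t s0 st; have cD : continuous (drift_along mu x j) by exact: drift_along_continuous.
by rewrite /noise -(integral_itvB cD s0 st); ring.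
Qed.

Lemma derive1_integral (q : R -> R) (t : R) : continuous q -> 0 < t ->
  derivable (fun r : R => \int[lam]_(s in `[0, r]) q s) t 1 /\
  derive1 (fun r : R => \int[lam]_(s in `[0, r]) q s) t = q t.
Proof.
move=> cq t0; apply: (@continuous_FTC1_closed _ q 0 t (t + 1)) => //.
- by rewrite ltrDl.
- exact: continuous_integrable_itv.
- exact: cq.
Qed.

Lemma derivable_derive1B (u v : R -> R) (t : R) : derivable u t 1 -> derivable v t 1 ->
  derivable (fun r => u r - v r) t 1 /\
  derive1 (fun r => u r - v r) t = derive1 u t - derive1 v t.
Proof. by move=> du dv; split; [exact: derivableB|rewrite !derive1E deriveB]. Qed.

Lemma absolutely_continuous_lipschitz (h : R -> R) (c : R) : 0 <= c ->
  (forall s t : R, 0 <= s -> s <= t -> t <= T -> `|h t - h s| <= c * (t - s)) ->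
  absolutely_continuous_on 0 T h.
Proof.
move=> c0 hc; apply/absolutely_continuous_onP => e e0.
have c1 : 0 < c + 1 by rewrite ltr_wpDl.
exists (e / (c + 1)); first exact: divr_gt0.
move=> l /andP[/allP al _]; rewrite ltr_pdivlMr// => le.
apply: le_lt_trans le; rewrite mulrC /variation_on /total_length mulr_sumr.
rewrite big_seq [leRHS]big_seq; apply: ler_sum => p pl.
have /and3P[p0 pp pT] := al p pl; apply: le_trans (hc _ _ p0 pp pT) _.
by rewrite ler_wpM2r ?subr_ge0// lerDl.
Qed.

Lemma absolutely_continuous_integral (q : R -> R) : continuous q ->
  absolutely_continuous_on 0 T (fun t : R => \int[lam]_(s in `[0, t]) q s).
Proof.
move=> cq; have cq' : {within `[0, T], continuous (fun t => `|q t|)}.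
  by apply: continuous_subspaceT => t; apply: cvg_norm; exact: cq.
have [c _ cH] := EVT_max (ltW T0) cq'.
apply: (@absolutely_continuous_lipschitz _ `|q c|) => // s t s0 st tT.
rewrite integral_itvB//; apply: norm_integral_itv_le => // r /andP[sr rt].
by apply: cH; rewrite in_itv/= (le_trans s0 sr) (le_trans rt tT).
Qed.

Lemma derive1_path_coord f j t : 0 < t < T ->
  (derivable (path_coord f j) t 1 <-> derivable (path_ext f j) t 1) /\
  derive1 (path_coord f j) t = derive1 (path_ext f j) t.
Proof.
move=> tT.
have E : \forall s \near t, path_coord f j s = path_ext f j s.
  have : t \in `]0, T[ by rewrite in_itv.
  move/near_in_itvoo; apply: filterS => s; rewrite in_itv/= => /andP[s0 sT].
  by rewrite path_ext_id// (ltW s0) ltW.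
have E' : \forall s \near t, path_ext f j s = path_coord f j s by apply: filterS E => s ->.
split; first by split; exact: near_eq_derivable.
by rewrite !derive1E; exact: near_eq_derive.
Qed.

(** A finite rate gives an integrable density of the path, hence one of the noise, and
    Cauchy-Schwarz bounds the energy. Conversely, finite energy makes the path absolutely
    continuous, which selects the integral branch of the rate, and Fatou's lemma bounds that
    integral. *)
Lemma dyson_rate_leP f M : (dyson_rate mu theta f <= M%:E)%E <->
  (forall j, path_coord f j 0 = theta ord0 j) /\ energy_le T (noise mu (path_ext f)) M.
Proof.
have T0' := ltW T0.
have cf := path_ext_chamber T0' f.
set x := path_ext f in cf *.
have cD j : continuous (drift_along mu x j) by exact: drift_along_continuous.
have Di j : lam.-integrable `[0, T] (EFin \o drift_along mu x j) by exact: continuous_integrable_itv.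
have xE j t : 0 <= t <= T -> path_coord f j t = x j t by move=> tT; rewrite -path_ext_id.
have driftE t j : 0 <= t <= T ->
    drift mu (fun i => path_coord f i t) j = drift_along mu x j t.
  by move=> tT; rewrite /drift_along; congr drift; apply/funext => i; exact: xE.
have halfE (I : \bar R) : ((2^-1)%:E * I <= M%:E)%E = (I <= (2 * M)%:E)%E.
  by rewrite lee_pdivrMl// EFinM.
rewrite /dyson_rate; case: asboolP => [[fac f0]|nac]; last first.
  split=> [|[f0 fM]]; first by rewrite leye_eq.
  exfalso; apply: nac; split=> // j.
  have nac := energy_le_ac j fM.
  (* The sum of noise and integral of the drift, written with differences only: u - ((u - u) - v) =
     u + v. *)
  have hac := absolutely_continuous_onB nac (absolutely_continuous_onB
    (absolutely_continuous_onB nac nac) (absolutely_continuous_integral (cD j))).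
  apply: absolutely_continuous_on_eq hac => t tT.
  by rewrite xE// /noise/=; ring.
have acf j := absolutely_continuous_FTC T0' (fac j).
have [p pH] := choice acf.
have pae : {ae lam, forall t, 0 < t < T -> forall j, derivable (path_coord f j) t 1 /\
    derive1 (path_coord f j) t = p j t}.
  have : {ae lam, forall t, forall j, 0 < t < T -> derivable (path_coord f j) t 1 /\
      derive1 (path_coord f j) t = p j t}.
    apply: (@filter_forall R 'I_n (fun j t => 0 < t < T -> derivable (path_coord f j) t 1 /\
      derive1 (path_coord f j) t = p j t) (almost_everywhere lam)).
      exact: (ae_filter_ringOfSetsType lam).
    by move=> j; have [] := pH j.
  apply: filterS; first exact: (ae_filter_ringOfSetsType lam).
  by move=> t H tT j; exact: H.
rewrite halfE; split=> [gM|[_ fM]].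
  split => //.
  have pi j : lam.-integrable `[0, T] (EFin \o p j) by have [+ _ _] := pH j; exact: integrableS.
  apply: (@integral_energy_le _ _ _ _ _ (fun j => p j \- drift_along mu x j)).
  - by move=> j; exact: (integrableB _ (pi j) (Di j)).
  - move=> j s t s0 st tT; rewrite noiseB// RintegralB//; last 2 first.
    + by apply: integrableS (pi j) => //; apply: subset_itv; rewrite bnd_simp.
    + exact: continuous_integrable_itv.
    have [_ pE _] := pH j; rewrite -pE// !xE// ?s0 ?tT ?(le_trans s0)//=.
    exact: le_trans st tT.
  (* The side with the density is measurable; the integrand of the rate, written with [derive1],
     agrees with it almost everywhere. *)
  apply: le_trans gM; apply: ae_ge0_le_integral_lower => //.
  - by move=> t _; rewrite lee_fin sumr_ge0// => j _; exact: sqr_ge0.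
  - by move=> t _; rewrite lee_fin sumr_ge0// => j _; exact: sqr_ge0.
  - apply/measurable_EFinP; apply: measurable_sum => j; apply: measurable_funX.
    apply: measurable_funB.
      by apply/measurable_EFinP; case/integrableP: (pi j).
    by apply/measurable_EFinP; case/integrableP: (Di j).
  apply: filterS (ae_interior_itv pae); first exact: (ae_filter_ringOfSetsType lam).
  move=> t H tT; have [_ {}H] := H tT; rewrite lee_fin; apply: eq_ler.
  apply: eq_bigr => j _ /=; have [_ ->] := H j.
  by rewrite driftE//; move: tT; rewrite /= in_itv.
apply: energy_le_integral fM _ => //.
apply: filterS pae; first exact: (ae_filter_ringOfSetsType lam).
move=> t H /[dup] tT /[dup] /H {}H /andP[t0 t1] j; have [dj _] := H j.
have [dxE dE] := derive1_path_coord f j tT.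
have [dI IE] := derive1_integral (cD j) t0.
have [dN NE] := derivable_derive1B (dxE.1 dj) dI.
split; first exact: dN.
rewrite [LHS]NE IE dE driftE//; last by rewrite !ltW.
Qed.

End rate.

(** * Level sets of the rate function *)

Lemma grid_cell {R : realType} (T : R) (N : nat) (t : R) : 0 < T -> (0 < N)%N -> 0 <= t <= T ->
  exists2 i : 'I_N, T / N%:R * i%:R <= t & t <= T / N%:R * i.+1%:R.
Proof.
move=> T0 N0 /andP[t0 tT]; set dt := T / N%:R.
have dt_gt0 : 0 < dt by rewrite divr_gt0// ltr0n.
have dtN : dt * N%:R = T by rewrite /dt divfK// gt_eqF// ltr0n.
have [->|ne] := eqVneq t T.
  have h : (N.-1 < N)%N by rewrite prednK.
  by exists (Ordinal h); rewrite /= ?prednK// -?dtN// ler_pM2l// ler_nat leq_pred.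
have /andP[it ti] := truncn_itv (divr_ge0 t0 (ltW dt_gt0)).
move: it ti; rewrite ler_pdivlMr// ltr_pdivrMr// mulrC [_.+1%:R * _]mulrC => it ti.
have iN : (Num.truncn (t / dt) < N)%N.
  have : dt * (Num.truncn (t / dt))%:R < dt * N%:R.
    by apply: le_lt_trans it _; rewrite dtN lt_neqAle ne.
  by rewrite ltr_pM2l// ltr_nat.
by exists (Ordinal iN); rewrite //= ltW.
Qed.

Section level_sets.
Context {R : realType} (mu T : R) (n : nat) (theta : 'rV[R]_n).
Hypothesis T0 : 0 < T.
Implicit Types (f g : path_space T n) (M : R).
Local Notation lam := (@lebesgue_measure R).
Local Notation level M := [set f : path_space T n | (dyson_rate mu theta f <= M%:E)%E].
Let T0' := ltW T0.

(** The a priori bound on the potential involves only [theta], [mu], [n], [T] and [M], whence one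
    [s] for the whole level set. *)
Lemma level_separated M : exists2 s : R, 0 < s &
  forall f, level M f -> forall t, separated s (fun j => path_ext f j t).
Proof.
pose c := potential (fun j => theta ord0 j) + M + n%:R * (2^-1 * (`|mu| + 1) ^+ 2) * T.
exists (expR (- (c / 2))); first exact: expR_gt0.
move=> f /(dyson_rate_leP mu theta T0)[f0 fM] t.
have cf := path_ext_chamber T0' f.
apply: potential_separated; first exact: cf.2.
have -> : (fun j => path_ext f j t) = (fun j => path_ext f j (clip 0 T t)).
  apply/funext => j; rewrite /path_ext [clip 0 T (clip 0 T t)]clip_id//.
    by have /andP[] := clip_bnd t T0'.
  by have /andP[] := clip_bnd t T0'.
apply: le_trans (potential_a_priori cf fM (clip_bnd t T0')) _.
rewrite /c; congr (potential _ + _ + _ <= _): (lexx c).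
by apply/funext => j; rewrite path_ext_id ?lexx// f0.
Qed.

Lemma energy_le_increment (h : 'I_n -> R -> R) M j (s t : R) : energy_le T h M ->
  0 <= s -> s <= t -> t <= T -> (h j t - h j s) ^+ 2 <= 2 * M * (t - s).
Proof.
move=> hM s0 st tT; have [->|ne] := eqVneq s t; first by rewrite !subrr expr0n/= mulr0.
have st0 : 0 < t - s by rewrite subr_gt0 lt_neqAle ne.
have E : energy_on h [:: (s, t)] <= 2 * M by apply: hM; rewrite /itv_family/= s0 st tT.
rewrite -ler_pdivrMr//; apply: le_trans E; rewrite /energy_on big_seq1/=.
rewrite [leRHS](bigD1 j)//= lerDl sumr_ge0// => k _.
by rewrite divr_ge0 ?sqr_ge0// ltW.
Qed.

(** The witness [a] is the increment of the noise, of order the square root of t - s; stating its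
    square avoids the root. The drift adds a Lipschitz term by separation. *)
Lemma level_increment M : exists2 L : R, 0 < L &
  forall f, level M f -> forall j (s t : R), 0 <= s -> s <= t -> t <= T -> exists a : R,
    a ^+ 2 <= L * (t - s) /\ `|path_coord f j t - path_coord f j s| <= `|a| + L * (t - s).
Proof.
have [s s0 sH] := level_separated M; have [L L0 [LH _]] := @drift_lipschitz R n s mu s0.
exists (L + 2 * `|M|); first by rewrite ltr_pwDl// mulr_ge0.
move=> f fM j u v u0 uv vT; have cf := path_ext_chamber T0' f.
have [f0 fe] := (dyson_rate_leP mu theta T0 f M).1 fM.
exists (noise mu (path_ext f) j v - noise mu (path_ext f) j u).
have uv0 : 0 <= v - u by rewrite subr_ge0.
split.
  apply: le_trans (energy_le_increment j fe u0 uv vT) _; rewrite ler_wpM2r//.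
  by rewrite ler_wpDl ?(ltW L0)// ler_pM2l// ler_norm.
rewrite -!path_ext_id ?u0 ?vT ?(le_trans u0 uv) ?(le_trans uv vT)//.
have cD : continuous (drift_along mu (path_ext f) j) by exact: drift_along_continuous.
pose I := \int[lam]_(r in `[u, v]) drift_along mu (path_ext f) j r.
rewrite [X in `|X|](_ : _ = (noise mu (path_ext f) j v - noise mu (path_ext f) j u) + I); last first.
  by rewrite noiseB// /I; ring.
apply: le_trans (ler_normD _ _) _; rewrite lerD2l; apply: (@le_trans _ _ (L * (v - u))).
  by apply: norm_integral_itv_le => // r _; apply: LH; exact: sH.
by rewrite ler_wpM2r// ler_wpDr// mulr_ge0.
Qed.

Lemma level_modulus M (e : R) : 0 < e -> exists2 d : R, 0 < d &
  forall f, level M f -> forall j (s t : R), 0 <= s <= T -> 0 <= t <= T -> `|s - t| < d ->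
    `|path_coord f j s - path_coord f j t| < e.
Proof.
move=> e0; have [L L0 LH] := level_increment M.
pose d := Num.min ((e / 2) / L) ((e / 2) ^+ 2 / L).
have d0 : 0 < d by rewrite lt_min !divr_gt0// ?exprn_gt0 ?divr_gt0.
exists d => // f fM j s t.
wlog st : s t / s <= t => [H s1 t1 st|].
  by have [le|/ltW le] := leP s t; [exact: H|rewrite distrC; apply: H; rewrite 1?distrC].
move=> /andP[s0 sT] /andP[t0 tT]; rewrite distrC ger0_norm ?subr_ge0// lt_min.
rewrite !ltr_pdivlMr// ![_ * L]mulrC => /andP[h1 h2].
have [a [a1 a2]] := LH f fM j s t s0 st tT.
rewrite distrC; apply: le_lt_trans a2 _.
have : `|a| < e / 2.
  rewrite -(@ltr_pXn2r _ 2)// ?nnegrE ?divr_ge0 ?(ltW e0)//.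
  by rewrite real_normK ?num_real//; exact: le_lt_trans a1 h2.
lra.
Qed.

Lemma level_bounded M : exists B : R, forall f, level M f -> forall j (t : R), 0 <= t <= T ->
  theta ord0 j - B <= path_coord f j t <= theta ord0 j + B.
Proof.
have [L L0 LH] := level_increment M.
(* L T + 1 dominates the square root of L T, hence |a|; the last term is the drift. *)
exists (L * T + 1 + L * T) => f fM j t /andP[t0 tT].
have [f0 _] := (dyson_rate_leP mu theta T0 f M).1 fM.
have [a [a1 a2]] := LH f fM j 0 t (lexx 0) t0 tT.
rewrite subr0 f0 in a1 a2; rewrite -ler_distl; apply: le_trans a2 _.
have LT : L * t <= L * T by rewrite ler_pM2l.
apply: lerD => //; rewrite -(@ler_pXn2r _ 2)// ?nnegrE//; last first.
  by rewrite addr_ge0// mulr_ge0// ltW.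
rewrite real_normK ?num_real//; apply: le_trans a1 _; apply: le_trans LT _.
have : 0 <= L * T by rewrite mulr_ge0// ltW.
by move: (L * T) => u u0; nra.
Qed.

(** For a fixed family the energy is a continuous function of finitely many values of the path. *)
Lemma energy_le_lim (h : nat -> 'I_n -> R -> R) (k : 'I_n -> R -> R) M :
  (forall m, energy_le T (h m) M) ->
  (forall j (t : R), 0 <= t <= T -> h m j t @[m --> \oo] --> k j t) -> energy_le T k M.
Proof.
move=> hM hk l abl.
have H : energy_on (h m) l @[m --> \oo] --> energy_on k l.
  rewrite /energy_on big_seq; under eq_fun do rewrite big_seq.
  apply: cvg_sumr => p pl; apply: cvg_sumr => j _.
  have /andP[/allP/(_ _ pl) /and3P[p0 pp pT] _] := abl.
  apply: cvgMl; rewrite expr2; under eq_fun do rewrite expr2.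
  by apply: cvgM; apply: cvgB; apply: hk; rewrite ?p0 ?pT ?(le_trans p0 pp) ?(le_trans pp pT).
by apply: (cvgr_to_le H); apply: nearW => m; exact: hM.
Qed.

(** The uniform separation passes to the limit path, so the drifts converge uniformly and the noises
    pointwise. *)
Lemma level_closed M g : (forall e : R, 0 < e -> exists2 f, level M f & path_ball g e f) ->
  level M g.
Proof.
move=> gf; have [s s0 sH] := level_separated M.
have [L L0 [_ LH]] := @drift_lipschitz R n s mu s0.
pose e (m : nat) : R := m.+1%:R^-1.
have e0 m : 0 < e m by rewrite invr_gt0.
have gf' m : exists f, level M f /\ path_ball g (e m) f.
  by have [f fM gf'] := gf (e m) (e0 m); exists f.
have [f fH] := choice gf'.
have close m j (t : R) : `|path_ext g j t - path_ext (f m) j t| < e m.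
  by apply: (fH m).2; exact: clip_bnd.
have e_cvg : e m @[m --> \oo] --> 0 by exact: cvg_harmonic.
have coord_cvg j (t : R) : path_ext (f m) j t @[m --> \oo] --> path_ext g j t.
  apply/cvgrPdist_le => r r0; near=> m; apply: ltW; apply: lt_trans (close m j t) _.
  by near: m; exact: (cvgr_lt _ e_cvg).
have cg := path_ext_chamber T0' g.
have gs t : separated s (fun j => path_ext g j t).
  move=> i j ij.
  have dif : path_ext (f m) j t - path_ext (f m) i t @[m --> \oo] --> path_ext g j t - path_ext g i t.
    exact: cvgB.
  apply/andP; split.
    by apply: (cvgr_to_ge dif); apply: nearW => m; have /andP[] := sH _ (fH m).1 t i j ij.
  by apply: (cvgr_to_le dif); apply: nearW => m; have /andP[] := sH _ (fH m).1 t i j ij.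
apply/(dyson_rate_leP mu theta T0); split.
  move=> j; rewrite -path_ext_id ?lexx//.
  have := coord_cvg j 0; rewrite (_ : (fun m => path_ext (f m) j 0) = cst (theta ord0 j)); last first.
    apply/funext => m; rewrite path_ext_id ?lexx//.
    by have [-> _] := (dyson_rate_leP mu theta T0 (f m) M).1 (fH m).1.
  move/cvg_lim => <-; last exact: Rhausdorff.
  by rewrite lim_cst.
apply: (@energy_le_lim (fun m => noise mu (path_ext (f m)))).
  by move=> m; have [] := (dyson_rate_leP mu theta T0 (f m) M).1 (fH m).1.
move=> j t /andP[t0 tT]; apply: cvgB; first exact: coord_cvg.
have cD (h : path_space T n) : continuous (drift_along mu (path_ext h) j).
  by apply: drift_along_continuous; exact: path_ext_chamber.
have LT : 0 < L * T + 1 by rewrite ltr_wpDl// mulr_ge0// ltW.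
apply/cvgrPdist_le => r r0; have rL : 0 < r / (L * T + 1) by exact: divr_gt0.
near=> m; rewrite -RintegralB//; [|exact: continuous_integrable_itv|exact: continuous_integrable_itv].
apply: (@le_trans _ _ (L * e m * (t - 0))).
  apply: norm_integral_itv_le => // [v|v _].
    by apply: cvgB; exact: cD.
  by apply: LH => [||i]; [exact: gs|exact: sH (fH m).1 v|exact/ltW/close].
have er : e m < r / (L * T + 1) by near: m; exact: (cvgr_lt _ e_cvg).
move: er; rewrite ltr_pdivlMr// => /ltW; apply: le_trans.
rewrite subr0 mulrAC mulrC ler_pM2l// ler_wpDr// ler_pM2l//.
Unshelve. all: by end_near. Qed.

Lemma ultra_fmap (X Y : Type) (phi : X -> Y) (F : set_system X) :
  UltraFilter F -> UltraFilter (phi @ F).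
Proof.
move=> FU; have FF : ProperFilter F by exact: ultra_proper.
split; first exact: fmap_proper_filter.
move=> G GG FG; apply/seteqP; split => // A GA.
have [//|FA] := in_ultra_setVsetC (phi @^-1` A) FU.
have GA' : G (~` A) by exact: FG.
by have [y []] := filter_ex (filterI GA GA').
Qed.

(** Arzela-Ascoli with ultrafilters: boundedness gives pointwise limits, the common modulus makes
    the limit continuous, and the common separation keeps it in the open chamber. *)
Lemma level_compact M : compact (level M).
Proof.
rewrite compact_ultra => F FU FM.
have FF : ProperFilter F by exact: ultra_proper.
have [B BH] := level_bounded M.
have lim_ex (tj : R * 'I_n) : exists r : R, path_coord f tj.2 (clip 0 T tj.1) @[f --> F] --> r.
  have := @segment_compact R (theta ord0 tj.2 - B) (theta ord0 tj.2 + B).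
  rewrite compact_ultra => /(_ (path_coord f tj.2 (clip 0 T tj.1) @[f --> F]) _)[].
  - exact: ultra_fmap.
  - have H : F [set f | `[theta ord0 tj.2 - B, theta ord0 tj.2 + B]%classic (path_coord f tj.2 (clip 0 T tj.1))].
      by apply: filterS FM => f fM; have := BH f fM tj.2 _ (clip_bnd tj.1 T0'); rewrite /= in_itv.
    exact: H.
  - by move=> r [_ Fr]; exists r.
have [G0 G0lim] := choice lim_ex.
pose x j (t : R) := G0 (clip 0 T t, j).
have xlim j (t : R) : path_ext f j t @[f --> F] --> x j t.
  have := G0lim (clip 0 T t, j); rewrite /= [clip 0 T (clip 0 T t)]clip_id//.
    by have /andP[] := clip_bnd t T0'.
  by have /andP[] := clip_bnd t T0'.
have xmod (e : R) : 0 < e -> exists2 d : R, 0 < d & forall j (s t : R), `|s - t| < d ->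
    `|x j s - x j t| <= e.
  move=> e0; have [d d0 dH] := level_modulus M e0; exists d => // j s t st.
  have H : `|path_ext f j s - path_ext f j t| @[f --> F] --> `|x j s - x j t|.
    by apply: cvg_norm; apply: cvgB; exact: xlim.
  apply: (cvgr_to_le H); apply: filterS FM => f fM; apply: ltW; apply: dH => //.
  - exact: clip_bnd.
  - exact: clip_bnd.
  - exact: le_lt_trans (clip_lip _ _ _ _) st.
have cx : chamber_path x.
  split=> [j t|t].
    apply/cvgrPdist_le => e e0; have [d d0 dH] := xmod e e0; near=> s.
    by apply: dH; near: s; exact: cvgr_dist_lt.
  have [s s0 sH] := level_separated M; apply: (separated_ordered s0) => i j ij.
  have dif : path_ext f j t - path_ext f i t @[f --> F] --> x j t - x i t.
    by apply: cvgB; exact: xlim.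
  apply/andP; split.
    by apply: (cvgr_to_ge dif); apply: filterS FM => f fM; have /andP[] := sH f fM t i j ij.
  by apply: (cvgr_to_le dif); apply: filterS FM => f fM; have /andP[] := sH f fM t i j ij.
have [g gx] := path_of T cx.
have ball_F (e : R) : 0 < e -> F (path_ball g e).
  move=> e0; have e4 : 0 < e / 4 by rewrite divr_gt0.
  have [d d0 dH] := xmod _ e4; have [d' d'0 dH'] := level_modulus M e4.
  (* Pointwise convergence at finitely many grid points becomes uniform, the mesh being below the
     moduli of the limit and of the level set; three errors of at most e / 4 remain below [e]. *)
  pose N := (Num.truncn (T / Num.min d d')).+1.
  have dd0 : 0 < Num.min d d' by rewrite lt_min d0.
  pose dt := T / N%:R.
  have dt0 : 0 < dt by rewrite divr_gt0.
  have dtd : dt < Num.min d d'.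
    by rewrite ltr_pdivrMr// mulrC -ltr_pdivrMr//; have /andP[] := truncn_itv (divr_ge0 T0' (ltW dd0)).
  have grid : F [set f | forall ij : 'I_N * 'I_n,
      `|x ij.2 (dt * ij.1%:R) - path_ext f ij.2 (dt * ij.1%:R)| < e / 4].
    apply: filter_forall => -[i j] /=.
    by have /cvgrPdist_lt/(_ _ e4) := xlim j (dt * i%:R).
  apply: filterS2 grid FM => f fgrid fM t j tT.
  have /andP[t0 t1] := tT; have [i it ti] := grid_cell T0 (isT : (0 < N)%N) tT.
  have i0 : 0 <= dt * i%:R by rewrite mulr_ge0// ltW.
  have iT : 0 <= dt * i%:R <= T by rewrite i0 (le_trans it).
  have td : `|t - dt * i%:R| < Num.min d d'.
    rewrite ger0_norm ?subr_ge0//; apply: le_lt_trans dtd.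
    by move: ti; rewrite -natr1 mulrDr mulr1 lerBlDl.
  have := fgrid (i, j); rewrite /= path_ext_id// => h2.
  move: td; rewrite lt_min => /andP[/(dH j) h1 /(dH' f fM j _ _ tT iT) h3].
  rewrite gx// (_ : _ - _ = (x j t - x j (dt * i%:R)) +
    (x j (dt * i%:R) - path_coord f j (dt * i%:R)) - (path_coord f j t - path_coord f j (dt * i%:R))); last by ring.
  apply: le_lt_trans (ler_normB _ _) _.
  by apply: le_lt_trans (lerD (ler_normD _ _) (lexx _)) _; lra.
exists g; split.
  apply: level_closed => e /ball_F Fe.
  by have [f [fM fe]] := filter_ex (filterI FM Fe); exists f.
by move=> A /path_ball_nbhs[e e0 eA]; apply: filterS eA _; exact: ball_F.
Unshelve. all: by end_near. Qed.

Lemma dyson_rate_ge0 f : (0 <= dyson_rate mu theta f)%E.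
Proof.
rewrite /dyson_rate; case: asboolP => // _; apply: mule_ge0; first by rewrite lee_fin invr_ge0.
by apply: integral_ge0 => t _; rewrite lee_fin sumr_ge0// => j _; exact: sqr_ge0.
Qed.

Lemma dyson_rate_good : good_rate_function (@dyson_rate R mu T n theta).
Proof.
split; [exact: dyson_rate_ge0|move=> f a af|exact: level_compact].
have ngf : ~ level a f by rewrite /= leNgt af.
have [e [e0 eH]] : exists e : R, 0 < e /\ forall g, path_ball f e g -> ~ level a g.
  apply: contrapT => /forallNP H; apply: ngf; apply: level_closed => e e0.
  apply: contrapT => He; apply: (H e); split => // g gf ga.
  by apply: He; exists g.
exists (path_ball f e); first exact: nbhs_path_ball.
by move=> g /eH/negP; rewrite -ltNge.
Qed.

(** A closed set has positive distance to a compact set disjoint from it. *)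
Lemma level_closed_gap M (F : set (path_space T n)) : closed F ->
  (forall f, F f -> ~ level M f) ->
  exists2 e : R, 0 < e & forall f g, F f -> level M g -> ~ path_ball g e f.
Proof.
move=> cF FM; have /compact_near_coveringP H := level_compact (M := M).
have [g gM|d /= d0 dH] := H R 0^'+ (fun e g => forall f, F f -> ~ path_ball g e f) _.
  have : nbhs g (~` F).
    by apply: open_nbhs_nbhs; split; [exact: closed_openC|move=> /FM].
  move/path_ball_nbhs => [e e0 eF].
  exists (path_ball g (e / 2), [set r | r < e / 2]).
    split => /=; first by apply: nbhs_path_ball; rewrite divr_gt0.
    by apply: nbhs_right_lt; rewrite divr_gt0.
  move=> [h r] /= [gh re] f Ff hf; apply: (eF f) => // t j tT.
  rewrite -(subrKA (path_coord h j t)); apply: le_lt_trans (ler_normD _ _) _.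
  by have := gh t j tT; have := hf t j tT; lra.
exists (d / 2); first by rewrite divr_gt0.
move=> f g Ff gM; apply: (dH (d / 2)) => //.
  by rewrite /= sub0r normrN gtr0_norm ?divr_gt0//; lra.
by rewrite divr_gt0.
Qed.

End level_sets.

(** * Stability under perturbations of the driver *)

Section continuous_induction.
Context {R : realType}.
Implicit Types (phi : R -> R) (t : R).

(** The set of times up to which phi <= 0 is closed, by continuity, and the strict inequality
    regained by [step] pushes its supremum to the right. *)
Lemma continuous_induction phi T : continuous phi -> phi 0 < 0 ->
  (forall t, 0 <= t <= T -> (forall r, 0 <= r <= t -> phi r <= 0) -> phi t < 0) ->
  forall t, 0 <= t <= T -> phi t < 0.
Proof.
move=> cphi phi0 step t /andP[t0 tT].
pose A := [set s : R | 0 <= s <= t /\ forall r, 0 <= r <= s -> phi r <= 0].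
have A0 : A 0.
  by split=> [|r]; rewrite ?lexx ?t0//; move=> r0; rewrite (_ : r = 0) ?(ltW phi0)//; apply/eqP; rewrite eq_le andbC.
have hA : has_sup A by split; [exists 0|exists t => s [/andP[]]].
have s0 : 0 <= sup A by exact: (sup_upper_bound hA).
have st : sup A <= t by apply: ge_sup => [|s [/andP[]]//]; exists 0.
have le_s r : 0 <= r <= sup A -> phi r <= 0.
  move=> /andP[r0]; rewrite le_eqVlt => /orP[/eqP ->|rs]; last first.
    have [u [_ Au] ru] := sup_gt (ex_intro _ 0 A0) rs.
    by apply: Au; rewrite r0 ltW.
  rewrite leNgt; apply/negP => ps.
  have sup0 : 0 < sup A.
    by rewrite lt_neqAle s0 andbT; apply/eqP => E; move: ps; rewrite -E ltNge (ltW phi0).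
  have /= := cvgr_gt _ (cphi (sup A)) _ ps.
  case=> e /= e0 He.
  have h : Num.max (sup A - e) 0 < sup A by rewrite gt_max sup0 andbT; lra.
  have [u [/andP[u0 ut] Au] ru] := sup_gt (ex_intro _ 0 A0) h.
  have us : u <= sup A by apply: (sup_upper_bound hA); split; [rewrite u0|].
  have : 0 < phi u.
    apply: He; rewrite /= ger0_norm ?subr_ge0//.
    by move: ru; rewrite gt_max => /andP[? _]; lra.
  by rewrite ltNge Au// u0 lexx.
have ps : phi (sup A) < 0 by apply: step => //; rewrite s0 (le_trans st).
move: st; rewrite le_eqVlt => /orP[/eqP <-//|st].
have /= := cvgr_lt _ (cphi (sup A)) _ ps.
case=> e /= e0 He.
pose u := Num.min (sup A + e / 2) t.
have su : sup A < u by rewrite lt_min st andbT; lra.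
suff : A u by move/(sup_upper_bound hA); rewrite leNgt su.
split; first by rewrite (le_trans s0 (ltW su)) ge_min lexx orbT.
move=> r /andP[r0 ru]; have [rs|rs] := leP r (sup A); first by apply: le_s; rewrite r0.
apply/ltW/He => /=; rewrite ltr0_norm ?subr_lt0// opprB.
by move: ru; rewrite le_min => /andP[? _]; lra.
Qed.

End continuous_induction.

Section perturbation.
Context {R : realType} {n : nat}.
Implicit Types (h k x y : 'I_n -> R -> R) (T a c eta mu : R).
Local Notation lam := (@lebesgue_measure R).

Lemma total_length_le T l : 0 <= T -> itv_family 0 T l -> total_length l <= T.
Proof.
move=> T0 lT; have := @le_sum_integral_family R T (cst 1%E) l _ _ lT.
have len (s t : R) : s <= t -> (\int[lam]_(r in `[s, t]) (1%E : \bar R) = (t - s)%:E)%E.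
  move=> st; rewrite integral_cst// mul1e; rewrite [LHS]lebesgue_measure_itv/= lte_fin.
  by case: ltP => // ts; congr EFin; apply/esym/eqP; rewrite subr_eq0 eq_le st ts.
rewrite len// subr0 => /(_ (measurable_cst _) (fun=> lee01)).
rewrite /total_length -lee_fin -sumEFin; apply: le_trans; apply: eq_ler.
rewrite !big_seq; apply: eq_bigr => p pl; rewrite len//.
by move: lT => /andP[/allP/(_ p pl)/and3P[]].
Qed.

Lemma sqrD_young (p q eta : R) : 0 < eta ->
  (p + q) ^+ 2 <= (1 + eta) * p ^+ 2 + (1 + eta^-1) * q ^+ 2.
Proof.
move=> e0; rewrite -subr_ge0 (_ : _ - _ = (eta * p - q) ^+ 2 / eta); first by rewrite divr_ge0 ?sqr_ge0// ltW.
by field; rewrite gt_eqF.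
Qed.

(** The difference of the drivers has slope at most [c], hence energy at most n c^2 T / 2; Young's
    inequality with parameter [eta] leaves the coefficient of [a] as close to 1 as desired. *)
Lemma energy_le_perturb T h k a eta c : 0 <= T -> 0 < eta -> energy_le T h a ->
  (forall j (s t : R), 0 <= s -> s <= t -> t <= T ->
     `|(k j t - k j s) - (h j t - h j s)| <= c * (t - s)) ->
  energy_le T k ((1 + eta) * a + (1 + eta^-1) * (n%:R * c ^+ 2 * T) / 2).
Proof.
move=> T0 eta0 ha hk l lT; have et1 : 0 < 1 + eta^-1 by rewrite addr_gt0 ?invr_gt0.
rewrite mulrDr mulrCA (mulrC 2 (_ / 2)) divfK//.
apply: (@le_trans _ _ ((1 + eta) * energy_on h l + (1 + eta^-1) * (n%:R * c ^+ 2 * total_length l))); last first.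
  apply: lerD; first by rewrite ler_pM2l ?addr_gt0// ha.
  by rewrite ler_pM2l//; apply: ler_wpM2l; [rewrite mulr_ge0 ?sqr_ge0|exact: total_length_le].
rewrite /energy_on /total_length !mulr_sumr -big_split/= !big_seq; apply: ler_sum => p pl.
have /andP[/allP/(_ p pl)/and3P[p0 pp pT] _] := lT.
have -> : n%:R * c ^+ 2 * (p.2 - p.1) = \sum_(j < n) c ^+ 2 * (p.2 - p.1).
  by rewrite sumr_const card_ord -mulrA mulr_natl.
rewrite !mulr_sumr -big_split/=; apply: ler_sum => j _.
have [E|ne] := eqVneq p.1 p.2; first by rewrite E !subrr expr0n/= !mul0r !mulr0 addr0.
have d0 : 0 < p.2 - p.1 by rewrite subr_gt0 lt_neqAle ne.
rewrite ler_pdivrMr// (_ : _ * (p.2 - p.1) =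
    (1 + eta) * (h j p.2 - h j p.1) ^+ 2 + (1 + eta^-1) * (c * (p.2 - p.1)) ^+ 2); last first.
  by field; rewrite !gt_eqF.
have := hk j p.1 p.2 p0 pp pT; set q := _ - _ => qc.
rewrite (_ : k j p.2 - k j p.1 = (h j p.2 - h j p.1) + q); last by rewrite /q; ring.
apply: le_trans (sqrD_young _ _ eta0) _; rewrite lerD2l ler_pM2l//.
by rewrite -[leLHS]real_normK ?num_real// ler_sqr ?nnegrE// (le_trans _ qc).
Qed.

Lemma noise_eq mu x y j t : 0 <= t -> (forall i (r : R), 0 <= r <= t -> x i r = y i r) ->
  noise mu x j t = noise mu y j t.
Proof.
move=> t0 xy; rewrite /noise xy ?t0 ?lexx//; congr (_ - _).
apply: eq_Rintegral => r; rewrite inE/= in_itv/= => rt.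
by rewrite /drift_along; congr (drift _ _ _); apply/funext => i; exact: xy.
Qed.

Lemma integral_clip_continuous T (q : R -> R) : 0 < T -> continuous q ->
  continuous (fun t => \int[lam]_(s in `[0, clip 0 T t]) q s).
Proof.
move=> T0 cq t; apply/cvgrPdist_lt => e e0.
have [d d0 dH] := absolutely_continuous_continuous (absolutely_continuous_integral T0 cq) e0.
near=> s; have /andP[? ?] := clip_bnd t (ltW T0); have /andP[? ?] := clip_bnd s (ltW T0).
apply: dH => //; apply: le_lt_trans (clip_lip _ _ _ _) _; near: s.
exact: cvgr_dist_lt.
Unshelve. all: by end_near. Qed.

End perturbation.

Section tracking.
Context {R : realType} (mu T : R) (n : nat) (theta : 'rV[R]_n).
Hypothesis T0 : 0 < T.
Implicit Types (f g : path_space T n).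
Local Notation lam := (@lebesgue_measure R).
Local Notation level M := [set f : path_space T n | (dyson_rate mu theta f <= M%:E)%E].
Let T0' := ltW T0.

Lemma noise_clip_continuous (x : 'I_n -> R -> R) j : chamber_path x ->
  continuous (fun t => noise mu x j (clip 0 T t)).
Proof.
move=> cx t; apply: cvgB; last first.
  by apply: (integral_clip_continuous T0); exact: drift_along_continuous.
exact: (continuous_comp (@clip_continuous _ 0 T t) (cx.1 j _)).
Qed.

Lemma chamber_path_clip (t : R) (x : 'I_n -> R -> R) : 0 <= t -> (forall j, continuous (x j)) ->
  (forall r : R, 0 <= r <= t -> ordered (fun j => x j r)) ->
  chamber_path (fun j r => x j (clip 0 t r)).
Proof.
move=> t0 cx ox; split=> [j r|r]; last exact/ox/clip_bnd.
exact: (continuous_comp (@clip_continuous _ 0 t r) (cx j _)).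
Qed.

(* [y] solves the equation driven by [V] up to the drift difference, which is of order [d]. *)
Lemma energy_le_stopped a eta d L (s t : R) (x y V : 'I_n -> R -> R) :
  0 < s -> 0 <= t -> 0 < eta ->
  (forall (u v : 'I_n -> R) j (e : R), separated s u -> separated s v -> (forall i, `|u i - v i| <= e) ->
     `|drift mu u j - drift mu v j| <= L * e) ->
  chamber_path x -> (forall j, continuous (y j)) ->
  (forall r : R, 0 <= r <= t -> separated s (fun j => x j r) /\ separated s (fun j => y j r)) ->
  (forall j (r : R), 0 <= r <= t -> y j r = x j r - (noise mu x j r - theta ord0 j - V j r)) ->
  (forall j (r : R), 0 <= r <= t -> `|x j r - y j r| <= d) ->
  energy_le t V a ->
  chamber_path (fun j r => y j (clip 0 t r)) /\
  energy_le t (noise mu (fun j r => y j (clip 0 t r)))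
    ((1 + eta) * a + (1 + eta^-1) * (n%:R * (L * d) ^+ 2 * t) / 2).
Proof.
move=> s0 t0 eta0 HL cx cy xys yE xyd Va.
have cyt : chamber_path (fun j r => y j (clip 0 t r)).
  by apply: chamber_path_clip => // r rt; apply: (separated_ordered s0); have [] := xys r rt.
split => //; apply: (energy_le_perturb t0 eta0 Va) => j u v u0 uv vt.
have ut : 0 <= u <= t by rewrite u0 (le_trans uv).
have vt' : 0 <= v <= t by rewrite vt (le_trans u0).
have -> : noise mu (fun j r => y j (clip 0 t r)) j v - noise mu (fun j r => y j (clip 0 t r)) j u - (V j v - V j u) =
    \int[lam]_(r in `[u, v]) (drift_along mu x j r - drift_along mu (fun j r => y j (clip 0 t r)) j r).
  rewrite RintegralB//; last 2 first.
  - by apply: continuous_integrable_itv; exact: drift_along_continuous.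
  - by apply: continuous_integrable_itv; exact: drift_along_continuous.
  have cvt : clip 0 t v = v by rewrite clip_id ?(le_trans u0).
  have cut : clip 0 t u = u by rewrite clip_id ?(le_trans uv).
  rewrite noiseB// cvt cut !yE//.
  have := noiseB mu j cx u0 uv; set I := \int[lam]_(r in _) drift_along mu x j r => H.
  have -> : I = x j v - x j u - (noise mu x j v - noise mu x j u) by rewrite H; ring.
  by ring.
apply: norm_integral_itv_le => //.
  by move=> r; apply: cvgB; exact: drift_along_continuous.
move=> r /andP[ur rv]; have rt : 0 <= r <= t by rewrite (le_trans u0 ur) (le_trans rv vt).
have crt : clip 0 t r = r by have /andP[? ?] := rt; rewrite clip_id.
have [xs ys] := xys r rt; rewrite /drift_along crt.
by apply: HL => // i; exact: xyd.
Qed.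

(** The witness is [y], the path minus the discrepancy of the drivers, so that its driver is [V] up
    to a change of drift. The Lipschitz bound on that change needs separation of both paths. Only
    [y] has a controlled energy, while separation is deduced from the potential of [x]; each bound
    serves to propagate the other. *)
Lemma near_level a a' e : a < a' -> 0 < e -> exists2 d : R, 0 < d &
  forall f (V : 'I_n -> R -> R), (forall j, continuous (V j)) -> (forall j, V j 0 = 0) ->
    energy_le T V a -> (forall j, path_coord f j 0 = theta ord0 j) ->
    (forall j (t : R), 0 <= t <= T -> `|noise mu (path_ext f) j t - (theta ord0 j + V j t)| <= d) ->
  exists2 g, level a' g & path_ball g e f.
Proof.
move=> aa' e0.
pose C := n%:R * (2^-1 * (`|mu| + 1) ^+ 2) : R.
have C0 : 0 <= C by rewrite mulr_ge0// mulr_ge0// sqr_ge0.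
(* The a priori bound for a path of energy a' started at [theta]; the path [x] is allowed a margin
   of 1 above it. *)
pose c := potential (fun j => theta ord0 j) + a' + C * T.
pose s0 := expR (- ((c + 1) / 2)); have s00 : 0 < s0 by exact: expR_gt0.
pose s := s0 / 2; have sp : 0 < s by exact: divr_gt0.
have [L L0 [_ LH]] := @drift_lipschitz R n s mu sp.
have [L' L'0 L'H] := @potential_lipschitz R n s sp.
(* Chosen for (1 + eta) a <= (a + a') / 2; the other half of a' - a is left to the change of
   drift. *)
pose eta := (a' - a) / 2 / (`|a| + 1).
have a1 : 0 < `|a| + 1 by rewrite ltr_wpDl.
have eta0 : 0 < eta by rewrite !divr_gt0// subr_gt0.
have et1 : 0 < 1 + eta^-1 by rewrite addr_gt0 ?invr_gt0.
have etaa : (1 + eta) * a <= (a + a') / 2.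
  have h1 : eta * a <= eta * (`|a| + 1) by rewrite ler_pM2l// (le_trans (ler_norm a))// lerDl.
  have h2 : eta * (`|a| + 1) = (a' - a) / 2 by rewrite /eta divfK ?gt_eqF.
  by rewrite mulrDl mul1r; lra.
pose K := (1 + eta^-1) * (n%:R * L ^+ 2 * T) / 2.
have K0 : 0 <= K.
  apply: divr_ge0 => //; apply: mulr_ge0; first exact: ltW.
  by apply: mulr_ge0 => //; rewrite mulr_ge0// sqr_ge0.
(* 1 gives d^2 <= d, s keeps [y] separated, e / 2 controls the distance, 1 / (2 L') leaves half of
   the margin on the potential, and the last term makes the energy of the change of drift at most
   (a' - a) / 2. *)
pose d := Num.min (Num.min 1 s) (Num.min (e / 2) (Num.min (2^-1 / L') ((a' - a) / 2 / (K + 1)))).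
have K1 : 0 < K + 1 by rewrite ltr_wpDl.
have d0 : 0 < d by rewrite !lt_min ltr01 sp !divr_gt0 ?invr_gt0 ?subr_gt0.
have /and5P[d1 ds de dL' dK] : [&& d <= 1, d <= s, d <= e / 2, d <= 2^-1 / L' & d <= (a' - a) / 2 / (K + 1)].
  by rewrite /d !ge_min !lexx ?orbT.
move: dL' dK; rewrite !ler_pdivlMr// => dL' dK.
have dsK : (1 + eta) * a + (1 + eta^-1) * (n%:R * (L * d) ^+ 2 * T) / 2 <= a'.
  have -> : (1 + eta^-1) * (n%:R * (L * d) ^+ 2 * T) / 2 = K * (d * d) by rewrite /K exprMn; ring.
  have h1 : K * (d * d) <= (a' - a) / 2.
    apply: (@le_trans _ _ (d * (K + 1))); last by rewrite ler_pdivlMr.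
    rewrite mulrCA ler_pM2l//.
    by apply: (@le_trans _ _ K); [rewrite ler_piMr|rewrite lerDl].
  by lra.
exists d => // f V cV V0 Va f0 fV; set x := path_ext f in fV.
have cx : chamber_path x by exact: path_ext_chamber.
have xE j t : 0 <= t <= T -> x j t = path_coord f j t by exact: path_ext_id.
have a'0 : 0 <= a' by rewrite (le_trans (energy_le_ge0 Va))// ltW.
pose D j (t : R) := noise mu x j (clip 0 T t) - theta ord0 j - V j (clip 0 T t).
pose y j (t : R) := x j t - D j t.
have cy j : continuous (y j).
  move=> t; apply: cvgB; first exact: cx.1.
  apply: cvgB; last exact: (continuous_comp (@clip_continuous _ 0 T t) (cV j _)).
  by apply: cvgB; [exact: noise_clip_continuous|exact: cvg_cst].
have yE j t : 0 <= t <= T -> y j t = x j t - (noise mu x j t - theta ord0 j - V j t).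
  by move=> /andP[t0 tT]; rewrite /y /D clip_id.
have xyd j t : 0 <= t <= T -> `|x j t - y j t| <= d.
  move=> tT; rewrite yE// (_ : x j t - _ = noise mu x j t - (theta ord0 j + V j t)) ?fV//; ring.
have x0 : (fun j => x j 0) = (fun j => theta ord0 j).
  by apply/funext => j; rewrite xE ?lexx ?f0.
have y0 j : y j 0 = theta ord0 j.
  rewrite yE ?lexx// V0 /noise.
  by rewrite set_itv1 Rintegral_set1; ring.
have sep0 t : 0 <= t <= T -> potential (fun j => x j t) <= c + 1 ->
    separated s (fun j => x j t) /\ separated s (fun j => y j t).
  move=> tT Ux; have xs : separated s0 (fun j => x j t) by apply: potential_separated; [exact: cx.2|].
  split; apply: (separated_close xs) => i; first by rewrite subrr normr0 ltW.
  by apply: le_trans ds; exact: xyd.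
have core t : 0 <= t <= T -> (forall r, 0 <= r <= t -> potential (fun j => x j r) <= c + 1) ->
    chamber_path (fun j r => y j (clip 0 t r)) /\ energy_le t (noise mu (fun j r => y j (clip 0 t r))) a'.
  move=> /andP[t0 tT] Ux.
  have rT r : 0 <= r <= t -> 0 <= r <= T by move=> /andP[-> /le_trans]; exact.
  have xyt r : 0 <= r <= t -> separated s (fun j => x j r) /\ separated s (fun j => y j r).
    by move=> rt; apply: sep0; [exact: rT|exact: Ux].
  have Vt : energy_le t V a by exact: energy_le_horizon Va.
  have [cyt yen] := energy_le_stopped sp t0 eta0 LH cx cy xyt
    (fun j r rt => yE j r (rT r rt)) (fun j r rt => xyd j r (rT r rt)) Vt.
  split => // l lt; apply: le_trans (yen l lt) _; rewrite ler_pM2l//.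
  apply: le_trans dsK; rewrite lerD2l ler_pM2r// ler_pM2l// ler_wpM2l//.
  by rewrite mulr_ge0// sqr_ge0.
(* While U(x) <= c + 1, the path [y] has energy at most a', so U(y) <= c by the a priori bound, and
   U(x) <= c + 1/2 since L' d <= 1/2. *)
have Ux t : 0 <= t <= T -> potential (fun j => x j t) - (c + 1) < 0.
  apply: (continuous_induction (phi := fun t => potential (fun j => x j t) - (c + 1))).
  - by move=> r; apply: cvgB; [exact: potential_along_continuous|exact: cvg_cst].
  - rewrite x0 /c; have : 0 <= C * T by rewrite mulr_ge0.
    by move: a'0; move: (potential _) (C * T) => u v; lra.
  - move=> r rT H; have {}H q : 0 <= q <= r -> potential (fun j => x j q) <= c + 1.
      by move=> qr; have := H q qr; rewrite subr_le0.
    have [cyr yen] := core r rT H; have /andP[r0 rT'] := rT.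
    have rr : 0 <= r <= r by rewrite r0 lexx.
    have := potential_a_priori cyr yen rr; rewrite !clip_id//.
    have -> : (fun i => y i 0) = (fun i => theta ord0 i) by apply/funext => i; exact: y0.
    have [xs ys] := sep0 r rT (H r rr).
    have := L'H _ _ d (ltW d0) xs ys (fun i => xyd i r rT).
    have : C * r <= C * T by rewrite ler_wpM2l.
    rewrite ler_norml /c => + /andP[_ +]; rewrite -/C.
    move: (potential _) (potential _) (potential _) (C * r) (C * T) dL' => u v w p q.
    by rewrite mulrC; lra.
have [||cyT yen] := core T; first by rewrite T0' lexx.
  by move=> r rT; have := Ux r rT; rewrite subr_lt0 => /ltW.
have [g gE] := path_of T cyT.
exists g; last first.
  move=> t j tT; rewrite gE// clip_id; [|by case/andP: tT..].
  by rewrite -xE// distrC; apply: le_lt_trans (xyd j t tT) _; lra.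
apply/(dyson_rate_leP mu theta T0); split.
  by move=> j; rewrite gE ?lexx// clip_id ?lexx ?y0.
move=> l lT; apply: le_trans (yen l lT); apply: eq_ler.
rewrite /energy_on !big_seq; apply: eq_bigr => p pl; apply: eq_bigr => j _.
have /andP[/allP/(_ p pl)/and3P[p0 pp pT] _] := lT.
have gx (t : R) : 0 <= t -> t <= T -> noise mu (path_ext g) j t = noise mu (fun j r => y j (clip 0 T r)) j t.
  move=> t0 tT; apply: noise_eq => // i r /andP[r0 rt].
  by rewrite path_ext_id ?gE ?r0 ?(le_trans rt).
by rewrite !gx// ?(le_trans p0)// (le_trans pp).
Qed.

End tracking.

Section stability.
Context {R : realType} (mu T : R) (n : nat) (theta : 'rV[R]_n).
Hypothesis T0 : 0 < T.
Implicit Types (f g : path_space T n).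
Local Notation lam := (@lebesgue_measure R).
Local Notation level M := [set f : path_space T n | (dyson_rate mu theta f <= M%:E)%E].
Let T0' := ltW T0.

Lemma continuous_expRM (c : R) : continuous (fun s : R => expR (c * s)).
Proof.
move=> s; apply: (@cvg_comp _ _ _ (fun s => c * s) expR _ (nbhs (c * s))); last exact: continuous_expR.
by apply: cvgMr; exact: cvg_id.
Qed.

Lemma integral_expRM (c t : R) : 0 < c -> 0 <= t ->
  \int[lam]_(s in `[0, t]) expR (c * s) = (expR (c * t) - 1) / c.
Proof.
move=> c0; rewrite le_eqVlt => /orP[/eqP <-|t0].
  by rewrite set_itv1 Rintegral_set1 mulr0 expR0 subrr mul0r.
have cE := @continuous_expRM c.
rewrite /Rintegral (@continuous_FTC2 _ _ (fun s => c^-1 * expR (c * s)))//.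
- by rewrite mulr0 expR0/=; field; rewrite gt_eqF.
- exact: continuous_subspaceT.
- have cF : continuous (fun s : R => c^-1 * expR (c * s)).
    by move=> s; apply: cvgMr; exact: cE.
  split; first by move=> z _; exact: ex_derive.
  + by apply/cvg_at_right_filter; exact: cF.
  + by apply/cvg_at_left_filter; exact: cF.
- move=> z _; rewrite derive1Ml// derive1_comp// derive1Ml// derive1_id mulr1 derive1E derive_val.
  by rewrite mulrCA mulVf ?mulr1// gt_eqF.
Qed.

(* Gronwall's inequality, run as a continuous induction so that it applies on the region
   where the drift is Lipschitz. *)
Lemma level_stability M g (e : R) : level M g -> 0 < e -> exists2 d : R, 0 < d &
  forall f, (forall j (t : R), 0 <= t <= T ->
      `|noise mu (path_ext f) j t - noise mu (path_ext g) j t| <= d) -> path_ball g e f.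
Proof.
move=> gM e0; have [s0 s00 /(_ g gM) gs] := level_separated mu theta T0 M.
pose s := s0 / 2; have sp : 0 < s by exact: divr_gt0.
have [L L0 [_ LH]] := @drift_lipschitz R n s mu sp.
(* The Gronwall rate for the sum of the deviations is n L; the added 1 keeps the division by [c]
   legitimate. *)
pose c := n%:R * L + 1; have c0 : 0 < c by rewrite ltr_wpDl// mulr_ge0// ltW.
(* Keeps k exp(c t) below [s], so that [f] stays where the drift is Lipschitz, and below e / 2. *)
pose k := Num.min s (e / 2) / expR (c * T).
have k0 : 0 < k by rewrite divr_gt0 ?expR_gt0// lt_min sp divr_gt0.
have kT t : 0 <= t <= T -> k * expR (c * t) <= s /\ k * expR (c * t) <= e / 2.
  move=> /andP[_ tT]; have : k * expR (c * t) <= Num.min s (e / 2).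
    rewrite -[leRHS](@divfK _ (expR (c * T))) ?gt_eqF ?expR_gt0// ler_pM2l//.
    by rewrite ler_expR ler_pM2l.
  by rewrite le_min => /andP[].
have n1 : 0 < (n%:R + 1) :> R by rewrite ltr_wpDl.
(* With n + 1 instead of n, the sum of the driver errors is strictly below [k]. *)
exists (k / (n%:R + 1)); first exact: divr_gt0.
move=> f fg; set x := path_ext f in fg; set z := path_ext g in fg.
have cx : chamber_path x by exact: path_ext_chamber.
have cz : chamber_path z by exact: path_ext_chamber.
pose phi (t : R) := \sum_(j < n) `|x j t - z j t| - k * expR (c * t).
have le_phi t i : phi t <= 0 -> `|x i t - z i t| <= k * expR (c * t).
  rewrite subr_le0; apply: le_trans; rewrite (bigD1 i)//= lerDl.
  by apply: sumr_ge0 => j _.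
have nd : n%:R * (k / (n%:R + 1)) < k.
  by rewrite mulrA ltr_pdivrMr// mulrC ltr_pM2l// ltrDl.
have xzE j t : 0 <= t -> x j t - z j t = (noise mu x j t - noise mu z j t) +
    \int[lam]_(r in `[0, t]) (drift_along mu x j r - drift_along mu z j r).
  move=> t0; rewrite RintegralB//; last 2 first.
  - by apply: continuous_integrable_itv; exact: drift_along_continuous.
  - by apply: continuous_integrable_itv; exact: drift_along_continuous.
  by rewrite /noise; ring.
have phi_lt t : 0 <= t <= T -> phi t < 0.
  apply: continuous_induction.
  - move=> t'; apply: cvgB.
      by apply: cvg_sumr => j _; apply: cvg_norm; apply: cvgB; [exact: cx.1|exact: cz.1].
    by apply: cvgMr; exact: continuous_expRM.
  - rewrite /phi mulr0 expR0 mulr1 subr_lt0; apply: le_lt_trans nd.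
    rewrite mulr_natl -[X in _ *+ X]card_ord -sumr_const; apply: ler_sum => j _.
    have := fg j 0; rewrite lexx T0' => /(_ isT); apply: le_trans.
    by rewrite xzE// set_itv1 Rintegral_set1 addr0.
  - move=> r rT H; have /andP[r0 rT'] := rT.
    have step j : `|x j r - z j r| <= k / (n%:R + 1) + L * k * ((expR (c * r) - 1) / c).
      rewrite xzE//; apply: le_trans (ler_normD _ _) _; apply: lerD; first exact: fg.
      have cD : continuous (fun q => drift_along mu x j q - drift_along mu z j q).
        by move=> q; apply: cvgB; exact: drift_along_continuous.
      apply: le_trans (le_normr_Rintegral _ _) _ => //; first exact: continuous_integrable_itv.
      rewrite -(integral_expRM c0 r0) -RintegralZl//; last first.
        by apply: continuous_integrable_itv; exact: continuous_expRM.
      apply: le_Rintegral => //.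
      + by apply: continuous_integrable_itv => q; apply: cvg_norm; exact: cD.
      + by apply: continuous_integrable_itv => q; apply: cvgMr; exact: continuous_expRM.
      + move=> q /=; rewrite in_itv/= => qr; have /andP[q0 qr'] := qr.
        have qT : 0 <= q <= T by rewrite q0 (le_trans qr').
        have close i := le_phi q i (H q qr).
        rewrite -mulrA; apply: LH => //; last first.
          by apply: (separated_close (gs q)) => i; rewrite subrr normr0 ltW.
        apply: (separated_close (gs q)) => i; rewrite distrC; apply: le_trans (close i) _.
        by have [] := kT q qT.
    rewrite /phi subr_lt0.
    apply: (@le_lt_trans _ _ (n%:R * (k / (n%:R + 1) + L * k * ((expR (c * r) - 1) / c)))).
      rewrite [leRHS]mulr_natl -[X in _ *+ X]card_ord -sumr_const; apply: ler_sum => j _.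
      exact: step.
    have E0 : 0 <= expR (c * r) - 1 by rewrite subr_ge0 -expR0 ler_expR mulr_ge0// ltW.
    have h : n%:R * (L * k * ((expR (c * r) - 1) / c)) <= k * (expR (c * r) - 1).
      rewrite (_ : n%:R * _ = k * (expR (c * r) - 1) * ((n%:R * L) / c)); last first.
        by field; rewrite gt_eqF.
      apply: ler_piMr; first by apply: mulr_ge0 => //; exact: ltW.
      by rewrite ler_pdivrMr// mul1r lerDl.
    rewrite mulrDr; apply: (@lt_le_trans _ _ (k + k * (expR (c * r) - 1))); last by rewrite mulrBr mulr1; lra.
    exact: ltr_leD.
move=> t j tT; rewrite -(path_ext_id g)// -(path_ext_id f)// distrC.
apply: le_lt_trans (le_phi t j (ltW (phi_lt t tT))) _.
by have [_] := kT t tT; move/le_lt_trans; apply; lra.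
Qed.

End stability.

(** * Piecewise linear interpolation of the driver *)

Section interpolation.
Context {R : realType} (T : R) (n N : nat).
Hypothesis T0 : 0 < T.
Hypothesis N0 : (0 < N)%N.
Let dt := T / N%:R.

Let dt_gt0 : 0 < dt. Proof. by rewrite divr_gt0// ltr0n. Qed.

Let dtN : dt * N%:R = T. Proof. by rewrite /dt divfK// gt_eqF// ltr0n. Qed.

Lemma sum_clip (m : nat) (u : R) : \sum_(i < m) clip 0 1 (u - i%:R) = clip 0 m%:R u.
Proof.
elim: m => [|m ih].
  by rewrite big_ord0 /clip; case: (leP 0 u) => u0; [rewrite maxxx|rewrite max_l// ltW].
rewrite big_ord_recr/= ih /clip -natr1; have : 0 <= m%:R :> R by [].
move: (m%:R) => M M0; case: (leP M u) => Mu; case: (leP (M + 1) u) => M1u; case: (leP 1 (u - M)) => h;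
  rewrite /Num.max; repeat case: ifPn; rewrite -?leNgt; lra.
Qed.

Variable W : 'I_n -> R -> R.

Definition increment (i : nat) (j : 'I_n) : R := W j (dt * i.+1%:R) - W j (dt * i%:R).

(** A sum of ramps: the clipped factor rises from 0 to 1 across the cell i and is constant
    elsewhere. This is continuous on the line and starts at 0, with no case distinction on cells. *)
Definition interpolate (j : 'I_n) (t : R) : R :=
  \sum_(i < N) increment i j * clip 0 1 (t / dt - i%:R).

Lemma interpolate_continuous j : continuous (interpolate j).
Proof.
move=> t; apply: cvg_sumr => i _; apply: cvgMr.
apply: (@cvg_comp _ _ _ (fun t => t / dt - i%:R) (clip 0 1) _ (nbhs (t / dt - i%:R))); last exact: clip_continuous.
by apply: cvgB; [apply: cvgMl; exact: cvg_id|exact: cvg_cst].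
Qed.

Lemma interpolate0 j : interpolate j 0 = 0.
Proof.
apply: big1 => i _; rewrite mul0r sub0r /clip min_r ?oppr_le0//.
  by rewrite max_l ?oppr_le0// mulr0.
Qed.

Lemma interpolate_cell j (i : 'I_N) (t : R) : dt * i%:R <= t -> t <= dt * i.+1%:R ->
  interpolate j t = W j (dt * i%:R) - W j 0 + increment i j * (t / dt - i%:R).
Proof.
move=> it ti; have h1 : i%:R <= t / dt by rewrite ler_pdivlMr// mulrC.
have h2 : t / dt <= i%:R + 1 by rewrite natr1 ler_pdivrMr// mulrC.
rewrite /interpolate -(big_mkord xpredT (fun k => increment k j * clip 0 1 (t / dt - k%:R))).
rewrite (@big_cat_nat _ _ _ i)//=; last exact/ltnW/ltn_ord.
rewrite [X in _ + X]big_ltn; last exact: ltn_ord.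
rewrite [X in _ + (_ + X)]big_nat_cond [X in _ + (_ + X)]big1 ?addr0; last first.
  move=> k /andP[/andP[ik _] _]; have : (i.+1%:R : R) <= k%:R by rewrite ler_nat.
  rewrite -natr1 => ik'; rewrite /clip min_r ?max_l ?mulr0//; lra.
congr (_ + _); last by rewrite clip_id//; lra.
transitivity (\sum_(0 <= k < i) increment k j); last first.
  have := @telescope_sumr R 0 i (fun k => W j (dt * k%:R)) (leq0n _).
  by rewrite mulr0.
apply: eq_big_nat => k /andP[_ ki]; have : (k.+1%:R : R) <= i%:R by rewrite ler_nat.
by rewrite -natr1 => ki'; rewrite /clip min_l ?max_r ?mulr1//; lra.
Qed.

Lemma interpolate_close (d : R) : (forall j, W j 0 = 0) ->
  (forall (i : 'I_N) j (t : R), dt * i%:R <= t -> t <= dt * i.+1%:R -> `|W j t - W j (dt * i%:R)| <= d) ->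
  forall j (t : R), 0 <= t <= T -> `|W j t - interpolate j t| <= 2 * d.
Proof.
move=> W0 osc j t tT; have [i it ti] := grid_cell T0 N0 tT.
have ii : dt * i%:R <= dt * i.+1%:R by rewrite ler_pM2l// ler_nat.
rewrite (interpolate_cell j it ti) W0 subr0.
have a0 : 0 <= t / dt - i%:R by rewrite subr_ge0 ler_pdivlMr// mulrC.
have a1 : t / dt - i%:R <= 1 by rewrite lerBlDr addrC natr1 ler_pdivrMr// mulrC.
have := osc i j _ it ti; have := osc i j _ ii (lexx _); rewrite -/(increment i j) => h1 h2.
rewrite opprD addrA; apply: le_trans (ler_normB _ _) _.
rewrite (_ : 2 * d = d + d); last by ring.
apply: lerD => //; rewrite normrM (ger0_norm a0); apply: le_trans h1.
by rewrite ler_piMr.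
Qed.

(** On an interval of the family the slope is an average of the cell slopes, weighted by the growth
    of the ramps; Jensen's inequality applies, and over the whole family each ramp grows by at most
    1. *)
Lemma interpolate_energy a :
  \sum_(i < N) \sum_(j < n) increment i j ^+ 2 / dt <= 2 * a -> energy_le T interpolate a.
Proof.
move=> Ea l lT; apply: le_trans Ea.
pose c (i : 'I_N) (t : R) := clip 0 1 (t / dt - i%:R).
have sumc (t : R) : 0 <= t <= T -> \sum_(i < N) c i t = t / dt.
  move=> /andP[t0 tT]; rewrite /c sum_clip clip_id//; first by rewrite divr_ge0// ltW.
  by rewrite ler_pdivrMr// mulrC dtN.
have c_le i (s t : R) : s <= t -> c i s <= c i t.
  by move=> st; apply: clip_homo; rewrite lerD2r ler_pM2r ?invr_gt0.
(* A ramp is monotone, so it carries the family to a nonoverlapping family in [0, 1], of total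
   length at most 1. *)
have cl (i : 'I_N) : \sum_(p <- l) (c i p.2 - c i p.1) <= 1.
  have lc : itv_family 0 1 [seq (c i p.1, c i p.2) | p <- l].
    have /andP[/allP al pl] := lT; apply/andP; split.
      rewrite all_map; apply/allP => p /al/and3P[_ pp _] /=; apply/and3P; split; last 2 first.
      - exact: c_le.
      - by have /andP[] := clip_bnd (p.2 / dt - i%:R) (@ler01 R).
      - by have /andP[] := clip_bnd (p.1 / dt - i%:R) (@ler01 R).
    rewrite pairwise_map; apply: sub_pairwise pl => p q; rewrite /nonoverlap /= => /orP[pq|qp].
      by rewrite c_le.
    by rewrite orbC c_le.
  by have := total_length_le ler01 lc; rewrite /total_length big_map.
apply: (@le_trans _ _ (\sum_(p <- l) \sum_(j < n) \sum_(i < N) increment i j ^+ 2 / dt * (c i p.2 - c i p.1))).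
  rewrite /energy_on !big_seq; apply: ler_sum => p pl; apply: ler_sum => j _.
  have /andP[/allP/(_ p pl)/and3P[p0 pp pT] _] := lT.
  have [E|ne] := eqVneq p.1 p.2.
    by rewrite E subrr expr0n/= mul0r; apply: sumr_ge0 => i _; rewrite subrr mulr0.
  have d0 : 0 < p.2 - p.1 by rewrite subr_gt0 lt_neqAle ne.
  rewrite ler_pdivrMr//.
  have -> : interpolate j p.2 - interpolate j p.1 = \sum_(i < N) increment i j * (c i p.2 - c i p.1).
    by rewrite /interpolate -sumrB; apply: eq_bigr => i _; rewrite mulrBr.
  have S1 : \sum_(i < N) (c i p.2 - c i p.1) = (p.2 - p.1) / dt.
    by rewrite sumrB !sumc ?mulrBl// ?p0 ?pT ?(le_trans pp)// (le_trans p0).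
  set m := \sum_(i < N) _ * _; pose v := m * dt / (p.2 - p.1).
  (* Jensen: [0 <= sum (x_i - v)^2 w_i] with [v] the barycentre *)
  have : 0 <= \sum_(i < N) (increment i j - v) ^+ 2 * (c i p.2 - c i p.1).
    by apply: sumr_ge0 => i _; rewrite mulr_ge0 ?sqr_ge0// subr_ge0 c_le.
  have -> : \sum_(i < N) (increment i j - v) ^+ 2 * (c i p.2 - c i p.1) =
      \sum_(i < N) increment i j ^+ 2 * (c i p.2 - c i p.1) - 2 * v * m + v ^+ 2 * ((p.2 - p.1) / dt).
    rewrite -S1 /m !mulr_sumr -sumrB -big_split/=; apply: eq_bigr => i _; ring.
  have -> : - (2 * v * m) = - (2 * (m ^+ 2 * dt / (p.2 - p.1))) by rewrite /v; field; rewrite gt_eqF.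
  have -> : v ^+ 2 * ((p.2 - p.1) / dt) = m ^+ 2 * dt / (p.2 - p.1).
    by rewrite /v; field; rewrite !gt_eqF// divr_gt0// ltr0n.
  set q := \sum_(i < N) _; have -> : \sum_(i < N) increment i j ^+ 2 / dt * (c i p.2 - c i p.1) = q / dt.
    by rewrite /q mulr_suml; apply: eq_bigr => i _; ring.
  move=> h; have : m ^+ 2 * dt / (p.2 - p.1) <= q by move: h; lra.
  rewrite ler_pdivrMr// => {}h; rewrite -(@ler_pM2r _ dt)//; apply: le_trans h _.
  by apply: eq_ler; field; rewrite gt_eqF.
under eq_bigr do rewrite exchange_big/=.
rewrite exchange_big/=; apply: ler_sum => i _; rewrite exchange_big/=; apply: ler_sum => j _.
rewrite -mulr_sumr ler_piMr// ?cl//.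
by rewrite divr_ge0 ?sqr_ge0// ltW.
Qed.

End interpolation.

(** * Estimates for Brownian motion *)

Section gaussian.
Context {R : realType}.
Implicit Types (v x y c r eps : R).
Local Notation lam := (@lebesgue_measure R).

Lemma measurable_norm_ge x : measurable [set y : R | x <= `|y| ].
Proof.
rewrite (_ : [set y | _] = (@Num.norm R R) @^-1` `[x, +oo[); last first.
  by apply/seteqP; split => y /=; rewrite in_itv/= andbT.
by rewrite -[X in measurable X]setTI; exact: normr_measurable.
Qed.

Lemma norm_ballE c r : [set y : R | `|y - c| < r] = `]c - r, c + r[%classic.
Proof. by apply/seteqP; split => y /=; rewrite in_itv/= ltr_distl. Qed.

Lemma normal_pdf_sqrt v y : 0 < v ->
  normal_pdf 0 (Num.sqrt v) y = (Num.sqrt (v * pi *+ 2))^-1 * expR (- (y ^+ 2 / (2 * v))).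
Proof.
move=> v0; rewrite normal_pdfE ?gt_eqF ?sqrtr_gt0// /normal_peak /normal_fun sqr_sqrtr ?ltW// subr0.
by rewrite mulNr mulr_natl.
Qed.

(* Compare with the Gaussian density of variance [v / eps]. *)
Lemma normal_tail v x eps : 0 < v -> 0 <= x -> 0 < eps -> eps <= 1 ->
  (normal_prob 0 (Num.sqrt v) [set y : R | x <= `|y| ]%R <=
   ((Num.sqrt eps)^-1 * expR (- ((1 - eps) * (x ^+ 2 / (2 * v)))))%:E)%E.
Proof.
move=> v0 x0 e0 e1; set K := _ * expR _.
have K0 : 0 <= K by rewrite mulr_ge0 ?invr_ge0 ?sqrtr_ge0 ?expR_ge0.
have mA := measurable_norm_ge x.
have se : 0 < Num.sqrt eps by rewrite sqrtr_gt0.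
apply: (@le_trans _ _ (\int[lam]_(y in [set y : R | x <= `|y| ]%R) (K%:E * (normal_pdf 0 (Num.sqrt (v / eps)) y)%:E))%E).
  apply: ge0_le_integral => //.
  - by move=> y _; rewrite lee_fin normal_pdf_ge0.
  - by apply: measurable_funTS; apply/measurable_EFinP; exact: measurable_normal_pdf.
  - apply: measurable_funTS; apply: (measurable_funeM K%:E); apply/measurable_EFinP; exact: measurable_normal_pdf.
  - move=> y /= xy; rewrite -EFinM lee_fin !normal_pdf_sqrt ?divr_gt0// /K.
    have -> : Num.sqrt (v / eps * pi *+ 2) = (Num.sqrt eps)^-1 * Num.sqrt (v * pi *+ 2).
      by rewrite -sqrtrV ?(ltW e0)// -sqrtrM ?invr_ge0 ?(ltW e0)//; congr Num.sqrt; rewrite -!mulrnAr; ring.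
    have s20 : Num.sqrt (v * pi *+ 2) != 0.
      by rewrite gt_eqF// sqrtr_gt0 mulrn_wgt0// mulr_gt0// pi_gt0.
    rewrite (_ : _ * (_ * _) = (Num.sqrt (v * pi *+ 2))^-1 *
      (expR (- ((1 - eps) * (x ^+ 2 / (2 * v)))) * expR (- (y ^+ 2 / (2 * (v / eps)))))); last first.
      by field; rewrite s20 gt_eqF.
    rewrite ler_pM2l ?invr_gt0 ?lt_neqAle 1?eq_sym ?s20 ?sqrtr_ge0// -expRD ler_expR -opprD lerN2.
    rewrite (_ : y ^+ 2 / (2 * (v / eps)) = eps * (y ^+ 2 / (2 * v))); last by field; rewrite !gt_eqF.
    have : x ^+ 2 / (2 * v) <= y ^+ 2 / (2 * v).
      rewrite ler_pM2r ?invr_gt0 ?mulr_gt0// -(real_normK (num_real y)) ler_sqr ?nnegrE//.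
    move: (_ / _) (_ / _) => p q pq.
    have : (1 - eps) * q <= (1 - eps) * p by rewrite ler_wpM2l// subr_ge0.
    by rewrite mulrBl mul1r; lra.
rewrite ge0_integralZl ?lee_fin//; last 2 first.
- by apply: measurable_funTS; apply/measurable_EFinP; exact: measurable_normal_pdf.
- by move=> y _; rewrite lee_fin normal_pdf_ge0.
rewrite -[leRHS]mule1; apply: lee_wpmul2l; first by rewrite lee_fin.
rewrite -(integral_normal_pdf 0 (Num.sqrt (v / eps))); apply: ge0_subset_integral => //.
- by apply/measurable_EFinP; exact: measurable_normal_pdf.
- by move=> y _; rewrite lee_fin normal_pdf_ge0.
Qed.

(** On the ball the density is at least its value at distance |c| + r from the origin. *)
Lemma normal_ball v c r : 0 < v -> 0 < r ->
  ((2 * r * (Num.sqrt (v * pi *+ 2))^-1 * expR (- ((`|c| + r) ^+ 2 / (2 * v))))%:E <=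
   normal_prob 0 (Num.sqrt v) [set y : R | `|y - c| < r]%R)%E.
Proof.
move=> v0 r0; pose K := (Num.sqrt (v * pi *+ 2))^-1 * expR (- ((`|c| + r) ^+ 2 / (2 * v))).
have K0 : 0 <= K by rewrite mulr_ge0 ?invr_ge0 ?sqrtr_ge0 ?expR_ge0.
rewrite norm_ballE.
apply: (@le_trans _ _ (\int[lam]_(y in `](c - r)%R, (c + r)%R[) K%:E)%E).
  rewrite integral_cst// [X in (_ <= _ * X)%E]lebesgue_measure_itv/= lte_fin ltrD2l gtrN//.
  by rewrite -EFinD -EFinM lee_fin /K; apply: eq_ler; ring.
apply: ge0_le_integral => //.
- by apply: measurable_funTS; apply/measurable_EFinP; exact: measurable_normal_pdf.
- move=> y /=; rewrite in_itv/= => /andP[cy yc]; rewrite lee_fin normal_pdf_sqrt// ler_wpM2l ?invr_ge0 ?sqrtr_ge0//.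
  rewrite ler_expR lerN2 ler_pM2r ?invr_gt0 ?mulr_gt0// -(real_normK (num_real y)).
  rewrite ler_sqr ?nnegrE// ?addr_ge0 ?(ltW r0)//.
  rewrite -[y](subrK c) (le_trans (ler_normD _ _))// addrC lerD2l ltW// ltr_norml; apply/andP; split; lra.
Qed.

End gaussian.

Section brownian_increments.
Context {R : realType} {d : measure_display} {Omega : measurableType d}.
Variable P : probability Omega R.
Implicit Types (X : R -> Omega -> R).

Lemma process_measurable (S : set R) X t : S t ->
  measurable_fun setT (X t : g_sigma_algebraType (process_events S X) -> R).
Proof.
move=> St _ A mA; rewrite setTI; apply: sub_gen_smallest.
by exists t => //; exists A.
Qed.

Lemma increment_tail X (s t k x eps : R) : standard_brownian_motion P X ->
  0 <= s -> s < t -> 0 < k -> 0 <= x -> 0 < eps -> eps <= 1 ->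
  (P [set w | x <= `|Num.sqrt k * (X t w - X s w)| ]%R <=
   ((Num.sqrt eps)^-1 * expR (- ((1 - eps) * (x ^+ 2 / (2 * (k * (t - s)))))))%:E)%E.
Proof.
move=> [_ _ Xn _ _] s0 st k0 x0 e0 e1.
have sk : 0 < Num.sqrt k by rewrite sqrtr_gt0.
have ts : 0 < t - s by rewrite subr_gt0.
have -> : [set w | x <= `|Num.sqrt k * (X t w - X s w)| ] =
    [set w | [set y : R | x / Num.sqrt k <= `|y| ] (X t w - X s w)].
  by apply/seteqP; split => w /=; rewrite normrM (gtr0_norm sk) ler_pdivrMr// mulrC.
rewrite Xn//; last exact: measurable_norm_ge.
apply: le_trans (normal_tail ts _ e0 e1) _; first by rewrite divr_ge0// ltW.
rewrite exprMn exprVn sqr_sqrtr ?(ltW k0)// lee_fin; apply: eq_ler.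
by congr (_ * expR (- (_ * _))); field; rewrite !gt_eqF.
Qed.

Lemma increment_ball X (s t k c r : R) : standard_brownian_motion P X ->
  0 <= s -> s < t -> 0 < k -> 0 < r ->
  ((2 * r * (Num.sqrt (k * (t - s) * pi *+ 2))^-1 *
      expR (- ((`|c| + r) ^+ 2 / (2 * (k * (t - s))))))%:E <=
   P [set w | `|Num.sqrt k * (X t w - X s w) - c| < r]%R)%E.
Proof.
move=> [_ _ Xn _ _] s0 st k0 r0.
have sk : 0 < Num.sqrt k by rewrite sqrtr_gt0.
have ts : 0 < t - s by rewrite subr_gt0.
have -> : [set w | `|Num.sqrt k * (X t w - X s w) - c| < r] =
    [set w | [set y : R | `|y - c / Num.sqrt k| < r / Num.sqrt k] (X t w - X s w)].
  have H a : (`|a - c / Num.sqrt k| < r / Num.sqrt k) = (`|Num.sqrt k * a - c| < r).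
    rewrite ltr_pdivlMr// -[X in `|_| * X](gtr0_norm sk) -normrM.
    by rewrite mulrBl divfK ?gt_eqF// mulrC.
  by apply/seteqP; split => w /=; rewrite H.
rewrite Xn//; last by rewrite norm_ballE.
have rk : 0 < r / Num.sqrt k by rewrite divr_gt0.
apply: le_trans (normal_ball (c / Num.sqrt k) ts rk).
rewrite lee_fin; apply: eq_ler.
have -> : Num.sqrt (k * (t - s) * pi *+ 2) = Num.sqrt k * Num.sqrt ((t - s) * pi *+ 2).
  by rewrite -sqrtrM ?(ltW k0)//; congr Num.sqrt; rewrite -!mulrnAr; ring.
rewrite normrM (gtr0_norm (_ : 0 < (Num.sqrt k)^-1)) ?invr_gt0// -mulrDl exprMn exprVn sqr_sqrtr ?(ltW k0)//.
have s0' : Num.sqrt ((t - s) * pi *+ 2) != 0.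
  by rewrite gt_eqF// sqrtr_gt0 mulrn_wgt0// mulr_gt0// pi_gt0.
congr (_ * expR (- _)); first by field; rewrite s0' gt_eqF.
by field; rewrite !gt_eqF.
Qed.

Variable n : nat.
Variable B : 'I_n -> R -> Omega -> R.
Hypothesis hB : forall j, standard_brownian_motion P (B j).
Hypothesis hBindep : independent_processes P B.

Lemma increment_measurable j (s t : R) (A : set R) : 0 <= s -> 0 <= t -> measurable A ->
  measurable [set w | A (B j t w - B j s w)].
Proof.
move=> s0 t0 mA; have [mB _ _ _ _] := hB j.
rewrite -[X in measurable X]setTI.
by apply: (measurable_funB (mB t t0) (mB s s0)).
Qed.

(** Independence of the components applies because each event on the increments of one component
    lies in the sigma-algebra of that component; independence of its increments does the rest. *)
Lemma increments_independent N (t : nat -> R) (A : nat -> 'I_n -> set R) :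
  0 <= t 0%N -> (forall i, t i <= t i.+1) -> (forall i j, measurable (A i j)) ->
  P [set w | forall (i : 'I_N) (j : 'I_n), A i j (B j (t i.+1) w - B j (t i) w)] =
  (\big[*%E/1%E]_(j < n) \big[*%E/1%E]_(i < N) P [set w | A i j (B j (t i.+1) w - B j (t i) w)%R])%E.
Proof.
move=> t0 tt mA; have ti i : 0 <= t i by elim: i => // i /le_trans; apply.
pose E j := [set w | forall i : 'I_N, A i j (B j (t i.+1) w - B j (t i) w)].
have -> : [set w | forall (i : 'I_N) (j : 'I_n), A i j (B j (t i.+1) w - B j (t i) w)] = \bigcap_j E j.
  by apply/seteqP; split => [w H j _ i|w H i j]; [exact: H|exact: H].
rewrite hBindep => [|j].
  by apply: eq_bigr => j _; have [_ _ _ H _] := hB j; exact: (H N t (A^~ j)).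
pose G := process_events [set t | 0 <= t] (B j).
have mE i : (G.-sigma.-measurable : set (set (g_sigma_algebraType G))) [set w | A i j (B j (t i.+1) w - B j (t i) w)].
  rewrite -[X in measurable X]setTI.
  by apply: measurable_funB => //; apply: process_measurable; exact: ti.
rewrite (_ : E j = \bigcap_(i in [set k : nat | (k < N)%N]) [set w | A i j (B j (t i.+1) w - B j (t i) w)]); last first.
  by apply/seteqP; split => w H i; [move=> iN; exact: (H (Ordinal iN))|exact: (H i (ltn_ord i))].
by apply: (@bigcap_measurableType _ (g_sigma_algebraType G)) => i _; exact: mE.
Qed.

End brownian_increments.

Section finite_unions_products.
Context {R : realType} {d : measure_display} {Omega : measurableType d}.
Variable P : probability Omega R.

Lemma measure_le_sum (I : finType) (p : pred I) (A : I -> set Omega) (E : set Omega) :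
  (forall i, measurable (A i)) -> measurable E ->
  (forall w, E w -> exists2 i, p i & A i w) -> (P E <= \sum_(i | p i) P (A i))%E.
Proof.
move=> mA mE EA.
pose K (S : set Omega) (x : \bar R) := measurable S /\ (P S <= x)%E.
have [mU PU] : K (\big[setU/set0]_(i | p i) A i) (\sum_(i | p i) P (A i))%E.
  apply: (big_ind2 K) => [|S x S' x' [mS Sx] [mS' Sx']|i _]; first by split => //; rewrite measure0.
    by split; [exact: measurableU|apply: le_trans (measureU2 _ mS mS') _; exact: leeD].
  by split.
apply: le_trans PU; apply: le_measure; rewrite ?inE// => w /EA[i pi Ai].
by rewrite (bigD1 i)//=; left.
Qed.

Lemma prode_le (I : finType) (x : I -> \bar R) (r : I -> R) :
  (forall i, 0 <= x i)%E -> (forall i, x i <= (r i)%:E)%E ->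
  ((0 <= \big[*%E/1%E]_i x i) /\ (\big[*%E/1%E]_i x i <= (\prod_i r i)%:E))%E.
Proof.
move=> x0 xr; apply: (big_ind2 (fun (y : \bar R) (s : R) => (0 <= y)%E /\ (y <= s%:E)%E)) => //.
by move=> y s y' s' [y0 ys] [y'0 ys']; split; [exact: mule_ge0|rewrite EFinM; exact: lee_pmul].
Qed.

Lemma prode_ge (I : finType) (x : I -> \bar R) (r : I -> R) :
  (forall i, 0 <= r i)%R -> (forall i, (r i)%:E <= x i)%E ->
  ((\prod_i r i)%:E <= \big[*%E/1%E]_i x i)%E.
Proof.
move=> r0 rx; suff [] : 0 <= \prod_i r i /\ ((\prod_i r i)%:E <= \big[*%E/1%E]_i x i)%E by [].
apply: (big_ind2 (fun (s : R) (y : \bar R) => 0 <= s /\ (s%:E <= y)%E)) => [|s y s' y' [s0 sy] [s'0 sy']|i _].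
- by split.
- by split; [exact: mulr_ge0|rewrite EFinM; apply: lee_pmul].
- by split.
Qed.

End finite_unions_products.

(** * Gaussian estimates on a time grid *)

Section grid_estimates.
Context {R : realType} {d : measure_display} {Omega : measurableType d}.
Variable P : probability Omega R.
Variables (n N : nat) (T : R).
Variable B : 'I_n -> R -> Omega -> R.
Hypothesis T0 : 0 < T.
Hypothesis N0 : (0 < N)%N.
Hypothesis hB : forall j, standard_brownian_motion P (B j).
Hypothesis hBindep : independent_processes P B.
Let dt := T / N%:R.

Let dt0 : 0 < dt. Proof. by rewrite divr_gt0// ltr0n. Qed.

Let grid0 (i : nat) : 0 <= dt * i%:R. Proof. by rewrite mulr_ge0// ltW. Qed.

Let grid_lt (i : nat) : dt * i%:R < dt * i.+1%:R.
Proof. by rewrite ltr_pM2l// ltr_nat. Qed.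

Let gridB (i : nat) : dt * i.+1%:R - dt * i%:R = dt.
Proof. by rewrite -mulrBr -natr1 addrAC subrr add0r mulr1. Qed.

Local Notation dX k i j w := (Num.sqrt k * (B j (dt * i.+1%:R) w - B j (dt * i%:R) w)).

Lemma grid_product (k : R) (A : nat -> 'I_n -> set R) : (forall i j, measurable (A i j)) ->
  measurable [set w | forall (i : 'I_N) (j : 'I_n), A i j (dX k i j w)] /\
  (P [set w | forall (i : 'I_N) (j : 'I_n), A i j (dX k i j w)] =
   \big[*%E/1%E]_(j < n) \big[*%E/1%E]_(i < N) P [set w | A i j (dX k i j w)])%E.
Proof.
move=> mA.
have mA' i j : measurable [set y | A i j (Num.sqrt k * y)].
  rewrite -[X in measurable X]setTI; exact: (mulrl_measurable (Num.sqrt k)).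
split; last exact: (@increments_independent _ _ _ P n B hB hBindep N (fun i => dt * i%:R)
    (fun i j => [set y | A i j (Num.sqrt k * y)]) (grid0 0) (fun i => ltW (grid_lt i)) mA').
rewrite (_ : [set w | _] = \bigcap_(i in [set i : nat | (i < N)%N]) \bigcap_(j in [set: 'I_n]) [set w | A i j (dX k i j w)]); last first.
  apply/seteqP; split => w H i => [iN j _|j]; first exact: (H (Ordinal iN)).
  by exact: (H i (ltn_ord i)).
apply: bigcap_measurableType => i _; apply: fin_bigcap_measurable => // j _.
exact: (increment_measurable hB j (grid0 i) (grid0 i.+1) (mA' i j)).
Qed.

(** The energies of the cells are rounded down to multiples of a / m and capped at [a]. An energy
    above [a] forces one of finitely many profiles [phi] of total at least (1 - eps) m, and each
    profile is a product of Gaussian tails. One factor 1 - eps is lost in the rounding, the other in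
    the tails; the number of profiles does not depend on [k] or [a]. *)
Lemma grid_energy_tail (eps : R) : 0 < eps -> eps < 1 -> exists2 C : R, 0 < C &
  forall (k a : R), 0 < k -> 0 < a ->
    measurable [set w | 2 * a < \sum_(i < N) \sum_(j < n) dX k i j w ^+ 2 / dt] /\
    (P [set w | 2 * a < \sum_(i < N) \sum_(j < n) dX k i j w ^+ 2 / dt]%R <=
      (C * expR (- ((1 - eps) ^+ 2 * a / k)))%:E)%E.
Proof.
move=> e0 e1; pose q : R := (N * n)%:R.
(* Rounding loses at most one unit per entry, hence at most q <= eps m in all. *)
pose m := (Num.truncn (q / eps)).+1.
have qm : q <= eps * m%:R.
  have /andP[_ /ltW] := truncn_itv (divr_ge0 (ler0n R (N * n)) (ltW e0)).
  by rewrite ler_pdivrMr// mulrC.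
have m0 : 0 < m%:R :> R by rewrite ltr0n.
pose I := {ffun 'I_N * 'I_n -> 'I_m.+1}.
pose c := (Num.sqrt eps)^-1; have c0 : 0 < c by rewrite invr_gt0 sqrtr_gt0.
exists (#|{: I}|%:R * c ^+ (N * n)).
  by rewrite mulr_gt0 ?exprn_gt0// ltr0n; apply/card_gt0P; exists [ffun=> ord0].
move=> k a k0 a0; set E := [set w | _].
have mX i j : measurable_fun setT (fun w => dX k i j w).
  have [mB _ _ _ _] := hB j.
  by apply: measurable_funM => //; apply: measurable_funB; exact: mB.
have mE : measurable E.
  have mS : measurable_fun setT (fun w => \sum_(i < N) \sum_(j < n) dX k i j w ^+ 2 / dt).
    apply: measurable_sum => i; apply: measurable_sum => j.
    by apply: measurable_funM => //; exact: measurable_funX.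
  rewrite (_ : E = (fun w => \sum_(i < N) \sum_(j < n) dX k i j w ^+ 2 / dt) @^-1` `]2 * a, +oo[); last first.
    by apply/seteqP; split => w /=; rewrite in_itv/= andbT.
  by rewrite -[X in measurable X]setTI; exact: mS.
split => //; pose del := a / m%:R; have del0 : 0 < del by rewrite divr_gt0.
pose x (phi : I) (ij : 'I_N * 'I_n) := Num.sqrt (2 * dt * del * (phi ij)%:R).
have x0 phi ij : 0 <= x phi ij by exact: sqrtr_ge0.
have x2 phi ij : x phi ij ^+ 2 = 2 * dt * del * (phi ij)%:R.
  by rewrite sqr_sqrtr// !mulr_ge0// ltW.
(* Sets are indexed by all naturals in [grid_product]; those beyond the grid are filled with
   [setT]. *)
pose mk (phi : I) (i : nat) (j : 'I_n) : set R :=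
  if insub i is Some i' then [set y | x phi (i', j) <= `|y| ] else setT.
have mkE phi (i : 'I_N) j : mk phi i j = [set y | x phi (i, j) <= `|y| ].
  by rewrite /mk valK.
have mmk phi i j : measurable (mk phi i j).
  by rewrite /mk; case: insub => // i'; exact: measurable_norm_ge.
pose A (phi : I) := [set w | forall (i : 'I_N) (j : 'I_n), mk phi i j (dX k i j w)].
pose good (phi : I) := (1 - eps) * m%:R <= \sum_(j < n) \sum_(i < N) (phi (i, j))%:R.
have PA phi : good phi -> (P (A phi) <= (c ^+ (N * n) * expR (- ((1 - eps) ^+ 2 * a / k)))%:E)%E.
  move=> gphi; have [_ ->] := grid_product k (mmk phi).
  pose r i j := c * expR (- ((1 - eps) * (del * (phi (i, j))%:R / k))).
  have [j|j|_] := @prode_le _ _ (fun j : 'I_n => \big[*%E/1%E]_(i < N) P [set w | mk phi i j (dX k i j w)])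
    (fun j : 'I_n => \prod_(i < N) r i j).
  - by apply: (big_ind (fun y : \bar R => 0 <= y)%E) => // *; exact: mule_ge0.
  - have [//|i|_] := @prode_le _ _ (fun i : 'I_N => P [set w | mk phi i j (dX k i j w)]) (fun i => r i j).
      rewrite mkE; apply: le_trans (increment_tail (hB j) (grid0 i) (grid_lt i) k0 (x0 phi (i, j)) e0 (ltW e1)) _.
      rewrite lee_fin gridB x2 le_eqVlt /r; apply/orP; left; apply/eqP.
      by congr (_ * expR (- (_ * _))); field; rewrite !gt_eqF.
    by [].
  move/le_trans; apply; rewrite lee_fin /r.
  rewrite (eq_bigr (fun j => c ^+ N * \prod_(i < N) expR (- ((1 - eps) * (del * (phi (i, j))%:R / k))))); last first.
    by move=> j _; rewrite big_split/= prodr_const card_ord.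
  rewrite big_split/= prodr_const card_ord -exprM ler_pM2l ?exprn_gt0//.
  under eq_bigr do rewrite -expR_sum.
  rewrite -expR_sum ler_expR.
  under eq_bigr do rewrite sumrN -mulr_sumr -mulr_suml -mulr_sumr.
  rewrite sumrN -mulr_sumr -mulr_suml -mulr_sumr lerN2.
  rewrite expr2 -!mulrA ler_pM2l ?subr_gt0// !mulrA ler_pM2r ?invr_gt0//.
  rewrite (_ : (1 - eps) * a = del * ((1 - eps) * m%:R)); last by rewrite /del; field; rewrite gt_eqF.
  by rewrite ler_pM2l.
have mA phi : measurable (A phi) by have [] := grid_product k (mmk phi).
have EA w : E w -> exists2 phi, good phi & A phi w.
  rewrite /E /= => Ew; pose e i j := dX k i j w ^+ 2 / (2 * dt).
  have e_ge0 i j : 0 <= e i j / del by rewrite divr_ge0 ?(ltW del0)// divr_ge0 ?sqr_ge0 ?mulr_ge0// ltW.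
  have {}Ew : a < \sum_(j < n) \sum_(i < N) e i j.
    rewrite exchange_big/= -(@ltr_pM2l _ 2)//; apply: lt_le_trans Ew _; rewrite mulr_sumr.
    apply: ler_sum => i _; rewrite mulr_sumr; apply: ler_sum => j _.
    by rewrite /e; apply: eq_ler; field; rewrite gt_eqF.
  exists [ffun ij : 'I_N * 'I_n => inord (minn m (Num.truncn (e ij.1 ij.2 / del)))]; last first.
    move=> i j; rewrite mkE /= -(@ler_pXn2r _ 2)// ?nnegrE// x2 real_normK ?num_real// ffunE/= inordK ?ltnS ?geq_minl//.
    rewrite (_ : dX k i j w ^+ 2 = 2 * dt * del * (e i j / del)); last by rewrite /e; field; rewrite !gt_eqF.
    apply: ler_wpM2l; first by rewrite !mulr_ge0// ltW.
    apply: (@le_trans _ _ (Num.truncn (e i j / del))%:R).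
      by rewrite ler_nat geq_minr.
    by have /andP[] := truncn_itv (e_ge0 i j).
  rewrite /good.
  under eq_bigr do under eq_bigr do rewrite ffunE/= inordK ?ltnS ?geq_minl//.
  (* An entry that reaches the cap provides the whole total [m] by itself; otherwise the cap is
     inactive and only the rounding matters. *)
  have [[j [i mij]]|nomij] := pselect (exists j : 'I_n, exists i : 'I_N, (m <= Num.truncn (e i j / del))%N).
    rewrite (bigD1 j)//= (bigD1 i)//= (minn_idPl mij).
    apply: (@le_trans _ _ m%:R); first by rewrite ler_piMl// lerBlDr lerDl ltW.
    rewrite -addrA lerDl addr_ge0//; apply: sumr_ge0 => // j' _.
    exact: sumr_ge0.
  apply: (@le_trans _ _ (\sum_(j < n) \sum_(i < N) (e i j / del - 1))); last first.
    apply: ler_sum => j _; apply: ler_sum => i _.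
    have /andP[_ h] := truncn_itv (e_ge0 i j).
    have -> : minn m (Num.truncn (e i j / del)) = Num.truncn (e i j / del).
      apply/minn_idPr; rewrite leqNgt; apply/negP => h'; apply: nomij; exists j, i; exact: ltnW.
    by rewrite lerBlDr natr1 ltW.
  under eq_bigr do rewrite sumrB -mulr_suml sumr_const card_ord.
  rewrite sumrB -mulr_suml sumr_const card_ord -mulrnA.
  rewrite mulrBl mul1r lerB// ?lerN2//.
  by rewrite ler_pdivlMr// /del mulrCA divff ?mulr1 ?ltW// gt_eqF.
apply: le_trans (measure_le_sum P mA mE EA) _.
apply: (@le_trans _ _ (\sum_(phi : I | good phi) (c ^+ (N * n) * expR (- ((1 - eps) ^+ 2 * a / k)))%:E)%E).
  by apply: lee_sum => phi; exact: PA.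
set K := c ^+ _ * expR _; have K0 : 0 <= K by rewrite mulr_ge0 ?expR_ge0// exprn_ge0// ltW.
rewrite sumEFin lee_fin (_ : _ * _ * expR _ = K *+ #|{: I}|); last by rewrite /K -mulr_natl; ring.
rewrite -sumr_const big_mkcond/=; apply: ler_sum => phi _; by case: ifP.
Qed.

(** [normal_ball] for each increment. The bound k <= 4 serves to make the Gaussian prefactor at
    least its value at 4. *)
Lemma grid_box (eta : R) (c : nat -> 'I_n -> R) : 0 < eta -> exists2 C : R, 0 < C &
  forall k : R, 0 < k -> k <= 4 ->
    measurable [set w | forall (i : 'I_N) (j : 'I_n), `|dX k i j w - c i j| < eta] /\
    ((C * expR (- ((\sum_(j < n) \sum_(i < N) (`|c i j| + eta) ^+ 2 / (2 * dt)) / k)))%:E <=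
    P [set w | forall (i : 'I_N) (j : 'I_n), `|dX k i j w - c i j| < eta]%R)%E.
Proof.
move=> eta0; pose c0 := 2 * eta * (Num.sqrt (4 * dt * pi *+ 2))^-1.
have s0 (v : R) : 0 < v -> 0 < Num.sqrt (v * pi *+ 2).
  by move=> v0; rewrite sqrtr_gt0 mulrn_wgt0// mulr_gt0// pi_gt0.
have c0_gt0 : 0 < c0 by rewrite !mulr_gt0// invr_gt0 s0// mulr_gt0.
exists (c0 ^+ (N * n)); first exact: exprn_gt0.
move=> k k0 k4; pose A (i : nat) (j : 'I_n) : set R := [set y | `|y - c i j| < eta].
have mA i j : measurable (A i j) by rewrite /A norm_ballE.
have [mG ->] := grid_product k mA; split => //.
pose r i j := c0 * expR (- ((`|c i j| + eta) ^+ 2 / (2 * dt) / k)).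
have r0 i j : 0 <= r i j by rewrite mulr_ge0 ?expR_ge0// ltW.
apply: le_trans (@prode_ge _ _ _ (fun j => \prod_(i < N) r i j) _ _); last 2 first.
- by move=> j; exact: prodr_ge0.
- move=> j; apply: prode_ge => // i.
  apply: le_trans (increment_ball (c i j) (hB j) (grid0 i) (grid_lt i) k0 eta0).
  rewrite lee_fin gridB /r; apply: ler_pM; rewrite ?expR_ge0 ?(ltW c0_gt0)//.
    apply: ler_wpM2l; first by rewrite mulr_ge0// ltW.
    rewrite lef_pV2 ?posrE; [|by rewrite s0// mulr_gt0..].
    apply: ler_wsqrtr; rewrite lerMn2r/= ler_pM2r ?pi_gt0//.
    by rewrite ler_pM2r.
  by apply: eq_ler; congr (expR (- _)); field; rewrite !gt_eqF.
rewrite lee_fin /r; apply: eq_ler.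
rewrite [RHS](eq_bigr (fun j => c0 ^+ N * \prod_(i < N) expR (- ((`|c i j| + eta) ^+ 2 / (2 * dt) / k)))); last first.
  by move=> j _; rewrite big_split/= prodr_const card_ord.
rewrite big_split/= prodr_const card_ord -exprM; congr (_ * _).
under [RHS]eq_bigr do rewrite -expR_sum.
rewrite -expR_sum; congr expR.
under [RHS]eq_bigr do rewrite sumrN -mulr_suml.
by rewrite sumrN -mulr_suml.
Qed.

End grid_estimates.

(** * Oscillation of Brownian motion by dyadic chaining *)

Section chaining.
Context {R : realType}.

(** The dyadic approximations of [t] from the left move by at most one step per level, and x / 4
    times the powers of 3/4 sum to x. The ratio 3/4 is chosen so that its square exceeds 1/2:
    relative to the variance, squared thresholds grow like (9/8)^m. *)
Lemma dyadic_chaining (g : R -> R) (s D x : R) : 0 < D -> 0 <= x -> continuous g ->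
  (forall m i : nat, (i < 2 ^ m)%N ->
     `|g (s + D * i.+1%:R / 2 ^+ m) - g (s + D * i%:R / 2 ^+ m)| <= x / 4 * (3 / 4) ^+ m) ->
  forall t, s <= t <= s + D -> `|g t - g s| <= x.
Proof.
move=> D0 x0 cg inc t /andP[st tD].
pose u := (t - s) / D; pose a m := Num.truncn (u * 2 ^+ m); pose p m : R := s + D * (a m)%:R / 2 ^+ m.
have u0 : 0 <= u by rewrite divr_ge0 ?subr_ge0// ltW.
have u1 : u <= 1 by rewrite ler_pdivrMr// mul1r lerBlDl.
have two m : 0 < 2 ^+ m :> R by rewrite exprn_gt0.
have aP m : (a m)%:R <= u * 2 ^+ m < (a m).+1%:R.
  by apply: truncn_itv; rewrite mulr_ge0// ltW.
have a_le m : (a m <= 2 ^ m)%N.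
  have /andP[h _] := aP m; rewrite -(ler_nat R) natrX (le_trans h)//.
  by rewrite ler_piMl// ltW.
have aS m : a m.+1 = (a m).*2 \/ a m.+1 = (a m).*2.+1.
  have /andP[h1 h2] := aP m; have /andP[h3 h4] := aP m.+1.
  have um := mulr_ge0 u0 (ltW (two m.+1)).
  have k1 : ((a m).*2 <= a m.+1)%N.
    by rewrite (truncn_ge_nat _ um) -mul2n natrM exprS mulrCA ler_pM2l.
  have k2 : (a m.+1 < (a m).+1.*2)%N.
    by rewrite (truncn_lt_nat _ um) -mul2n natrM exprS mulrCA ltr_pM2l.
  move: k2; rewrite doubleS ltnS leq_eqVlt ltnS => /orP[/eqP ->|k2]; [by right|left].
  by apply/eqP; rewrite eqn_leq k2.
have bound m : `|g (p m) - g s| <= x * (1 - (3 / 4) ^+ m.+1).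
  elim: m => [|m ih].
    (* At level 0 the approximation is the left end, or the right end when t = s + D. *)
    have /= := a_le 0%N; rewrite /p expn0; case: (a 0%N) => [_|[_|//]].
      by rewrite mulr0 mul0r addr0 subrr normr0 mulr_ge0// expr1; lra.
    have := inc 0%N 0%N isT; rewrite expr0 mulr0 mul0r addr0 => /le_trans; apply.
    by rewrite expr1 mulr1; lra.
  have dbl : s + D * (a m).*2%:R / 2 ^+ m.+1 = p m.
    by rewrite /p -mul2n natrM exprS; field; rewrite gt_eqF.
  have q0 : 0 <= (3 / 4 : R) ^+ m.+1 by rewrite exprn_ge0// divr_ge0.
  have xq : 0 <= x * (3 / 4) ^+ m.+1 by exact: mulr_ge0.
  case: (aS m) => E.
    rewrite {1}/p E dbl; apply: le_trans ih _; rewrite [in leRHS]exprS; move: xq; lra.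
  have h : ((a m).*2 < 2 ^ m.+1)%N by rewrite -E a_le.
  have := inc m.+1 _ h; rewrite dbl -E -/(p m.+1) => {}h.
  rewrite -(subrK (g (p m)) (g (p m.+1))) -addrA.
  apply: le_trans (ler_normD _ _) _; apply: le_trans (lerD h ih) _.
  by rewrite [in leRHS]exprS; move: xq; lra.
have close m : `|t - p m| <= D / 2 ^+ m.
  have /andP[h1 h2] := aP m.
  have -> : t - p m = D / 2 ^+ m * (u * 2 ^+ m - (a m)%:R).
    by rewrite /p /u; field; rewrite !gt_eqF.
  have D2 : 0 <= D / 2 ^+ m by rewrite divr_ge0 ?ltW.
  rewrite normrM (ger0_norm D2) ler_piMr// ger0_norm ?subr_ge0// lerBlDl.
  by rewrite natr1 ltW.
apply/ler_addgt0Pr => e e0.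
have /cvgrPdist_lt/(_ _ e0)[r /= r0 gr] := cg t.
pose m := (Num.truncn (D / r)).+1.
have Dm : D / 2 ^+ m < r.
  rewrite ltr_pdivrMr// mulrC -ltr_pdivrMr//.
  have /andP[_ h] := truncn_itv (divr_ge0 (ltW D0) (ltW r0)); apply: lt_le_trans h _.
  by rewrite -natrX ler_nat ltnW// ltn_expl.
have := gr (p m) (le_lt_trans (close m) Dm) => gtp.
rewrite (_ : g t - g s = (g (p m) - g s) + (g t - g (p m))); last by ring.
apply: le_trans (ler_normD _ _) _; apply: lerD; last exact: ltW.
apply: le_trans (bound m) _; rewrite ler_piMr// lerBlDr lerDl exprn_ge0// divr_ge0//.
Qed.

Context {d : measure_display} {Omega : measurableType d}.
Variable P : probability Omega R.

(** Bernoulli's inequality (9/8)^m >= 1 + m / 8 and q >= 16 give an extra factor exp(-2 m) <= 4^-m,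
    which beats the 2^m increments of level m. The right side is shaped for a geometric series. *)
Lemma dyadic_tail (q : R) m : 16 <= q ->
  (2 ^ m)%:R * (2 * expR (- (q * (9 / 8) ^+ m))) <= 4 * expR (- q) / (2 ^ m.+1)%:R.
Proof.
move=> q16; have bern : 1 + m%:R / 8 <= (9 / 8 : R) ^+ m.
  elim: m => [|m ih]; first by rewrite mul0r addr0 expr0.
  rewrite exprS -natr1; have m0 : 0 <= m%:R :> R by [].
  apply: (@le_trans _ _ (9 / 8 * (1 + m%:R / 8))); last by rewrite ler_pM2l.
  by move: m0; move: (m%:R) => y; lra.
have e4 : expR (- 2) <= 4^-1 :> R.
  rewrite expRN lef_pV2 ?posrE ?expR_gt0//.
  have : 1 + 1 <= expR 1 :> R by exact: expR_ge1Dx.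
  move=> h; rewrite (_ : 2 = 1 + 1 :> R)// expRD.
  by apply: (@le_trans _ _ ((1 + 1) * (1 + 1))); [lra|apply: ler_pM].
have h : expR (- (q * (9 / 8) ^+ m)) <= expR (- q) * (4^-1) ^+ m.
  apply: (@le_trans _ _ (expR (- q) * expR (- 2) ^+ m)); last first.
    by rewrite ler_pM2l ?expR_gt0// lerXn2r// nnegrE ?expR_ge0// invr_ge0.
  rewrite -expRM_natl -expRD ler_expR.
  have m0 : 0 <= m%:R :> R by [].
  have : q * (1 + m%:R / 8) <= q * (9 / 8) ^+ m by rewrite ler_pM2l//; lra.
  have : 16 * m%:R <= q * m%:R :> R by rewrite ler_wpM2r.
  by rewrite mulrDr mulr1 mulrA; lra.
have p0 : 0 < 2 ^+ m :> R by rewrite exprn_gt0.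
rewrite !natrX exprS; apply: (@le_trans _ _ (2 ^+ m * (2 * (expR (- q) * 4^-1 ^+ m)))).
  by rewrite ler_pM2l// ler_pM2l.
apply: eq_ler.
have -> : (4^-1 : R) ^+ m = (2 ^+ m)^-1 ^+ 2.
  have -> : (4 : R) = 2 ^+ 2 by rewrite -natrX.
  by rewrite !exprVn -!exprM mulnC.
by field; rewrite gt_eqF.
Qed.

(** The exceptional event involves dyadic increments only, hence is measurable. Continuity is asked
    of a function [g] agreeing with the path, since Brownian paths are continuous only almost
    surely. The constant 64 is 2 * 2 * 16: the doubled variance, the half lost in the tail bound
    with eps = 1/2, and the square of the 4 in the thresholds. *)
Lemma oscillation_tail : exists2 C : R, 0 < C &
  forall (X : R -> Omega -> R) (s D k x : R), standard_brownian_motion P X ->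
  0 <= s -> 0 < D -> 0 < k -> 0 < x ->
  exists E : set Omega, [/\ measurable E, (P E <= (C * expR (- (x ^+ 2 / (64 * k * D))))%:E)%E &
    forall w, ~ E w -> forall g : R -> R, continuous g ->
      (forall t, s <= t <= s + D -> g t = Num.sqrt k * X t w) ->
    forall t, s <= t <= s + D -> `|g t - g s| <= x].
Proof.
(* The term exp(16) makes the bound at least 1 when q < 16, where [dyadic_tail] does not apply. *)
exists (4 + expR 16); first by rewrite addr_gt0 ?expR_gt0.
move=> X s D k x hX s0 D0 k0 x0; set q := x ^+ 2 / _.
have [q16|q16] := ltP q 16.
  exists setT; split => //; last by move=> w /(_ I).
  apply: le_trans (probability_le1 P measurableT) _.
  rewrite lee_fin mulrDl -expRD; apply: (@le_trans _ _ (expR (16 - q))).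
    by rewrite -[leLHS]expR0 ler_expR subr_ge0 ltW.
  by rewrite lerDr mulr_ge0 ?expR_ge0.
pose y m : R := x / 4 * (3 / 4) ^+ m.
have y0 m : 0 <= y m by rewrite mulr_ge0 ?exprn_ge0 ?divr_ge0// ltW.
have [mX _ _ _ _] := hX.
pose tt m i : R := s + D * i%:R / 2 ^+ m.
have tt0 m i : 0 <= tt m i by rewrite addr_ge0// divr_ge0 ?exprn_ge0// mulr_ge0// ltW.
have tt_lt m i : tt m i < tt m i.+1.
  by rewrite /tt ltrD2l ltr_pM2r ?invr_gt0 ?exprn_gt0// ltr_pM2l// ltr_nat.
have ttB m i : tt m i.+1 - tt m i = D / 2 ^+ m.
  by rewrite /tt -natr1; ring.
pose A m i := [set w | y m <= `|Num.sqrt k * (X (tt m i.+1) w - X (tt m i) w)| ].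
have mA m i : measurable (A m i).
  have mf : measurable_fun setT (fun w => `|Num.sqrt k * (X (tt m i.+1) w - X (tt m i) w)|).
    apply: measurableT_comp => //; apply: measurable_funM => //; apply: measurable_funB; exact: mX.
  rewrite (_ : A m i = (fun w => `|Num.sqrt k * (X (tt m i.+1) w - X (tt m i) w)|) @^-1` `[y m, +oo[).
    by rewrite -[U in measurable U]setTI; exact: mf.
  by apply/seteqP; split => w /=; rewrite in_itv/= andbT.
pose Am m := \bigcup_(i : 'I_(2 ^ m)) A m i.
have mAm m : measurable (Am m) by apply: fin_bigcup_measurable.
have PAm m : (P (Am m) <= (4 * expR (- q) / (2 ^ m.+1)%:R)%:E)%E.
  apply: le_trans (measure_le_sum (p := xpredT) P (fun i : 'I_(2 ^ m) => mA m i) (mAm m) _) _.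
    by move=> w [i _ Aw]; exists i.
  apply: (@le_trans _ _ (\sum_(i < 2 ^ m) (2 * expR (- (q * (9 / 8) ^+ m)))%:E)%E).
    apply: lee_sum => i _; have half0 : 0 < 2^-1 :> R by [].
    have half1 : 2^-1 <= 1 :> R by lra.
    apply: le_trans (increment_tail hX (tt0 m i) (tt_lt m i) k0 (y0 m) half0 half1) _.
    rewrite lee_fin; apply: ler_pM; rewrite ?expR_ge0 ?invr_ge0 ?sqrtr_ge0//.
      rewrite -[leRHS]invrK lef_pV2 ?posrE ?sqrtr_gt0//.
      rewrite -[leLHS](ger0_norm (ltW half0)) -sqrtr_sqr ler_wsqrtr// expr2 ler_piMr//.
    have yE : y m ^+ 2 = x ^+ 2 / 16 * ((9 / 8) ^+ m / 2 ^+ m).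
      have -> : y m ^+ 2 = (x / 4) ^+ 2 * ((3 / 4) ^+ 2) ^+ m by rewrite exprMn -!exprM mulnC.
      rewrite -exprVn -exprMn (_ : (3 / 4) ^+ 2 = 9 / 8 / 2 :> R); last by field.
      by congr (_ * _); field.
    rewrite ttB yE ler_expR lerN2 /q; apply: eq_ler.
    have two0 : 2 ^+ m != 0 :> R by rewrite gt_eqF// exprn_gt0.
    by move: ((9 / 8) ^+ m) => z; field; rewrite two0 !gt_eqF.
  rewrite sumEFin lee_fin; apply: le_trans (dyadic_tail m q16).
  by rewrite sumr_const card_ord [leRHS]mulr_natl.
exists (\bigcup_m Am m); split.
- exact: bigcup_measurable.
- apply: (@le_trans _ _ (4 * expR (- q))%:E); last first.
    by rewrite lee_fin ler_pM2r ?expR_gt0// lerDl expR_ge0.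
  apply: le_trans (@measure_sigma_subadditive _ _ _ P _ _ mAm _ (@subset_refl _ _)) _.
    exact: bigcup_measurable.
  apply: le_trans (epsilon_trick0 xpredT _); last by rewrite mulr_ge0// expR_ge0.
  by apply: lee_nneseries => // m _; exact: PAm.
- move=> w Ew g cg gX t tD; apply: (@dyadic_chaining g s D x) => //; first exact: ltW.
  move=> m i im; rewrite -/(tt m i) -/(tt m i.+1).
  have ttD i' : (i' <= 2 ^ m)%N -> s <= tt m i' <= s + D.
    move=> im'; rewrite /tt lerDl lerD2l divr_ge0 ?mulr_ge0 ?exprn_ge0 ?(ltW D0)//=.
    by rewrite ler_pdivrMr ?exprn_gt0// ler_pM2l// -natrX ler_nat.
  rewrite !gX ?ttD// 1?ltnW// -mulrBr; apply/ltW; rewrite ltNge; apply/negP => h.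
  by apply: Ew; exists m => //; exists (Ordinal im).
Qed.

Variables (n : nat) (T : R).
Variable B : 'I_n -> R -> Omega -> R.
Hypothesis T0 : 0 < T.
Hypothesis hB : forall j, standard_brownian_motion P (B j).

Lemma grid_oscillation : exists2 C : R, 0 < C & forall (N : nat) (k x : R),
  (0 < N)%N -> 0 < k -> 0 < x ->
  exists E : set Omega, [/\ measurable E,
    (P E <= (N%:R * n%:R * C * expR (- (x ^+ 2 * N%:R / (64 * T) / k)))%:E)%E &
    forall w, ~ E w -> forall W : 'I_n -> R -> R, (forall j, continuous (W j)) ->
      (forall j t, 0 <= t <= T -> W j t = Num.sqrt k * B j t w) ->
    forall (i : 'I_N) j t, T / N%:R * i%:R <= t -> t <= T / N%:R * i.+1%:R ->
      `|W j t - W j (T / N%:R * i%:R)| <= x].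
Proof.
have [C C0 H] := oscillation_tail; exists C => // N k x N0 k0 x0.
have N0' : 0 < N%:R :> R by rewrite ltr0n.
have dt0 : 0 < T / N%:R by exact: divr_gt0.
set dt := T / N%:R in dt0 *.
have s0 (i : nat) : 0 <= dt * i%:R by rewrite mulr_ge0// ltW.
have /choice[E EH] (ij : 'I_N * 'I_n) := H (B ij.2) (dt * ij.1%:R) dt k x (hB ij.2) (s0 _) dt0 k0 x0.
have mE ij : measurable (E ij) by have [] := EH ij.
have mU : measurable (\bigcup_ij E ij) by apply: fin_bigcup_measurable.
exists (\bigcup_ij E ij); split => //.
  apply: le_trans (measure_le_sum (p := xpredT) P mE mU _) _; first by move=> w [ij _ Ew]; exists ij.
  apply: (@le_trans _ _ (\sum_(ij : 'I_N * 'I_n) (C * expR (- (x ^+ 2 * N%:R / (64 * T) / k)))%:E)%E).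
    apply: lee_sum => ij _; have [_ + _] := EH ij; move/le_trans; apply.
    rewrite lee_fin; apply: eq_ler; congr (_ * expR (- _)).
    by rewrite /dt; field; rewrite !gt_eqF.
  set K := C * expR _; rewrite sumEFin lee_fin sumr_const card_prod !card_ord.
  by rewrite (_ : _ * C * _ = K *+ (N * n))// /K -[RHS]mulr_natl natrM; ring.
move=> w Ew W cW WE i j t it ti; have [_ _ /(_ w) K] := EH (i, j).
have dtS : dt * i.+1%:R = dt * i%:R + dt by rewrite -natr1 mulrDr mulr1.
apply: K (cW j) _ _ _ => [Eij|r /andP[ir ri]|]; first by apply: Ew; exists (i, j).
  apply: WE; rewrite (le_trans _ ir)//= (le_trans ri)// -dtS.
  rewrite -[leRHS](@divfK _ N%:R) ?gt_eqF// ler_pM2l// ler_nat; exact: ltn_ord.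
by rewrite it -dtS.
Qed.

End chaining.

(** * Measurability of events *)

Section path_measurability.
Context {R : realType} {d : measure_display} {Omega : measurableType d}.
Variables (T : R) (n : nat) (omega : Omega -> path_space T n).
Hypothesis T0 : 0 < T.
Hypothesis momega : forall (t : R) j (A : set R), 0 <= t <= T -> measurable A ->
  measurable [set w | A (path_coord (omega w) j t)].
Implicit Types f g : path_space T n.

(** Given by a grid size and rational data, so there are countably many; closed inequalities can be
    tested at rational times. *)
Definition tube (N : nat) (q : {ffun 'I_N * 'I_n -> rat}) (r : rat) : set (path_space T n) :=
  [set f | forall (i : 'I_N) (j : 'I_n) (t : R), T / N%:R * i%:R <= t -> t <= T / N%:R * i.+1%:R ->
     `|path_coord f j t - ratr (q (i, j))| <= ratr r].

Let cell_le (N : nat) (i : 'I_N) : T / N%:R * i%:R <= T / N%:R * i.+1%:R.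
Proof. by rewrite ler_wpM2l ?ler_nat// divr_ge0// ltW. Qed.

Let cellT (N : nat) (i : 'I_N) (t : R) : T / N%:R * i%:R <= t -> t <= T / N%:R * i.+1%:R -> 0 <= t <= T.
Proof.
have N0 : 0 < N%:R :> R by rewrite ltr0n (leq_trans _ (ltn_ord i)).
move=> it ti; rewrite (le_trans _ it) ?mulr_ge0 ?divr_ge0 ?(ltW T0)//=.
apply: (le_trans ti); rewrite -[leRHS](@divfK _ N%:R) ?gt_eqF// ler_pM2l ?divr_gt0// ler_nat.
exact: ltn_ord.
Qed.

(** A strict violation at some time persists on a neighbourhood, hence at a rational time; clipping
    keeps the tested times inside the cell. *)
Lemma tube_rational N (q : {ffun 'I_N * 'I_n -> rat}) r f : tube q r f <->
  forall x : 'I_N * 'I_n * rat, `|path_coord f x.1.2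
    (clip (T / N%:R * x.1.1%:R) (T / N%:R * x.1.1.+1%:R) (ratr x.2)) - ratr (q x.1)| <= ratr r.
Proof.
split=> [H [[i j] p] /=|H i j t it ti].
  by have /andP[h1 h2] := clip_bnd (ratr p : R) (cell_le i); exact: H.
set a := T / N%:R * i%:R in it; set b := T / N%:R * i.+1%:R in ti.
rewrite leNgt; apply/negP => rt.
pose g (s : R) := `|path_ext f j (clip a b s) - ratr (q (i, j))|.
have cab s : 0 <= clip a b s <= T by have /andP[? ?] := clip_bnd s (cell_le i); exact: (@cellT N i).
have gt : ratr r < g t by rewrite /g path_ext_id// clip_id.
have cg : continuous g.
  move=> s; apply: cvg_norm; apply: cvgB; last exact: cvg_cst.
  exact: (continuous_comp (@clip_continuous _ a b s) ((path_ext_chamber (ltW T0) f).1 j _)).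
have [e /= e0 He] := cvgr_gt _ (cg t) _ gt.
have [p] : exists p : rat, ratr p \in `]t, (t + e)[ by apply: rat_in_itvoo; rewrite ltrDl.
rewrite in_itv/= => /andP[tp pe]; have := He (ratr p); rewrite /= ltr0_norm ?subr_lt0// opprB ltrBlDl.
by move=> /(_ pe); rewrite ltNge /g path_ext_id// (H (i, j, p)).
Qed.

Lemma tube_measurable N (q : {ffun 'I_N * 'I_n -> rat}) r : measurable (omega @^-1` tube q r).
Proof.
pose c (x : 'I_N * 'I_n * rat) : R := clip (T / N%:R * x.1.1%:R) (T / N%:R * x.1.1.+1%:R) (ratr x.2).
have cT x : 0 <= c x <= T.
  by have /andP[? ?] := clip_bnd (ratr x.2 : R) (cell_le x.1.1); exact: (@cellT N x.1.1).
pose A (x : 'I_N * 'I_n * rat) := [set y : R | `|y - ratr (q x.1)| <= ratr r].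
have mA x : measurable (A x).
  rewrite /A (_ : [set y | _] = `[ratr (q x.1) - ratr r, ratr (q x.1) + ratr r]%classic)//.
  by apply/seteqP; split => y /=; rewrite in_itv/= ler_distl.
rewrite (_ : _ @^-1` _ = ~` \bigcup_x ~` [set w | A x (path_coord (omega w) x.1.2 (c x))]).
  apply: measurableC; apply: countable_bigcupT_measurable => [|x]; first exact: countableP.
  by apply: measurableC; exact: momega.
rewrite -setC_bigcap setCK; apply/seteqP; split => w /=.
  by move=> /tube_rational H x _; exact: H.
by move=> H; apply/tube_rational => x; exact: H.
Qed.

Lemma tube_basis (O : set (path_space T n)) f : open O -> O f ->
  exists N, exists q : {ffun 'I_N * 'I_n -> rat}, exists r, tube q r f /\ tube q r `<=` O.
Proof.
move=> oO Of; have [e e0 eO] := path_ball_nbhs (open_nbhs_nbhs (conj oO Of)).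
have [r] : exists r : rat, ratr r \in `]0, e / 2[ by apply: rat_in_itvoo; rewrite divr_gt0.
rewrite in_itv/= => /andP[r0 re]; have r2 : 0 < (ratr r : R) / 2 by rewrite divr_gt0.
have [cf _] := path_ext_chamber (ltW T0) f.
have : \forall dl \near 0^'+, forall j (s t : R), 0 <= s <= T -> `|s - t| < dl ->
    `|path_ext f j s - path_ext f j t| < ratr r / 2.
  apply: filter_forall => j; have [dl dl0 H] := @continuous_uniform_itv R (path_ext f j) 0 T _ (cf j) r2.
  near=> dl' => s t sT st; apply: H => //; apply: lt_le_trans st _.
  by near: dl'; exact: nbhs_right_le.
case=> dl /= dl0 dlH.
have {dlH} osc (j : 'I_n) (s t : R) : 0 <= s <= T -> `|s - t| < dl / 2 ->
    `|path_ext f j s - path_ext f j t| < ratr r / 2.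
  apply: (dlH (dl / 2)); last by rewrite divr_gt0.
  by rewrite /= sub0r normrN gtr0_norm ?divr_gt0// ltr_pdivrMr// ltr_pMr// ltr1n.
have dl2 : 0 < dl / 2 by rewrite divr_gt0.
pose N := (Num.truncn (T / (dl / 2))).+1.
(* On such a cell the path varies by less than r / 2, and the rational centre is within r / 2 of its
   value at the left end, so the tube contains [f]; any two of its members differ by at most 2 r <
   e. *)
have dtd : T / N%:R < dl / 2.
  by rewrite ltr_pdivrMr// mulrC -ltr_pdivrMr//; have /andP[] := truncn_itv (divr_ge0 (ltW T0) (ltW dl2)).
have /choice[q qH] (ij : 'I_N * 'I_n) : exists q : rat, ratr q \in
    `](path_coord f ij.2 (T / N%:R * ij.1%:R)), (path_coord f ij.2 (T / N%:R * ij.1%:R) + ratr r / 2)[.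
  by apply: rat_in_itvoo; rewrite ltrDl.
exists N, (finfun q), r; have tf : tube (finfun q) r f.
  move=> i j t it ti; have iT : 0 <= T / N%:R * i%:R <= T by apply: (cellT (lexx _)); exact: cell_le.
  have tT := cellT it ti.
  have := qH (i, j); rewrite ffunE in_itv/= => /andP[q1 q2].
  have td : `|T / N%:R * i%:R - t| < dl / 2.
    rewrite distrC ger0_norm ?subr_ge0//; apply: le_lt_trans dtd.
    by move: ti; rewrite -natr1 mulrDr mulr1 lerBlDl.
  have := osc j _ t iT td; rewrite !path_ext_id// ltr_norml => /andP[? ?].
  rewrite ler_norml; apply/andP; split; lra.
split=> // g tg; apply: eO => t j tT.
have [i it ti] := grid_cell T0 (isT : (0 < N)%N) tT.
have := tf i j t it ti; have := tg i j t it ti; rewrite !ler_norml ltr_norml => /andP[? ?] /andP[? ?].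
apply/andP; split; lra.
Unshelve. all: by end_near. Qed.

(** Adaptedness gives measurability of single coordinates only. An open set is the union of the
    countably many tubes it contains. *)
Lemma open_preimage_measurable (O : set (path_space T n)) : open O -> measurable (omega @^-1` O).
Proof.
move=> oO.
pose F (u : {N : nat & {ffun 'I_N * 'I_n -> rat}} * rat) :=
  if `[< tube (tagged u.1) u.2 `<=` O >] then omega @^-1` tube (tagged u.1) u.2 else set0.
rewrite (_ : _ @^-1` O = \bigcup_u F u).
  apply: countable_bigcupT_measurable => [|u]; first exact: countableP.
  by rewrite /F; case: asboolP => // _; exact: tube_measurable.
apply/seteqP; split => w /=.
  move=> /(tube_basis oO)[N [q [r [qw qO]]]]; exists (existT (fun N => {ffun 'I_N * 'I_n -> rat}) N q, r) => //.
  by rewrite /F; case: asboolP.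
by case=> u _; rewrite /F; case: asboolP => // uO; exact: uO.
Qed.

End path_measurability.

Section adaptedness.
Context {R : realType} {d : measure_display} {Omega : measurableType d}.
Variable P : probability Omega R.

Lemma augmented_filtration_measurable n (B : 'I_n -> R -> Omega -> R) (t : R) :
  (forall j, standard_brownian_motion P (B j)) -> augmented_filtration P B t `<=` measurable.
Proof.
move=> hB; apply: smallest_sub; first exact: sigma_algebra_measurable.
move=> E [[j [s]]|[]//]; rewrite /= in_itv/= => /andP[s0 _] [A mA ->].
have [mB _ _ _ _] := hB j.
by rewrite -[X in measurable X]setTI; exact: mB.
Qed.

End adaptedness.

(** * Large deviations *)

Section exponential_scale.
Context {R : realType}.
Implicit Types (p : R -> \bar R) (C b del : R).

Lemma exp_scale_near (C e : R) : 0 < e -> exists2 del : R, 0 < del &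
  forall k : R, 0 < k -> k < del -> k * `|ln C| <= e.
Proof.
move=> e0; have c0 : 0 < `|ln C| + 1 by rewrite ltr_wpDl.
exists (e / (`|ln C| + 1)); first exact: divr_gt0.
move=> k k0; rewrite ltr_pdivlMr// => /ltW; apply: le_trans.
by rewrite ler_pM2l// lerDl.
Qed.

(** k ln (C exp(- b / k)) = k ln C - b, and k ln C vanishes in the limit: constants independent of
    [k] are free. *)
Lemma limf_esup_exp p C b : 0 < C -> (forall k : R, 0 < k <= 4 -> (0 <= p k)%E) ->
  (forall k : R, 0 < k <= 4 -> (p k <= (C * expR (- (b / k)))%:E)%E) ->
  (limf_esup (fun k : R => k%:E * lne (p k)) 0^'+ <= (- b)%:E)%E.
Proof.
move=> C0 p0 pC; apply/lee_addgt0Pr => e e0; have [del del0 H] := exp_scale_near C e0.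
have m0 : 0 < Num.min 4 del by rewrite lt_min del0 andbT.
apply: le_trans (ereal_inf_lbound _) _.
  exists [set k : R | 0 < k < Num.min 4 del] => //.
  by near=> k => /=; apply/andP; split; near: k; [exact: nbhs_right_gt|exact: nbhs_right_lt].
apply: ge_ereal_sup => y /= [k /andP[k0]]; rewrite lt_min => /andP[k4 kd] <-.
have k04 : 0 < k <= 4 by rewrite k0 ltW.
have E0 : 0 < C * expR (- (b / k)) by rewrite mulr_gt0// expR_gt0.
have h : (lne (p k) <= (ln C - b / k)%:E)%E.
  have -> : ln C - b / k = ln (C * expR (- (b / k))) by rewrite lnM ?posrE ?expR_gt0// expRK.
  rewrite -lne_EFin// lee_lne ?pC// in_itv/= leey ?p0//.
  by rewrite lee_fin ltW.
apply: le_trans (lee_wpmul2l _ h) _; first by rewrite lee_fin ltW.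
rewrite -EFinM -EFinD lee_fin mulrBr mulrCA divff ?gt_eqF// mulr1.
have := H k k0 kd; have : k * ln C <= k * `|ln C| by rewrite ler_pM2l// ler_norm.
by lra.
Unshelve. all: by end_near. Qed.

Lemma limf_einf_exp p C b del : 0 < C -> 0 < del ->
  (forall k : R, 0 < k -> k < del -> ((C * expR (- (b / k)))%:E <= p k)%E) ->
  ((- b)%:E <= limf_einf (fun k : R => k%:E * lne (p k)) 0^'+)%E.
Proof.
move=> C0 del0 pC; rewrite EFinN leeNl -limf_esupN.
apply/lee_addgt0Pr => e e0; have [del' del'0 H] := exp_scale_near C e0.
have m0 : 0 < Num.min del del' by rewrite lt_min del0.
apply: le_trans (ereal_inf_lbound _) _.
  exists [set k : R | 0 < k < Num.min del del'] => //.
  by near=> k => /=; apply/andP; split; near: k; [exact: nbhs_right_gt|exact: nbhs_right_lt].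
apply: ge_ereal_sup => y /= [k /andP[k0]]; rewrite lt_min => /andP[kd kd'] <-.
have E0 : 0 < C * expR (- (b / k)) by rewrite mulr_gt0// expR_gt0.
have h : ((ln C - b / k)%:E <= lne (p k))%E.
  have -> : ln C - b / k = ln (C * expR (- (b / k))) by rewrite lnM ?posrE ?expR_gt0// expRK.
  rewrite -lne_EFin// lee_lne ?pC// in_itv/= leey ?lee_fin ?(ltW E0)//.
  by rewrite (le_trans _ (pC k k0 kd))// lee_fin ltW.
rewrite leeNl; apply: le_trans (lee_wpmul2l _ h); last by rewrite lee_fin ltW.
rewrite -EFinM -EFinD -EFinN lee_fin mulrBr mulrCA divff ?gt_eqF// mulr1.
have := H k k0 kd'; have : k * (- ln C) <= k * `|ln C| by rewrite ler_pM2l// -normrN ler_norm.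
by rewrite mulrN; lra.
Unshelve. all: by end_near. Qed.

(** An exponent larger by 1 gains exp(-1/k) <= k, enough to absorb an error term into half of the
    main one. *)
Lemma expR_inv_le (k : R) : 0 < k -> expR (- k^-1) <= k.
Proof.
move=> k0; rewrite expRN -[leRHS]invrK lef_pV2 ?posrE ?expR_gt0 ?invr_gt0//.
by apply: le_trans (expR_ge1Dx _); rewrite lerDr.
Qed.

End exponential_scale.

Section dyson_ldp.
Context {R : realType} (mu T : R) (n : nat) (theta : 'rV[R]_n).
Hypothesis T0 : 0 < T.
Context {d : measure_display} {Omega : measurableType d}.
Variables (P : probability Omega R) (B : 'I_n -> R -> Omega -> R).
Hypothesis hB : forall j, standard_brownian_motion P (B j).
Hypothesis hBindep : independent_processes P B.
Variable omega : R -> Omega -> path_space T n.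
Hypothesis homega : forall k : R, 0 < k <= 4 -> dyson_strong_solution mu theta P B k (omega k).
Local Notation lam := (@lebesgue_measure R).
Local Notation level M := [set f : path_space T n | (dyson_rate mu theta f <= M%:E)%E].

Lemma solution_preimage_measurable (k : R) (O : set (path_space T n)) : 0 < k <= 4 -> open O ->
  measurable (omega k @^-1` O).
Proof.
move=> k4 oO; apply: open_preimage_measurable => // t j A tT mA.
by apply: (augmented_filtration_measurable hB); have [+ _] := homega k4; apply.
Qed.

Lemma within_continuous_clip (g : R -> R) : {within `[0, +oo[, continuous g} ->
  continuous (fun t => g (clip 0 T t)).
Proof.
move=> /subspace_continuousP cg t.
have ct s : `[0, +oo[%classic (clip 0 T s).
  by rewrite /= in_itv/= andbT; have /andP[] := clip_bnd s (ltW T0).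
apply/cvgrPdist_lt => e e0; have /cvgrPdist_lt/(_ _ e0) H := cg _ (ct t).
have K : \forall s \near t, `[0, +oo[%classic (clip 0 T s) -> `|g (clip 0 T t) - g (clip 0 T s)| < e.
  exact: (@clip_continuous _ 0 T t _ H).
by near=> s; apply: (near K s) => //; exact: ct.
Unshelve. all: by end_near.
Qed.

(** One null event gathers the almost sure properties. Off it, the clipped driver is continuous on
    the line, and the equation says that the noise of the path is [theta] plus the driver. *)
Lemma solution_driver (k : R) : 0 < k <= 4 -> exists E : set Omega, [/\ measurable E, P E = 0%E &
  forall w, ~ E w -> exists W : 'I_n -> R -> R,
    [/\ forall j, continuous (W j), forall j, W j 0 = 0,
        forall j t, 0 <= t <= T -> W j t = Num.sqrt k * B j t w,
        forall j, path_coord (omega k w) j 0 = theta ord0 j &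
        forall j t, 0 <= t <= T -> noise mu (path_ext (omega k w)) j t = theta ord0 j + W j t] ].
Proof.
move=> k4; have [_ sol] := homega k4.
have B0 : {ae P, forall w, forall j, B j 0 w = 0}.
  by apply: filter_forall => j; have [] := hB j.
have cB : {ae P, forall w, forall j, {within `[0, +oo[, continuous (fun t => B j t w)}}.
  by apply: filter_forall => j; have [] := hB j.
have [E [mE PE EH]] : {ae P, forall w, [/\ forall j, B j 0 w = 0,
    forall j, {within `[0, +oo[, continuous (fun t => B j t w)} &
    forall t, 0 <= t <= T -> forall j : 'I_n,
     path_coord (omega k w) j t = theta ord0 j + Num.sqrt k * B j t w +
       \int[lam]_(s in `[0, t]) drift mu (fun i => path_coord (omega k w) i s) j] }.
  by apply: filterS3 B0 cB sol.
exists E; split => // w Ew.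
have [w0 wc ws] : [/\ forall j, B j 0 w = 0,
    forall j, {within `[0, +oo[, continuous (fun t => B j t w)} &
    forall t, 0 <= t <= T -> forall j : 'I_n,
     path_coord (omega k w) j t = theta ord0 j + Num.sqrt k * B j t w +
       \int[lam]_(s in `[0, t]) drift mu (fun i => path_coord (omega k w) i s) j].
  by apply: contrapT => nw; apply: Ew; exact: EH.
exists (fun j t => Num.sqrt k * B j (clip 0 T t) w).
have c0 : clip 0 T 0 = 0 by rewrite clip_id// ltW.
have T00 : 0 <= (0 : R) <= T by rewrite lexx ltW.
split.
- by move=> j t; apply: cvgMr; exact: (within_continuous_clip (wc j)).
- by move=> j; rewrite c0 w0 mulr0.
- by move=> j t /andP[t0 tT]; rewrite clip_id.
- by move=> j; rewrite ws// w0 set_itv1 Rintegral_set1 mulr0 !addr0.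
- move=> j t /andP[t0 tT]; rewrite /noise path_ext_id ?t0// ws ?t0// clip_id//.
  rewrite [X in _ - X](_ : _ = \int[lam]_(s in `[0, t]) drift mu (fun i => path_coord (omega k w) i s) j).
    by rewrite addrK.
  apply: eq_Rintegral => s; rewrite inE/= in_itv/= => /andP[s0 st]; rewrite /drift_along.
  by congr (drift _ _ _); apply/funext => i; rewrite path_ext_id// s0 (le_trans st).
Qed.

(** Off the three exceptional events, the interpolated driver has energy at most [a] and is close to
    the true one, so [near_level] puts the path near the level a', which the gap forbids to members
    of [F]. The intermediate b < a < a' pays for the losses of the energy tail and of
    [near_level]. *)
Lemma ldp_upper_level (F : set (path_space T n)) a' b : closed F ->
  (forall f, F f -> ~ level a' f) -> b < a' ->
  (limf_esup (fun k : R => k%:E * lne (P (omega k @^-1` F))) 0^'+ <= (- b)%:E)%E.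
Proof.
move=> cF Fa' ba'.
have mF k : 0 < k <= 4 -> measurable (omega k @^-1` F).
  move=> k4; rewrite -[F]setCK preimage_setC; apply: measurableC.
  exact: (solution_preimage_measurable k4 (closed_openC cF)).
have [b0|b0] := ltP b 0.
  apply: (@limf_esup_exp _ _ 1) => // k k4; apply: le_trans (probability_le1 P (mF k k4)) _.
  rewrite mul1r lee_fin -[leLHS]expR0 ler_expR oppr_ge0.
  by have /andP[k0 _] := k4; rewrite ler_pdivrMr// mul0r ltW.
pose a := (b + a') / 2; have ba : b < a by rewrite /a; lra.
have aa' : a < a' by rewrite /a; lra.
have a0 : 0 < a by exact: le_lt_trans ba.
(* From 2 eps a = a - b it follows that (1 - eps)^2 a >= b. *)
pose eps := (a - b) / (2 * a).
have a20 : 0 < 2 * a by rewrite mulr_gt0.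
have eps0 : 0 < eps by rewrite divr_gt0// subr_gt0.
have eps1 : eps < 1 by rewrite ltr_pdivrMr// mul1r; lra.
have epsb : b <= (1 - eps) ^+ 2 * a.
  have : eps * (2 * a) = a - b by rewrite /eps divfK// gt_eqF.
  have : 0 <= eps ^+ 2 * a by rewrite mulr_ge0 ?sqr_ge0// ltW.
  by move=> h1 h2; rewrite (_ : (1 - eps) ^+ 2 * a = a - eps * (2 * a) + eps ^+ 2 * a); [lra|ring].
have [e e0 gap] := level_closed_gap T0 cF Fa'.
have [dl dl0 near_a'] := near_level mu theta T0 aa' e0.
have [C1 C10 osc] := grid_oscillation T0 hB.
(* The interpolation error is twice the oscillation on a cell. *)
pose x := dl / 2; have x0 : 0 < x by exact: divr_gt0.
(* Large enough for the exponent of the oscillation event to be at least [b]. *)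
pose N := (Num.truncn (64 * T * b / x ^+ 2)).+1.
have x20 : 0 < x ^+ 2 by rewrite exprn_gt0.
have T64 : 0 < 64 * T by rewrite mulr_gt0.
have Nb : b <= x ^+ 2 * N%:R / (64 * T).
  rewrite ler_pdivlMr// mulrC [leRHS]mulrC -ler_pdivrMr//.
  have K0 : 0 <= 64 * T * b / x ^+ 2 by rewrite divr_ge0 ?(ltW x20)// mulr_ge0// ltW.
  by have /andP[_ /ltW] := truncn_itv K0.
have N0 : (0 < N)%N by [].
have [C2 C20 enr] := grid_energy_tail T0 N0 hB hBindep eps0 eps1.
pose C := N%:R * n%:R * C1 + C2.
have NC0 : 0 <= N%:R * n%:R * C1 by rewrite !mulr_ge0// ltW.
apply: (@limf_esup_exp _ _ C) => [|//|k k4]; first by rewrite ltr_wpDl.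
have /andP[k0 _] := k4.
have [E1 [mE1 PE1 E1H]] := solution_driver k4.
have [E2 [mE2 PE2 E2H]] := osc N k x N0 k0 x0.
have [] := enr k a k0 a0; set E3 := [set w | _] => mE3 PE3.
apply: (@le_trans _ _ (P (E1 `|` (E2 `|` E3)))).
  apply: le_measure; rewrite ?inE; [exact: mF|by do 2?apply: measurableU|].
  move=> w Fw; apply: contrapT => /not_orP[nE1 /not_orP[nE2 nE3]].
  have [W [cW W0 WB f0 fW]] := E1H w nE1.
  have WN (i : nat) j : (i <= N)%N -> W j (T / N%:R * i%:R) = Num.sqrt k * B j (T / N%:R * i%:R) w.
    move=> iN; apply: WB; rewrite mulr_ge0 ?divr_ge0 ?(ltW T0)//=.
    have N0' : 0 < N%:R :> R by [].
    by rewrite -[leRHS](@divfK _ N%:R) ?gt_eqF// ler_pM2l ?divr_gt0// ler_nat.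
  have Wen : energy_le T (interpolate T N W) a.
    apply: (interpolate_energy T0 N0).
    rewrite leNgt; apply/negP => h; apply: nE3; rewrite /E3 /=.
    apply: lt_le_trans h _; apply: eq_ler.
    apply: eq_bigr => i _; apply: eq_bigr => j _; rewrite /increment !WN ?mulrBr//.
    exact: ltnW.
  have close := interpolate_close T0 N0 W0 (E2H w nE2 W cW WB).
  have [|g ga' fg] := near_a' (omega k w) _ (@interpolate_continuous _ T _ N W)
    (@interpolate0 _ T _ N W) Wen f0.
    move=> j t tT; rewrite fW// (_ : _ - _ = W j t - interpolate T N W j t); last by ring.
    by apply: le_trans (close j t tT) _; rewrite /x mulrC divfK.
  exact: (gap _ _ Fw ga' fg).
apply: (@le_trans _ _ (P E1 + P (E2 `|` E3))%E); first by apply: measureU2 => //; exact: measurableU.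
rewrite PE1 add0e; apply: (@le_trans _ _ (P E2 + P E3)%E); first exact: measureU2.
apply: le_trans (leeD PE2 PE3) _; rewrite -EFinD lee_fin /C [leRHS]mulrDl.
have mono y : b <= y -> expR (- (y / k)) <= expR (- (b / k)).
  by move=> yb; rewrite ler_expR lerN2 ler_pM2r ?invr_gt0.
by apply: lerD; [apply: ler_wpM2l => //; exact: mono|rewrite ler_pM2l//; exact: mono].
Qed.

(** On the event [G] that the grid increments follow those of [h], the path can miss [O] only
    through the null event or a large oscillation. The exponent of the latter is made M + e + 1,
    against M + e for [G], so the subtraction costs only a constant factor. *)
Lemma ldp_lower_level (O : set (path_space T n)) f M e : open O -> O f -> level M f -> 0 < e ->
  ((- (M + e))%:E <= limf_einf (fun k : R => k%:E * lne (P (omega k @^-1` O))) 0^'+)%E.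
Proof.
move=> oO Of fM e0; have [r r0 rO] := path_ball_nbhs (open_nbhs_nbhs (conj oO Of)).
have [dl dl0 stab] := level_stability T0 fM r0.
have [f0 fen] := (dyson_rate_leP mu theta T0 f M).1 fM.
set h := noise mu (path_ext f) in fen stab.
have M0 := energy_le_ge0 fen.
have h0 j : h j 0 = theta ord0 j.
  by rewrite /h /noise set_itv1 Rintegral_set1 subr0 path_ext_id ?f0// lexx ltW.
have [C1 C10 osc] := grid_oscillation T0 hB.
(* Three errors: the oscillations of the driver and of [h] on a cell, and the accumulated error at
   the grid points. *)
pose x := dl / 3; have x0 : 0 < x by exact: divr_gt0.
have x20 : 0 < x ^+ 2 by rewrite exprn_gt0.
have T64 : 0 < 64 * T by rewrite mulr_gt0.
have Me0 : 0 < M + e + 1 by rewrite addr_gt0// ltr_wpDl.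
(* The first term gives the oscillation event the exponent M + e + 1; the second makes [h], whose
   squared increment is at most 2 M times the length, vary by at most [x] on a cell. *)
pose K := (64 * T * (M + e + 1) + 2 * M * T) / x ^+ 2.
have MT : 0 <= 2 * M * T by rewrite !mulr_ge0// ltW.
have K0 : 0 <= K.
  by rewrite divr_ge0 ?(ltW x20)// addr_ge0// mulr_ge0 ?(ltW T64) ?(ltW Me0).
pose N := (Num.truncn K).+1.
have N0 : (0 < N)%N by [].
have N0' : 0 < N%:R :> R by [].
have KN : 64 * T * (M + e + 1) + 2 * M * T <= N%:R * x ^+ 2.
  by rewrite -ler_pdivrMr//; have /andP[_ /ltW] := truncn_itv K0.
have NMe : M + e + 1 <= x ^+ 2 * N%:R / (64 * T).
  by rewrite ler_pdivlMr// mulrC [leRHS]mulrC; apply: le_trans KN; rewrite lerDl.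
pose dt := T / N%:R; have dt0 : 0 < dt by exact: divr_gt0.
have grid_ge0 (i : nat) : 0 <= dt * i%:R by rewrite mulr_ge0// ltW.
have gridS (i : nat) : dt * i.+1%:R = dt * i%:R + dt by rewrite -natr1 mulrDr mulr1.
have gridT (i : nat) : (i <= N)%N -> dt * i%:R <= T.
  by move=> iN; rewrite -[leRHS](@divfK _ N%:R) ?gt_eqF// ler_pM2l// ler_nat.
have h_osc j (s t : R) : 0 <= s -> s <= t -> t <= T -> t - s <= dt -> `|h j t - h j s| <= x.
  move=> s0 st tT tsd; rewrite -(@ler_pXn2r _ 2)// ?nnegrE ?(ltW x0)// real_normK ?num_real//.
  apply: le_trans (energy_le_increment j fen s0 st tT) _.
  apply: (@le_trans _ _ (2 * M * dt)); first by rewrite ler_wpM2l// mulr_ge0.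
  rewrite /dt mulrA ler_pdivrMr// [leRHS]mulrC; apply: le_trans KN; rewrite lerDr.
  by rewrite mulr_ge0 ?(ltW T64) ?(ltW Me0).
pose c (i : nat) j := h j (dt * i.+1%:R) - h j (dt * i%:R).
have cx (i : 'I_N) j : `|c i j| <= x.
  apply: h_osc => //; [by rewrite gridS lerDl ltW|exact: gridT|by rewrite gridS addrAC subrr add0r].
pose Q := N%:R * n%:R * (2 * x + 1) / (2 * dt).
have dt20 : 0 < 2 * dt by rewrite mulr_gt0.
have x21 : 0 < 2 * x + 1 by rewrite addr_gt0// mulr_gt0.
have Q0 : 0 <= Q by rewrite divr_ge0 ?(ltW dt20)// !mulr_ge0// ltW.
(* x / N keeps N accumulated errors below [x]. With eta <= 1, replacing |c| by |c| + eta raises the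
   energy by at most eta Q, which the last term keeps below [e]. *)
pose eta := Num.min (Num.min 1 (x / N%:R)) (e / (Q + 1)).
have Q10 : 0 < Q + 1 by rewrite ltr_wpDl.
have eta0 : 0 < eta by rewrite !lt_min ltr01 !divr_gt0.
have /and3P[eta1 etax etae] : [&& eta <= 1, eta <= x / N%:R & eta <= e / (Q + 1)].
  by rewrite /eta !ge_min !lexx ?orbT.
have cM : \sum_(j < n) \sum_(i < N) (`|c i j| + eta) ^+ 2 / (2 * dt) <= M + e.
  apply: (@le_trans _ _ (\sum_(j < n) \sum_(i < N) (c i j ^+ 2 / (2 * dt) + eta * (2 * x + 1) / (2 * dt)))).
    apply: ler_sum => j _; apply: ler_sum => i _; rewrite -mulrDl ler_pM2r ?invr_gt0//.
    rewrite -(real_normK (num_real (c i j))) sqrrD -addrA lerD2l mulrDr mulr1.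
    rewrite -mulr_natl; apply: lerD; last by rewrite expr2 ler_piMr// ltW.
    by rewrite [leRHS](_ : _ = 2 * (x * eta)); [rewrite ler_pM2l// ler_pM2r|ring].
  under eq_bigr do rewrite big_split/= sumr_const card_ord.
  rewrite big_split/= sumr_const card_ord -mulrnA; apply: lerD.
    rewrite exchange_big/= -(@ler_pM2l _ 2)//.
    apply: le_trans (fen _ (uniform_family N (ltW T0))); rewrite /energy_on big_map.
    rewrite [iota 0 N](_ : _ = index_iota 0 N); last by rewrite /index_iota subn0.
    rewrite big_mkord mulr_sumr; apply: eq_ler.
    apply: eq_bigr => i _; rewrite mulr_sumr; apply: eq_bigr => j _ /=.
    have dtE : dt * i.+1%:R - dt * i%:R = dt by rewrite gridS; ring.
    by rewrite -/dt dtE -/(c i j); move: (c i j) => z; field; rewrite gt_eqF.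
  rewrite [leLHS](_ : _ = eta * Q); last by rewrite -[LHS]mulr_natl natrM /Q; ring.
  move: etae; rewrite ler_pdivlMr//; apply: le_trans; rewrite ler_pM2l// lerDl//.
have [C2 C20 box] := grid_box T0 N0 hB hBindep c eta0.
pose Co := N%:R * n%:R * C1.
have Co0 : 0 <= Co by rewrite !mulr_ge0// ltW.
have Co1 : 0 < 2 * (Co + 1) by rewrite mulr_gt0// ltr_wpDl.
have C20' : 0 < C2 / 2 by exact: divr_gt0.
(* Below this value Co exp(-1/k) <= C2 / 2, so half of the main term survives. *)
pose del := Num.min 4 (C2 / (2 * (Co + 1))).
have del0 : 0 < del by rewrite lt_min; apply/andP; split => //; exact: divr_gt0.
apply: (limf_einf_exp C20' del0) => k k0; rewrite lt_min => /andP[/ltW k4 kC].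
have k04 : 0 < k <= 4 by rewrite k0.
have mO : measurable (omega k @^-1` O) by exact: solution_preimage_measurable.
have [E1 [mE1 PE1 E1H]] := solution_driver k04.
have [E2 [mE2 PE2 E2H]] := osc N k x N0 k0 x0.
have [] := box k k0 k4; set G := [set w | _] => mG PG.
have GO : (P G <= P (omega k @^-1` O) + P E2)%E.
  apply: (@le_trans _ _ (P (E1 `|` (omega k @^-1` O `|` E2)))); last first.
    apply: (@le_trans _ _ (P E1 + P (omega k @^-1` O `|` E2))%E).
      by apply: measureU2 => //; exact: measurableU.
    by rewrite PE1 add0e; exact: measureU2.
  apply: le_measure; rewrite ?inE//; first by do 2?apply: measurableU.
  move=> w Gw; apply: contrapT => /not_orP[nE1 /not_orP[nO nE2]].
  apply: nO; apply: rO; apply: stab => j t tT.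
  have [W [cW W0 WB w0 wW]] := E1H w nE1.
  have Wosc := E2H w nE2 W cW WB.
  have WN (i : nat) j' : (i <= N)%N -> W j' (dt * i%:R) = Num.sqrt k * B j' (dt * i%:R) w.
    by move=> iN; apply: WB; rewrite grid_ge0 gridT.
  have grid (i : nat) : (i <= N)%N -> `|W j (dt * i%:R) - (h j (dt * i%:R) - theta ord0 j)| <= i%:R * eta.
    elim: i => [_|i ih iN]; first by rewrite mulr0 W0 h0 subrr subr0 normr0 mul0r.
    have := Gw (Ordinal iN) j; rewrite /= mulrBr -!WN//; last exact: ltnW.
    rewrite /c => /ltW step; rewrite -[in leRHS]natr1 [leRHS]mulrDl mul1r.
    rewrite (_ : W j _ - _ = (W j (dt * i%:R) - (h j (dt * i%:R) - theta ord0 j)) +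
      (W j (dt * i.+1%:R) - W j (dt * i%:R) - (h j (dt * i.+1%:R) - h j (dt * i%:R)))); last by ring.
    by apply: le_trans (ler_normD _ _) _; apply: lerD => //; apply: ih; exact: ltnW.
  have [i it ti] := grid_cell T0 N0 tT; have /andP[t0 tT'] := tT.
  rewrite wW// (_ : _ - _ = (W j t - W j (dt * i%:R)) - (h j t - h j (dt * i%:R)) +
    (W j (dt * i%:R) - (h j (dt * i%:R) - theta ord0 j))); last by rewrite -/(h j t); ring.
  apply: le_trans (ler_normD _ _) _.
  apply: le_trans (lerD (ler_normB _ _) (grid i (ltnW (ltn_ord i)))) _.
  have h1 := Wosc i j t it ti.
  have h2 : `|h j t - h j (dt * i%:R)| <= x.
    by apply: h_osc => //; rewrite lerBlDl -gridS.
  have h3 : i%:R * eta <= x.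
    apply: (@le_trans _ _ (N%:R * eta)); first by rewrite ler_pM2r// ler_nat ltnW.
    by rewrite mulrC -ler_pdivlMr.
  have -> : dl = x + x + x by rewrite /x; field.
  by apply: lerD => //; apply: lerD.
have Pfin : P E2 \is a fin_num by exact: fin_num_measure.
have : ((C2 * expR (- ((M + e) / k)))%:E <= P (omega k @^-1` O) + (Co * expR (- ((M + e + 1) / k)))%:E)%E.
  apply: (@le_trans _ _ (P G)).
    apply: le_trans PG; rewrite lee_fin ler_pM2l// ler_expR lerN2 ler_pM2r ?invr_gt0//.
  apply: le_trans GO _; apply: leeD2l; apply: le_trans PE2 _.
  by rewrite lee_fin ler_wpM2l// ler_expR lerN2 ler_pM2r ?invr_gt0.
rewrite -leeBlDr// -EFinB; apply: le_trans; rewrite lee_fin.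
rewrite (_ : (M + e + 1) / k = (M + e) / k + k^-1); last by field; rewrite gt_eqF.
rewrite opprD expRD; set E := expR (- ((M + e) / k)); have E0 : 0 < E by exact: expR_gt0.
have k1 : Co * expR (- k^-1) <= C2 / 2.
  apply: (@le_trans _ _ (Co * k)); first by rewrite ler_wpM2l// expR_inv_le.
  apply: (@le_trans _ _ ((Co + 1) * k)); first by rewrite ler_pM2r// lerDl.
  move: kC; rewrite ltr_pdivlMr// => kC; rewrite ler_pdivlMr//; apply: ltW.
  by rewrite [ltLHS](_ : _ = k * (2 * (Co + 1)))//; ring.
have : Co * (E * expR (- k^-1)) <= C2 / 2 * E by rewrite mulrCA mulrC ler_pM2r.
by move=> h1; rewrite (_ : C2 * E = C2 / 2 * E + C2 / 2 * E); [lra|field].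
Qed.

(** For open sets only points of finite rate matter, and the slack [e] tends to 0. For closed sets
    the bound is obtained for every b strictly below the infimum, which also covers an infinite
    infimum. *)
Lemma dyson_satisfies_LDP :
  satisfies_LDP (fun k A => P (omega k @^-1` A)) (@dyson_rate R mu T n theta).
Proof.
split=> [U oU|F cF].
  rewrite leeNl; apply: le_ereal_inf_tmp => _ [f Uf <-]; rewrite leeNl.
  have := dyson_rate_ge0 mu theta f; case E: dyson_rate => [r| |] // _; last by rewrite leNye.
  rewrite leeNl; apply/lee_addgt0Pr => e e0; rewrite leeNl -EFinD -EFinN.
  by apply: (ldp_lower_level oU Uf) => //; rewrite /= E.
set I := ereal_inf _.
have I0 : (0 <= I)%E by apply: le_ereal_inf_tmp => _ [f _ <-]; exact: dyson_rate_ge0.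
have key a b : (a%:E < I)%E -> b < a ->
    (limf_esup (fun k : R => k%:E * lne (P (omega k @^-1` F))) 0^'+ <= (- b)%:E)%E.
  move=> aI; apply: ldp_upper_level => // f Ff; rewrite /= => fa.
  have : (I <= dyson_rate mu theta f)%E by apply: ereal_inf_lbound; exists f.
  by move=> /le_trans/(_ fa); rewrite leNgt aI.
case: I I0 key => [r _|_|//] key.
  apply/lee_addgt0Pr => e e0; rewrite -EFinN -EFinD.
  have := key (r - e / 2) (r - e); rewrite lte_fin (_ : - (r - e) = - r + e); last by ring.
  by apply; lra.
set L := limf_esup _ _ in key *.
(* With an infinite infimum every real is an upper bound of the limit; b = 1 - l contradicts a
   finite value l. *)
case: L key => [l|//|//] key.
  have : (l%:E <= (- (1 - l))%:E)%E by apply: (key (2 - l)); [exact: ltry|lra].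
  by rewrite lee_fin => h; exfalso; lra.
by have := key 1 0 (ltry _) ltr01.
Qed.

End dyson_ldp.

Theorem proposition1p6 (R : realType) (mu T : R) (hT : 0 < T)
    (n : nat) (hn : (1 <= n)%N) (theta : 'rV[R]_n) (htheta : chamber R n theta)
    (d : measure_display) (Omega : measurableType d) (P : probability Omega R)
    (B : 'I_n -> R -> Omega -> R)
    (hB : forall j, standard_brownian_motion P (B j))
    (hBindep : independent_processes P B)
    (omega : R -> Omega -> path_space T n)
    (homega : forall k : R, 0 < k <= 4 ->
       dyson_strong_solution mu theta P B k (omega k)) :
  good_rate_function (@dyson_rate R mu T n theta) /\
  satisfies_LDP (fun k A => P (omega k @^-1` A)) (@dyson_rate R mu T n theta).
Proof.
split; first exact: dyson_rate_good.
exact: (dyson_satisfies_LDP hT hB hBindep homega).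
Qed.
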